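(* Let $1\le l\le d$ and $z\in\mathbb{R}$. For $N\ge1$ let $B_N^l=[0,N-1]^l\times\{0\}^{d-l}\subset\mathbb{Z}^d$ and let $\mathcal{N}_N^{l,z}$ be the point process on $\mathbb{R}^d$ $$\mathcal{N}_N^{l,z}=\sum_{x\in B_N^l}\delta_{x/N}1_{\{U_x>g(0)\{\log|B_N^l|+z\}\}}.$$ Then $\mathcal{N}_N^{l,z}$ converges in law, as $N\to\infty$, to $\mathcal{N}^{l,z}$, where $\mathcal{N}^{l,z}$ is a Poisson point process with intensity $\exp(-z)\lambda_l$ and $\lambda_l$ is ($l$-dimensional) Lebesgue measure on $[0,1]^l\times\{0\}^{d-l}$.
   Context: Throughout $d\ge 3$; $|A|$ denotes the cardinality of a set $A$. Sets such as $[0,N-1]^l\times\{0\}^{d-l}$ regarded as subsets of $\mathbb{Z}^d$ consist of their integer points. Convergence in law of point processes is the usual one (weak convergence of laws of random point measures on $\mathbb{R}^d$ with the vague topology). $P_x$ is the law of simple random walk $(X_n)_{n\ge0}$ on $\mathbb{Z}^d$ started at $x$. The Green's function is $g(x,y)=\sum_{n\ge0}P_x(X_n=y)$ and $g(\cdot)=g(\cdot,0)$. For a finite set $K\subset\mathbb{Z}^d$ let $\tilde H_K=\inf\{n\ge1: X_n\in K\}$, $e_K(x)=P_x(\tilde H_K=\infty)1_K(x)$, and $\operatorname{cap}(K)=\sum_{x\in K}e_K(x)$. Random interlacements. Let $W$ be the space of doubly infinite nearest-neighbor paths $w:\mathbb{Z}\to\mathbb{Z}^d$ that spend finite time in bounded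 subsets of $\mathbb{Z}^d$, and let $W^\star=W/\sim$, where $w\sim v$ if $w(\cdot)=v(\cdot+N)$ for some $N\in\mathbb{Z}$. Let $\nu$ be the unique $\sigma$-finite measure on $W^\star$ such that for every finite $K\subset\mathbb{Z}^d$ the restriction of $\nu$ to the set of trajectories modulo time-shift that enter $K$ is the image under $W\to W^\star$ of the finite measure $Q_K$ on $W$ given by $Q_K[(w(-n))_{n\ge0}\in E, w(0)=x,(w(n))_{n\ge0}\in F]=P_x(E\mid\tilde H_K=\infty)\,e_K(x)\,P_x(F)$ (interpreted as $0$ if $e_K(x)=0$). Under $\mathbb{P}$, let $\omega=\sum_i\delta_{(w_i^\star,u_i)}$ be a Poisson point process on $W^\star\times[0,\infty)$ with intensity measure $\nu\otimes du$. The random interlacement at level $u\ge0$ is $\mathcal{I}^u=\bigcup_{i: u_i\le u}\operatorname{range}(w_i^\star)\subset\mathbb{Z}^d$, where $\operatorname{range}(w^\star)$ is the set of vertices visited by $w^\star$. For each $u$ its law is characterized by $\mathbb{P}(A\cap\mathcal{I}^u=\varnothing)=\exp(-u\operatorname{cap}(A))$ for all finite $A\subset\mathbb{Z}^d$. For $x\in\mathbb{Z}^d$, $U_x=\inf\{u\ge0: x\in\mathcal{I}^u\}$. *)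

(* Defs.v *)
From HB Require Import structures.
From mathcomp Require Import all_boot all_order all_algebra finmap.
From mathcomp Require Import all_classical all_reals all_analysis.
From mathcomp Require Import measurable_realfun.
Import Order.TTheory GRing.Theory Num.Theory.
Import numFieldNormedType.Exports.
Set Implicit Arguments.
Unset Strict Implicit.
Unset Printing Implicit Defensive.
Local Open Scope classical_set_scope.
Local Open Scope ring_scope.

HB.instance Definition _ := isPointed.Build int 0.

Notation lattice d := 'rV[int]_d.

Definition adjacent d (x y : lattice d) : bool :=
  \sum_(i < d) `|x 0 i - y 0 i| == 1.

Definition path_coord d : set (set (nat -> lattice d)) :=
  [set A | exists n y, A = [set w | w n = y]].

Definition path_space d := g_sigma_algebraType (@path_coord d).

Definition walk_step (R : realType) d (x y : lattice d) : R :=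
  if adjacent x y then (2 * d)%:R^-1 else 0.

Definition walk_law (R : realType) d (x : lattice d)
    (P : probability (path_space d) R) : Prop :=
  forall n (y : nat -> lattice d),
    P [set w : path_space d | forall i, (i <= n)%N -> w i = y i] =
    ((y 0%N == x)%:R * \prod_(i < n) walk_step R (y i) (y i.+1))%:E.

Section potential.
Context (R : realType) (d : nat).
Variable P : lattice d -> probability (path_space d) R.
Local Open Scope ereal_scope.

Definition green (x y : lattice d) : \bar R :=
  \sum_(n <oo) P x [set w : path_space d | w n = y].

Definition return_time (K : set (lattice d)) (w : path_space d) : \bar R :=
  ereal_inf [set n%:R%:E | n in [set n | (1 <= n)%N /\ K (w n)]].

Definition no_return (K : set (lattice d)) : set (path_space d) :=
  [set w | return_time K w = +oo].

Definition equilibrium (K : set (lattice d)) (x : lattice d) : \bar R :=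
  P x (no_return K) * (\1_K x)%:E.

End potential.

(* As x / 0 = 0, this is 0 when P A = 0. *)
Definition cond_prob d (T : measurableType d) (R : realType)
    (P : probability T R) (E A : set T) : \bar R :=
  (fine (P (E `&` A)) / fine (P A))%:E.

(* Doubly infinite paths are taken in dimension [d.+1]: the library requires
   measurable types to be inhabited. For the transience clause, recall that the
   bounded subsets of the lattice are the finite ones. *)
Record bipath d := Bipath {
  bipath_fun :> int -> lattice d.+1;
  bipath_adjacent : forall n, adjacent (bipath_fun n) (bipath_fun (n + 1));
  bipath_transient : forall K : set (lattice d.+1), finite_set K ->
    finite_set [set n | K (bipath_fun n)] }.

Lemma bipath_inhabited d : inhabited (bipath d).
Proof.
pose e (n : int) : lattice d.+1 := \row_i (if i == ord0 then n else 0).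
apply: inhabits; apply: (@Bipath _ e) => [n|K finK].
  rewrite /adjacent big_ord_recl big1 => [|i _].
    by rewrite !mxE eqxx opprD addNKr normrN normr1 addr0.
  by rewrite !mxE /= subr0 normr0.
apply: (@sub_finite_set _ _ ((fun m : lattice d.+1 => m 0 0) @` K)).
  by move=> n /= Kn; exists (e n) => //; rewrite mxE.
exact: finite_image.
Qed.

HB.instance Definition _ d := gen_eqMixin (bipath d).
HB.instance Definition _ d := gen_choiceMixin (bipath d).
HB.instance Definition _ d :=
  isPointed.Build (bipath d) (inhabited_witness (bipath_inhabited d)).

Definition bipath_coord d : set (set (bipath d)) :=
  [set A | exists n y, A = [set w : bipath d | w n = y]].

Definition bipath_space d := g_sigma_algebraType (@bipath_coord d).

Definition shift_rel d (w v : bipath d) : bool :=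
  `[< exists N : int, forall n, w n = v (n + N) >].

Lemma shift_equiv d : equiv_class_of (@shift_rel d).
Proof.
split.
- by move=> w; apply/asboolP; exists 0 => n; rewrite addr0.
- move=> w v; apply/asboolP/asboolP => -[N wv]; exists (- N) => n.
    by rewrite wv addrNK.
  by rewrite wv addrNK.
- move=> v w u /asboolP[N wv] /asboolP[M vu]; apply/asboolP.
  by exists (N + M) => n; rewrite wv vu addrA.
Qed.

Canonical shift_equiv_rel d := EquivRelPack (@shift_equiv d).

Definition trajectory d := {eq_quot (shift_equiv_rel d)}%qT.
HB.instance Definition _ d := Choice.on (trajectory d).
HB.instance Definition _ d :=
  isPointed.Build (trajectory d) (\pi_(trajectory d) point)%qT.

Definition to_trajectory d (w : bipath_space d) : trajectory d :=
  (\pi_(trajectory d) (w : bipath d))%qT.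

Definition trajectory_space d := g_sigma_algebraType
  (image_set_system setT (@to_trajectory d) measurable).

Definition traj_range d (w : trajectory d) : set (lattice d.+1) :=
  [set x | exists v n, to_trajectory v = w /\ (v : bipath d) n = x].

Section interlacement_intensity.
Context (R : realType) (d : nat).
Variable P : lattice d.+1 -> probability (path_space d.+1) R.
Local Open Scope ereal_scope.

Definition two_sided_measure (K : set (lattice d.+1))
    (Q : {finite_measure set (bipath_space d) -> \bar R}) : Prop :=
  forall x (E F : set (path_space d.+1)), measurable E -> measurable F ->
    Q [set w : bipath_space d | [/\ E (fun n : nat => (w : bipath d) (- n%:Z)%R),
          (w : bipath d) 0%R = x & F (fun n : nat => (w : bipath d) n%:Z)]] =
    cond_prob (P x) E (no_return R K) * equilibrium P K x * P x F.

Definition interlacement_intensity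
    (nu : {sigma_finite_measure set (trajectory_space d) -> \bar R}) : Prop :=
  forall K : set (lattice d.+1), finite_set K ->
  exists2 Q, two_sided_measure K Q &
    forall A : set (trajectory_space d), measurable A ->
      nu (A `&` [set w | traj_range w `&` K !=set0]) =
      pushforward Q (@to_trajectory d : _ -> trajectory_space d) A.

End interlacement_intensity.

(* A countable family of points, possibly with repetitions; the terms equal to
   [None] are no points, so that the family may be finite. *)
Definition config (T : Type) := nat -> option T.

Definition config_measure d (T : measurableType d) (R : realType)
    (c : config T) : {measure set T -> \bar R} :=
  mseries (fun n => if c n is Some x then \d_x : {measure set T -> \bar R}
                    else mzero) 0.

Section poisson_process.
Context dO (Omega : measurableType dO) d (T : measurableType d) (R : realType).
Variables (P : probability Omega R) (N : Omega -> set T -> \bar R).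
Variable mu : set T -> \bar R.
Local Open Scope ereal_scope.

Definition poisson_process : Prop :=
  [/\ forall B, measurable B -> measurable_fun setT (fun s => N s B),
      forall B, measurable B -> mu B < +oo -> forall k : nat,
        P [set s | N s B = k%:R%:E] =
        (expR (- fine (mu B)) * fine (mu B) ^+ k / k`!%:R)%:E,
      forall B, measurable B -> mu B = +oo -> P [set s | N s B = +oo] = 1
    & forall n (B : 'I_n -> set T), (forall i, measurable (B i)) ->
        trivIset setT B ->
        forall A : 'I_n -> set (\bar R), (forall i, measurable (A i)) ->
        P [set s | forall i, A i (N s (B i))] =
        \prod_(i < n) P [set s | A i (N s (B i))] ].

End poisson_process.

Section interlacements.
Context (R : realType) (d : nat).
Local Open Scope ereal_scope.

Notation labelled := (trajectory_space d * measurableTypeR R)%type.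

(* The label space [0, +oo[ is rendered as R, with Lebesgue measure restricted
   to [0, +oo[ and all labels required to be nonnegative. *)
Definition level_measure : set (measurableTypeR R) -> \bar R :=
  mrestr lebesgue_measure (measurable_itv `[0%R, +oo[).

Definition interlacement_process dO (Omega : measurableType dO)
    (P : probability Omega R)
    (nu : {sigma_finite_measure set (trajectory_space d) -> \bar R})
    (omega : Omega -> config labelled) : Prop :=
  poisson_process P (fun s => config_measure R (omega s)) (nu \x level_measure)
  /\ forall s i w u, omega s i = Some (w, u) -> (0 <= u)%R.

Definition interlacement (c : config labelled) (u : R) : set (lattice d.+1) :=
  [set x | exists i w v, [/\ c i = Some (w, v), (v <= u)%R & traj_range w x]].

(* The infimum is +oo when x is never covered. *)
Definition cover_level (c : config labelled) (x : lattice d.+1) : \bar R :=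
  ereal_inf [set u%:E | u in [set u : R | (0 <= u)%R /\ interlacement c u x]].

End interlacements.

Definition borel (R : realType) d := g_sigma_algebraType (@open 'rV[R]_d).

Record point_measure (R : realType) d := PointMeasure {
  point_measure_val :> {measure set (borel R d) -> \bar R};
  point_measure_config : exists c : config (borel R d),
    forall A, measurable A -> point_measure_val A = config_measure R c A;
  point_measure_locfin : forall K : set 'rV[R]_d, compact K ->
    (point_measure_val K < +oo)%E }.

HB.instance Definition _ R d := gen_eqMixin (point_measure R d).
HB.instance Definition _ R d := gen_choiceMixin (point_measure R d).

Definition test_function (R : realType) d :=
  {f : 'rV[R]_d -> R | continuous f /\
    exists2 K : set 'rV[R]_d, compact K & forall x, ~ K x -> f x = 0}.

HB.instance Definition _ R d := gen_eqMixin (test_function R d).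
HB.instance Definition _ R d := gen_choiceMixin (test_function R d).

(* The vague topology is the coarsest topology for which all the maps
   mu |-> \int[mu]_x f x, with f continuous of compact support, are continuous. *)
Definition pairing (R : realType) d (mu : point_measure R d) :
    {ptws test_function R d -> R} :=
  fun f => \int[mu]_x (sval f x).

HB.instance Definition _ R d := Topological.copy (point_measure R d)
  (initial_topology (@pairing R d)).

Definition cvg_in_law (R : realType) (S : topologicalType)
    dO (Omega : measurableType dO) (P : probability Omega R)
    (X : nat -> Omega -> S)
    dO' (Omega' : measurableType dO') (P' : probability Omega' R)
    (Y : Omega' -> S) : Prop :=
  forall F : S -> R, continuous F -> (exists M, forall s, `|F s| <= M) ->
    ('E_P[F \o X n])%E @[n --> \oo] --> ('E_P'[F \o Y])%E.

Lemma config_measure_onth d (T : measurableType d) (R : realType) (s : seq T) A :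
  config_measure R (onth s) A = (\sum_(x <- s) \d_x A)%E.
Proof.
rewrite /config_measure /= /mseries (@nneseries_split _ _ 0 (size s))//.
rewrite add0n [X in (_ + X)%E]eseries0 ?adde0; last first.
  by move=> k sk _; rewrite onth_default.
case: s => [|x0 s]; first by rewrite big_geq// big_nil.
rewrite [RHS](big_nth x0); apply: eq_big_nat => k /andP[_ ks].
by rewrite -(odflt_onth x0); move: (onthTE (x0 :: s) k); rewrite ks; case: onth.
Qed.

Lemma seq_point_measure_config (R : realType) d (s : seq (borel R d)) :
  exists c : config (borel R d), forall A, measurable A ->
    config_measure R (onth s) A = config_measure R c A.
Proof. by exists (onth s). Qed.

Lemma seq_point_measure_locfin (R : realType) d (s : seq (borel R d))
  (K : set 'rV[R]_d) : compact K -> (config_measure R (onth s) K < +oo)%E.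
Proof.
move=> _; rewrite config_measure_onth; apply: lte_sum_pinfty => x _.
by rewrite diracE ltry.
Qed.

Definition seq_point_measure (R : realType) d (s : seq (borel R d)) :
    point_measure R d :=
  @PointMeasure R d (config_measure R (onth s))
    (seq_point_measure_config s) (@seq_point_measure_locfin R d s).

Definition box d (l N : nat) : set (lattice d) :=
  [set x | (forall i : 'I_d, (i < l)%N -> 0 <= x 0 i <= N%:Z - 1) /\
           (forall i : 'I_d, (l <= i)%N -> x 0 i = 0)].

Definition box_fset d l N : {fset lattice d} := fset_set (@box d l N).

Definition rescale (R : realType) d (N : nat) (x : lattice d) : borel R d :=
  \row_i ((x 0 i)%:~R / N%:R).

Definition uncovered_process (R : realType) d (l N : nat) (z : R)
    (P : lattice d.+1 -> probability (path_space d.+1) R)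
    (c : config (trajectory_space d * measurableTypeR R)) :
    point_measure R d.+1 :=
  seq_point_measure [seq rescale R N x | x <- box_fset d.+1 l N &
    (green P 0 0 * (ln #|` box_fset d.+1 l N|%:R + z)%:E < cover_level c x)%E].

Fixpoint lebesgue_tuple (R : realType) (l : nat) :
    set (l.-tuple (measurableTypeR R)) -> \bar R :=
  match l with
  | 0 => \d_[tuple]
  | k.+1 => pushforward (lebesgue_measure \x @lebesgue_tuple R k)%E
              (fun p : measurableTypeR R * k.-tuple (measurableTypeR R) =>
                 [tuple of p.1 :: p.2])
  end.

(* Since [nth] has default value 0, the row below pads t with zeros: this is the
   image of l-dimensional Lebesgue measure on [0, 1]^l. *)
Definition lebesgue_cube (R : realType) d (l : nat) (A : set (borel R d)) :
    \bar R :=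
  lebesgue_tuple [set t : l.-tuple (measurableTypeR R) |
    (forall i, 0 <= tnth t i <= 1) /\
    A (\row_(i < d) nth (0 : R) t i)].

(* Main.v *)
(** Write g for the Green's function and u = g(0) (log N^l + z). The function
(|x|^2 + c)^(-1/3) is superharmonic for the walk when d >= 3 and c is large, and
this gives g(x) <= g(0) ((|x|^2 + c) / c)^(-1/3). Decomposing a path at its last
visit to a finite set K yields sum_(y in K) g(x,y) e_K(y) = 1 for x in K, hence
cap {x} = 1 / g(0) and cap {x, y} = 2 / (g(0) + g(x - y)). Each site is therefore
uncovered at level u with probability e^-z / N^l, and two distant sites are nearly
independent.

Let S be the set of uncovered sites. Given x in S, the set S has the law of the
set S'_x of sites missed by the trajectories that avoid x; S'_x contains S and is
independent of the event that x is in S. Comparing S'_x with S site by site gives,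
for the vector W of cell counts, an approximate recursion
m_j P(W = m) = lambda_j P(W = m - e_j) whose error is controlled by pair
probabilities only and tends to 0; its solution is the product Poisson law.

A bounded continuous functional of a point measure carried by [0,1)^l x {0} is
close, by compactness, to the same functional of the measure obtained by moving
every point to the corner of its cell in a fine grid. So expectations are
determined, up to a small error, by the laws of the cell counts. *)

Require Import Defs.
From HB Require Import structures.
From mathcomp Require Import all_boot all_order all_algebra finmap.
From mathcomp Require Import all_classical all_reals all_analysis.
From mathcomp Require Import measurable_realfun.
From mathcomp Require Import ring lra zify.
Import Order.TTheory GRing.Theory Num.Theory.
Import numFieldNormedType.Exports.
Local Open Scope classical_set_scope.
Local Open Scope ring_scope.
Set Implicit Arguments.
Unset Strict Implicit.
Unset Printing Implicit Defensive.

(** * Simple random walk *)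

Section unit_steps.
Context (d : nat).
Implicit Types (x y : lattice d) (k : 'I_d * bool).

(** In the continuum |x|^(-2/3) is superharmonic with room to spare for d >= 3, since 2/3 < d - 2.
    This slack absorbs the lattice corrections once c is large, and one argument serves all d and l.
    The sum over pairs is cut at a distance that is a small power of N. Below it, g(x) <= rho g(0)
    for all x <> 0 with a fixed rho < 1, and this beats the number of near pairs; above it, the
    decay of g beats the level, which grows only like log N.

    The approximate recursion leaves P(W = 0) undetermined. Normalization fixes it, the bounded mean
    number of uncovered sites preventing a loss of mass.

    A continuous functional F sees a measure only through its pairings with test functions. Measures
    with t atoms are images of t-tuples of points, so at fixed t the compactness needed is that of
    tuples in the unit cube, and no metric for the vague topology is introduced. The composite of F
    with the process is not assumed measurable: its expectation is squeezed between integrals of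
    step functions of the cell counts. *)

Definition unit_step k : lattice d :=
  \row_j (if j == k.1 then (-1) ^+ k.2 else 0).

Lemma unit_step_flip k : unit_step (k.1, ~~ k.2) = - unit_step k.
Proof.
apply/rowP => j; rewrite !mxE/=.
by case: eqP => _; [case: k.2; rewrite ?opprK|rewrite oppr0].
Qed.

Lemma unit_step_inj : injective unit_step.
Proof.
move=> [i b] [j c] /rowP e.
have := e i; rewrite !mxE/= eqxx; case: eqVneq => [<- |_].
  by case: b {e}; case: c.
by case: b {e}.
Qed.

Lemma adjacentP x y : reflect (exists k, y = x + unit_step k) (Defs.adjacent x y).
Proof.
apply: (iffP idP) => [|[k ->]].
  rewrite /Defs.adjacent => xy1.
  have : (\sum_(i < d) absz (x 0 i - y 0 i)%R == 1)%N.
    suff: (\sum_(i < d) absz (x 0 i - y 0 i)%R)%N%:~R == 1 :> int by rewrite intz.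
    rewrite sumMz; apply/eqP; rewrite -[RHS](eqP xy1); apply: eq_bigr => i _.
    by rewrite intz abszE.
  move/sum_nat_eq1 => [i [_ xyi xyj]].
  exists (i, x 0 i - y 0 i == 1); apply/rowP => j; rewrite !mxE/=.
  have [->{j}|ji] := eqVneq j i.
    by case: eqP => e; rewrite ?expr1 ?expr0; lia.
  by have := xyj _ ji isT; lia.
rewrite /Defs.adjacent (bigD1 k.1)//= !mxE eqxx big1 => [|j jk].
  by case: k.2 => /=; rewrite addr0 opprD addNKr normrN ?normrN1 ?normr1.
by rewrite !mxE (negbTE jk) addr0 subrr normr0.
Qed.

Lemma sum_unit_step (V : nmodType) (F : lattice d -> V) :
  \sum_k F (- unit_step k) = \sum_k F (unit_step k).
Proof.
pose h k : 'I_d * bool := (k.1, ~~ k.2).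
have hK : involutive h by move=> -[i b]; rewrite /h/= negbK.
rewrite (reindex_inj (inv_inj hK)); apply: eq_bigr => k _.
by rewrite -unit_step_flip /= negbK; case: k.
Qed.

End unit_steps.

Section walk_step_sum.
Context (R : realType) (d : nat).

Lemma walk_stepE (x y : lattice d) :
  walk_step R x y = (2 * d)%:R^-1 * \sum_(k : 'I_d * bool) (y == x + unit_step k)%:R.
Proof.
rewrite /walk_step; case: adjacentP => [[k ->]|nxy].
  rewrite (bigD1 k)//= eqxx big1 ?addr0 ?mulr1// => j jk.
  by rewrite (inj_eq (@addrI _ _)) (inj_eq (@unit_step_inj _)) eq_sym (negbTE jk).
rewrite big1 ?mulr0// => k _; case: eqP => // e.
by case: nxy; exists k.
Qed.

End walk_step_sum.

Lemma probability_setI_full disp (T : measurableType disp) (R : realType)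
    (mu : probability T R) (A B : set T) :
  measurable A -> measurable B -> mu A = 1%E -> mu (B `&` A) = mu B.
Proof.
move=> mA mB A1; have mAC := measurableC mA.
have : mu (B `&` ~` A) = 0%E.
  apply/eqP; rewrite eq_le measure_ge0 andbT.
  rewrite (le_trans (le_measure mu _ _ (@subIsetr _ B (~` A))))// ?inE//.
    exact: measurableI.
  by rewrite [leLHS](probability_setC mu mA) A1 subee.
move=> B0; rewrite -[in RHS](setUIDK B A).
by apply/esym/measureU0 => //; [exact: measurableI|exact: measurableD].
Qed.

Section walk.
Context (R : realType) (d : nat).
Local Notation path := (path_space d.+1).
Implicit Types (x y v : lattice d.+1).

Lemma measurable_path_eq n y : measurable [set w : path | w n = y].
Proof. by apply: sub_sigma_algebra; exists n, y. Qed.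

Lemma measurable_path_in n (A : set (lattice d.+1)) :
  measurable [set w : path | A (w n)].
Proof.
have -> : [set w : path | A (w n)] =
    \bigcup_y [set w : path | A y /\ w n = y].
  apply/seteqP; split => [w Aw|w [y _ [/= Ay wy]]]; first by exists (w n).
  by rewrite /= wy.
apply: countable_bigcupT_measurable => [|y]; first exact: countableP.
have [Ay|Ay] := pselect (A y).
  have -> : [set w : path | A y /\ w n = y] = [set w | w n = y].
    by apply/seteqP; split => w //= [].
  exact: measurable_path_eq.
have -> : [set w : path | A y /\ w n = y] = set0 by apply/seteqP; split => w //= [].
exact: measurable0.
Qed.

Definition shift_path k (w : path) : path := fun n => w (n + k)%N.

Lemma measurable_shift_path k : measurable_fun setT (shift_path k).
Proof.
apply: (@measurability _ _ path path setT (shift_path k) (@path_coord d.+1)) => //.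
move=> _ [_ [n [y ->]] <-]; rewrite setTI.
exact: (measurable_path_eq (n + k) y).
Qed.

Lemma measurable_shift_preimage k (E : set path) : measurable E ->
  measurable (shift_path k @^-1` E).
Proof. by move=> mE; rewrite -[X in measurable X]setTI; exact: measurable_shift_path. Qed.

Definition cylinder n (f : nat -> lattice d.+1) : set path :=
  [set w | forall i, (i <= n)%N -> w i = f i].

Lemma measurable_cylinder n f : measurable (cylinder n f).
Proof.
have -> : cylinder n f = \bigcap_(i in `I_n.+1) [set w : path | w i = f i].
  by apply/seteqP; split => w /= wy i; exact: wy.
apply: bigcap_measurable => [|i _]; first by exists 0%N.
exact: measurable_path_eq.
Qed.

(** A pi-system, since two cylinders are nested or disjoint: [set0] closes it under intersection,
    and [setT] is the exhausting set in the uniqueness theorem for measures. *)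
Definition cylinders : set (set path) :=
  [set A | A = set0 \/ A = setT \/ exists n f, A = cylinder n f].

Lemma cylinders_setI : setI_closed cylinders.
Proof.
move=> A B [->|[->|[n [y ->]]]] CB; rewrite ?set0I ?setTI//; first by left.
case: CB => [->|[->|[m [z ->]]]]; rewrite ?setI0 ?setIT; first by left.
  by right; right; exists n, y.
wlog nm : n m y z / (n <= m)%N => [H|].
  case/orP: (leq_total n m) => nm; first exact: H.
  by rewrite setIC; exact: H.
have [yz|/existsNP[i]] := pselect (forall i, (i <= n)%N -> y i = z i).
  right; right; exists m, z; apply/seteqP; split => [w [] //|w wz].
  by split => // i i_n; rewrite yz// wz// (leq_trans i_n).
move=> /not_implyP[i_n yz]; left; apply/seteqP; split => // w [wy wz].
by apply: yz; rewrite -wy// wz// (leq_trans i_n).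
Qed.

Lemma measurable_cylinders : @measurable _ path = <<s cylinders >>.
Proof.
apply/seteqP; split; last first.
  apply: smallest_sub; first exact: sigma_algebra_measurable.
  move=> _ [->|[->|[n [y ->]]]]; [exact: measurable0|exact: measurableT|].
  exact: measurable_cylinder.
apply: smallest_sub; first exact: smallest_sigma_algebra.
move=> _ [n [y ->]].
pose G := g_sigma_algebraType cylinders.
(* A coordinate event is a union of cylinders over all prefixes ending in [y], countably many
   because the lattice is countable. *)
have -> : [set w : path | w n = y] = \bigcup_(s : n.+1.-tuple (lattice d.+1))
    (if tnth s ord_max == y then cylinder n (nth 0 s) else set0).
  apply/seteqP; split => [w /= wn|w [s _]].
    exists [tuple w i | i < n.+1] => //=.
    rewrite tnth_mktuple/= wn eqxx => i i_n.
    by rewrite -[i]/(nat_of_ord (Ordinal (i_n : (i < n.+1)%N))) nth_mktuple.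
  by case: eqP => // <- /(_ n (leqnn n)) /= ->; rewrite (tnth_nth 0).
apply: (@countable_bigcupT_measurable _ G) => [|s]; first exact: countableP.
case: eqP => _; last exact: measurable0.
by apply: sub_sigma_algebra; right; right; exists n, (nth 0 s).
Qed.

Variable P : lattice d.+1 -> probability path R.
Hypothesis P_walk : forall x, walk_law x (P x).

Lemma walk_start x : P x [set w : path | w 0%N = x] = 1%E.
Proof.
have := P_walk x 0 (fun=> x); rewrite big_ord0 eqxx mulr1 => <-.
congr (P x _); apply/seteqP; split => [w /= wx i|w /= ->//].
by rewrite leqn0 => /eqP ->.
Qed.

(** Both sides are finite measures in [E] and agree on cylinders by [walk_law]. *)
Lemma walk_markov1 x (E : set path) : measurable E ->
  P x (shift_path 1 @^-1` E) =
  (((2 * d.+1)%:R^-1)%:E * \sum_k P (x + unit_step k) E)%E.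
Proof.
have c_ge0 : 0 <= (2 * d.+1)%:R^-1 :> R by rewrite invr_ge0.
pose k0 : 'I_d.+1 * bool := (ord0, true).
pose s := enum {: 'I_d.+1 * bool}.
have sz : size s = (2 * d.+1)%N by rewrite -cardE card_prod card_ord card_bool mulnC.
pose m2 : {measure set path -> \bar R} := mscale (NngNum c_ge0)
  (msum (fun i => P (x + unit_step (nth k0 s i))) (2 * d.+1)).
have m2E A : m2 A = (((2 * d.+1)%:R^-1)%:E * \sum_k P (x + unit_step k) A)%E.
  rewrite /m2 /= /mscale /= /msum; congr (_ * _)%E.
  have -> : (\sum_k P (x + unit_step k) A =
      \sum_(k <- s) P (x + unit_step k) A)%E by rewrite big_enum.
  by rewrite (big_nth k0) big_mkord sz.
move=> mE; rewrite -m2E.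
pose m1 : {measure set path -> \bar R} := pushforward (P x) (shift_path 1).
rewrite -[LHS]/(m1 (measurable_shift_path 1) E).
apply: (measure_unique cylinders (fun=> setT)) => //.
- exact: measurable_cylinders.
- exact: cylinders_setI.
- by move=> _; right; left.
- by rewrite bigcup_const.
- move=> A [->|[->|[n [y ->]]]]; rewrite ?measure0//.
    rewrite [LHS]probability_setT m2E.
    under eq_bigr do rewrite probability_setT.
    rewrite sumEFin -EFinM big_const iter_addr addr0 card_prod card_ord card_bool.
    by rewrite -mulr_natl mulr1 mulnC mulVf// pnatr_eq0.
  rewrite m2E [LHS](_ : _ = P x (shift_path 1 @^-1` cylinder n y)); last by [].
  (* The walk starts at [x] almost surely; prefixing [x] turns the shifted cylinder into a
     cylinder. *)
  rewrite -(probability_setI_full (measurable_path_eq 0 x))//; last 2 first.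
  - by apply: measurable_shift_preimage; exact: measurable_cylinder.
  - exact: walk_start.
  pose y' i := if i is j.+1 then y j else x.
  have -> : shift_path 1 @^-1` cylinder n y `&` [set w : path | w 0%N = x] =
      cylinder n.+1 y'.
    apply/seteqP; split => [w [/= wy wx] [|i]//= i_n|w /= wy].
      by rewrite -(wy i)// /shift_path addn1.
    split; last by rewrite (wy 0%N).
    by move=> i i_n; rewrite /shift_path addn1 wy.
  rewrite P_walk eqxx mul1r big_ord_recl/= walk_stepE.
  under [in RHS]eq_bigr do rewrite P_walk.
  by rewrite sumEFin -EFinM -mulrA mulr_suml.
- by move=> _; rewrite [ltLHS]probability_setT ltry.
Qed.

(** The n-step transition probability as a function of the displacement alone ([walk_marginal]), by
    recursion over the first step. In this form translation invariance is built in and symmetry is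
    an easy induction. *)
Fixpoint walk_prob n v : R :=
  if n is m.+1 then (2 * d.+1)%:R^-1 * \sum_k walk_prob m (v - unit_step k)
  else (v == 0)%:R.

Lemma walk_prob_ge0 n v : 0 <= walk_prob n v.
Proof.
elim: n v => [|n ih] v /=; first exact: ler0n.
by rewrite mulr_ge0 ?invr_ge0// sumr_ge0.
Qed.

Lemma walk_probN n v : walk_prob n (- v) = walk_prob n v.
Proof.
elim: n v => [|n ih] v /=; first by rewrite oppr_eq0.
congr (_ * _); under eq_bigr do rewrite -ih opprB opprK.
by rewrite -(sum_unit_step (fun k => walk_prob n (k + v))); apply: eq_bigr => k _; rewrite addrC.
Qed.

(** The Markov property at a fixed time. [E = setT] gives the marginals, [E = no_return] the
    last-exit decomposition. *)
Lemma walk_markov n x y (E : set path) : measurable E ->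
  P x ([set w : path | w n = y] `&` shift_path n @^-1` E) =
  ((walk_prob n (y - x))%:E * P y E)%E.
Proof.
move=> mE; elim: n x => [|n ih] x.
  have -> : shift_path 0 @^-1` E = E.
    have e w : shift_path 0 w = w by apply/funext => i; rewrite /shift_path addn0.
    by apply/seteqP; split => w; rewrite /= e.
  rewrite /= subr_eq0; have [->|yx] := eqVneq y x.
    rewrite mul1e setIC probability_setI_full//; first exact: measurable_path_eq.
    exact: walk_start.
  rewrite mul0e -(probability_setI_full (measurable_path_eq 0 x)).
  - rewrite (_ : _ `&` _ = set0) ?measure0//.
    by apply/seteqP; split => // w [[/= -> _]] /eqP; rewrite (negbTE yx).
  - by apply: measurableI => //; exact: measurable_path_eq.
  - exact: walk_start.
rewrite [X in P x X](_ : _ = shift_path 1 @^-1`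
    ([set w : path | w n = y] `&` shift_path n @^-1` E)); last first.
  have e w : shift_path n (shift_path 1 w) = shift_path n.+1 w.
    by apply/funext => i; rewrite /shift_path -addnA addn1.
  have e1 w : shift_path 1 w n = w n.+1 by rewrite /shift_path addn1.
  by apply/seteqP; split => w; rewrite /= e e1.
rewrite walk_markov1; last first.
  by apply: measurableI; [exact: measurable_path_eq|exact: measurable_shift_preimage].
under eq_bigr do rewrite ih opprD addrA.
by rewrite -ge0_sume_distrl// => [|k _]; rewrite ?sumEFin ?muleA// lee_fin walk_prob_ge0.
Qed.

Lemma walk_marginal n x y :
  P x [set w : path | w n = y] = (walk_prob n (y - x))%:E.
Proof.
have := @walk_markov n x y setT measurableT.
by rewrite preimage_setT setIT probability_setT mule1.
Qed.

End walk.

(** * Green function and last exits *)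

Section superharmonic.
Context (R : realType).

(** Cubing reduces the claim to (1 + t) q^3 >= 1 for the quadratic q on the right. The Taylor
    coefficient of t^2 is 2/9 < 6/25; the surplus 3 (6/25 - 2/9) = 4/75 is the constant term of ((1
    + t) q^3 - 1) / t^2 and dominates the other terms when |t| <= 1/20. *)
Lemma powR_third_upper (t : R) : `|t| <= 20^-1 ->
  (1 + t) `^ (- 3^-1) <= 1 - t / 3 + 6 / 25 * t ^+ 2.
Proof.
rewrite ler_norml => /andP[t_ge t_le].
have t1 : 0 < 1 + t by lra.
set q := (X in _ <= X).
have tX n : `|t ^+ n| <= 20^-1 ^+ n.
  by rewrite normrX lerXn2r ?nnegrE// ler_norml; apply/andP; split.
have [t2 t3 t4 t5] := And4 (tX 2) (tX 3) (tX 4) (tX 5).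
have e n : 20^-1 ^+ n.+2 <= 400^-1 :> R.
  have -> : 20^-1 ^+ n.+2 = 20^-1 ^+ n * 20^-1 ^+ 2 :> R by rewrite -exprD addn2.
  have -> : 400^-1 = 1 * 20^-1 ^+ 2 :> R by field.
  by rewrite ler_wpM2r ?sqr_ge0// exprn_ile1//; lra.
have [e2 e3 e4 e5] := And4 (e 0) (e 1) (e 2) (e 3).
have {t2 e2}/andP[t2_ge t2_le] : - 400^-1 <= t ^+ 2 <= 400^-1.
  by rewrite -ler_norml (le_trans t2).
have {t3 e3}/andP[t3_ge t3_le] : - 400^-1 <= t ^+ 3 <= 400^-1.
  by rewrite -ler_norml (le_trans t3).
have {t4 e4}/andP[t4_ge t4_le] : - 400^-1 <= t ^+ 4 <= 400^-1.
  by rewrite -ler_norml (le_trans t4).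
have {t5 e5}/andP[t5_ge t5_le] : - 400^-1 <= t ^+ 5 <= 400^-1.
  by rewrite -ler_norml (le_trans t5).
have t2_ge0 : 0 <= t ^+ 2 := sqr_ge0 t.
have q_gt0 : 0 < q by rewrite /q; lra.
have q3 : 1 <= (1 + t) * q ^+ 3.
  rewrite -subr_ge0.
  have -> : (1 + t) * q ^+ 3 - 1 = t ^+ 2 * (4 / 75 + 362 / 675 * t
    - 4459 / 16875 * t ^+ 2 + 122 / 625 * t ^+ 3 - 684 / 15625 * t ^+ 4
    + 216 / 15625 * t ^+ 5) by rewrite /q; field.
  apply: mulr_ge0; [exact: t2_ge0|clear q q_gt0 tX t1 t2_ge0].
  move: (t ^+ 2) (t ^+ 3) (t ^+ 4) (t ^+ 5) t2_ge t2_le t3_ge t3_le t4_ge t4_le t5_ge t5_le.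
  by move=> t2 t3 t4 t5 *; lra.
have y3 : ((1 + t) `^ (- 3^-1)) ^+ 3 = (1 + t)^-1.
  rewrite -powR_mulrn ?powR_ge0// -powRrM mulNr mulVf ?pnatr_eq0//.
  by rewrite powR_inv1// ltW.
suff : ((1 + t) `^ (- 3^-1)) ^+ 3 <= q ^+ 3.
  by rewrite ler_pXn2r// nnegrE ?powR_ge0 ?(ltW q_gt0).
by rewrite y3 -[_^-1]mul1r ler_pdivrMr ?t1// mulrC.
Qed.

(** Here [s] is |v|^2 + c and [a] a coordinate of v. Expanding (|a| - 20)^2 >= 0 gives 2 |a| <= a^2
    / 20 + 20, and 21 <= c / 20. *)
Lemma walk_increment_bound (a c s e : R) : 1000 <= c -> a ^+ 2 <= s - c ->
  e = 1 \/ e = -1 -> - (20^-1 * s) <= 1 + 2 * e * a <= 20^-1 * s.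
Proof.
move=> c_ge a_le e1; have := sqr_ge0 (a - 20); have := sqr_ge0 (a + 20) => a1 a2.
by case: e1 => ->; apply/andP; split; lra.
Qed.

(** The numerator left over in [potential_superharmonic]. For large s its main term is (50 D - 144)
    s, positive for D >= 3 but not for D = 2: this is where the dimension enters. *)
Lemma superharmonic_slack (D c s : R) : 3 <= D -> 1000 <= c -> 1000 <= s ->
  0 <= 50 * D * s - 36 * D - 144 * s + 144 * c.
Proof.
move=> D3 c_ge s_ge.
have Ds : 0 <= (D - 3) * (s - 1000) by rewrite mulr_ge0 ?subr_ge0.
lra.
Qed.

Variables (d : nat) (c : R).
Hypothesis c_ge : 1000 <= c.

Let c_gt0 : 0 < c. Proof. by apply: lt_le_trans c_ge; rewrite ltr0n. Qed.

Definition sqnorm (v : lattice d.+1) : R := \sum_i (v 0 i)%:~R ^+ 2.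

Lemma sqnorm_ge0 v : 0 <= sqnorm v.
Proof. by apply: sumr_ge0 => i _; rewrite sqr_ge0. Qed.

Lemma sqnorm0 : sqnorm 0 = 0.
Proof. by rewrite /sqnorm big1// => i _; rewrite mxE expr0n. Qed.

Lemma sqnorm_ge1 v : v != 0 -> 1 <= sqnorm v.
Proof.
move=> v0; have [i vi] : exists i, v 0 i != 0.
  apply/existsP; apply: contraR v0; rewrite negb_exists => /forallP v0.
  by apply/eqP/rowP => i; rewrite mxE; apply/eqP; have := v0 i; rewrite negbK.
rewrite /sqnorm (bigD1 i)//= ler_wpDr//; first by apply: sumr_ge0 => j _; rewrite sqr_ge0.
by rewrite -rmorphXn/= ler1z -gtz0_ge1 exprn_even_gt0.
Qed.

Lemma sqnorm_step v k : sqnorm (v + unit_step k) =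
  sqnorm v + 1 + 2 * (-1) ^+ k.2 * (v 0 k.1)%:~R.
Proof.
rewrite /sqnorm (bigD1 k.1)//= [in RHS](bigD1 k.1)//=.
have -> : \sum_(i < d.+1 | i != k.1) ((v + unit_step k) 0 i)%:~R ^+ 2 =
    \sum_(i < d.+1 | i != k.1) (v 0 i)%:~R ^+ 2 :> R.
  by apply: eq_bigr => i ik; rewrite !mxE (negbTE ik) addr0.
rewrite !mxE eqxx; move: (\sum_(i < _ | _) _) => S.
rewrite rmorphD/= rmorphXn/= rmorphN1.
have : ((-1) ^+ k.2 : R) ^+ 2 = 1 by rewrite sqrr_sign.
set e := (-1) ^+ _; set a := _%:~R => e2.
by rewrite sqrrD e2; ring.
Qed.

(* With c >= 1000 the relative increments of sqnorm + c along a step are at most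
   1/20, the range of the expansion in [powR_third_upper]. *)
Definition potential (v : lattice d.+1) : R := ((sqnorm v + c) / c) `^ (- 3^-1).

Lemma potential_gt0 v : 0 < potential v.
Proof. by rewrite powR_gt0// divr_gt0// ltr_wpDl ?sqnorm_ge0. Qed.

Lemma potential0 : potential 0 = 1.
Proof. by rewrite /potential sqnorm0 add0r divff ?gt_eqF// powR1. Qed.

Lemma potential_le u v : sqnorm u <= sqnorm v -> potential v <= potential u.
Proof.
move=> uv; rewrite /potential !powRN lef_pV2 ?posrE; last 2 first.
- by rewrite powR_gt0// divr_gt0// ltr_wpDl ?sqnorm_ge0.
- by rewrite powR_gt0// divr_gt0// ltr_wpDl ?sqnorm_ge0.
apply: ge0_ler_powR; rewrite ?nnegrE ?invr_ge0//.
- by rewrite divr_ge0 ?addr_ge0 ?sqnorm_ge0 ?ltW.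
- by rewrite divr_ge0 ?addr_ge0 ?sqnorm_ge0 ?ltW.
- by rewrite ler_pM2r ?invr_gt0// lerD2r.
Qed.

Lemma potential_superharmonic v : (3 <= d.+1)%N ->
  (2 * d.+1)%:R^-1 * \sum_k potential (v + unit_step k) <= potential v.
Proof.
move=> d3; set s := sqnorm v + c.
have s_ge : 1000 <= s by rewrite (le_trans c_ge)// lerDr sqnorm_ge0.
have s_gt0 : 0 < s by lra.
pose t (k : 'I_d.+1 * bool) : R := (1 + 2 * (-1) ^+ k.2 * (v 0 k.1)%:~R) / s.
have vi_le i : (v 0 i)%:~R ^+ 2 <= s - c.
  rewrite /s addrK /sqnorm (bigD1 i)//= lerDl; apply: sumr_ge0 => j _.
  exact: sqr_ge0.
have t_bound (a e : R) : a ^+ 2 <= s - c -> e = 1 \/ e = -1 ->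
    - (20^-1 * s) <= 1 + 2 * e * a <= 20^-1 * s.
  exact: walk_increment_bound.
have t_le k : `|t k| <= 20^-1.
  rewrite /t normrM normfV (gtr0_norm s_gt0) ler_pdivrMr// ler_norml.
  by apply: t_bound => //; case: k.2; [right|left].
have step k : potential (v + unit_step k) <=
    potential v * (1 - t k / 3 + 6 / 25 * t k ^+ 2).
  have -> : potential (v + unit_step k) = potential v * (1 + t k) `^ (- 3^-1).
    have t1 : 0 <= 1 + t k.
      by have := t_le k; rewrite ler_norml => /andP[]; lra.
    rewrite /potential -powRM//; last by rewrite divr_ge0 ?ltW.
    congr (_ `^ _); rewrite sqnorm_step /t /s; field.
    by rewrite -/s !gt_eqF.
  rewrite ler_pM2l ?potential_gt0//; exact: powR_third_upper.
apply: (@le_trans _ _ ((2 * d.+1)%:R^-1 *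
    \sum_k potential v * (1 - t k / 3 + 6 / 25 * t k ^+ 2))).
  by rewrite ler_wpM2l ?invr_ge0// ler_sum.
rewrite -mulr_sumr mulrCA ger_pMr ?potential_gt0// ler_pdivrMl ?ltr0n// mulr1.
(* Adding the two signs in direction i cancels the odd part of [t]: the values of [t] sum to 2 / s
   and their squares to (2 + 8 v_i^2) / s^2. *)
have -> : \sum_k (1 - t k / 3 + 6 / 25 * t k ^+ 2) =
    \sum_(i < d.+1) (2 - 2 / (3 * s) + 6 / 25 * (2 + 8 * (v 0 i)%:~R ^+ 2) / s ^+ 2).
  rewrite -(pair_bigA _ (fun i b => 1 - t (i, b) / 3 + 6 / 25 * t (i, b) ^+ 2))/=.
  apply: eq_bigr => i _; rewrite big_bool /t/= expr1 expr0; field.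
  by rewrite gt_eqF.
rewrite big_split/= sumr_const card_ord -[(_ - _) *+ _]mulr_natl.
rewrite -!mulr_suml -!mulr_sumr big_split/= -mulr_sumr sumr_const card_ord.
have -> : \sum_(i < d.+1) (v 0 i)%:~R ^+ 2 = s - c by rewrite /s addrK.
have D3 : (3 : R) <= d.+1%:R by rewrite (ler_nat _ 3).
rewrite natrM -[2 *+ _]mulr_natl; move: (d.+1%:R : R) D3 => D D3.
rewrite -subr_ge0.
have -> : 2 * D - (D * (2 - 2 / (3 * s)) + 6 / 25 * (D * 2 + 8 * (s - c)) / s ^+ 2)
   = (50 * D * s - 36 * D - 144 * s + 144 * c) / (75 * s ^+ 2).
  by field; rewrite gt_eqF.
apply: divr_ge0; last by rewrite mulr_ge0 ?sqr_ge0.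
exact: superharmonic_slack.
Qed.

End superharmonic.

Section green_function.
Context (R : realType) (d : nat).
Hypothesis d_ge3 : (3 <= d.+1)%N.
Implicit Types (x y v : lattice d.+1).
Local Notation q := (@walk_prob R d).

Definition green_sum n v : R := \sum_(i < n) q i v.

Lemma green_sumS n v : green_sum n.+1 v =
  (v == 0)%:R + (2 * d.+1)%:R^-1 * \sum_k green_sum n (v - unit_step k).
Proof.
rewrite /green_sum big_ord_recl/=; congr (_ + _).
by rewrite exchange_big/= mulr_sumr.
Qed.

(** Comparison principle by induction on the number of steps: off the origin [green_sumS] has no
    source term, so superharmonicity of [f] propagates the bound. The origin is left as a hypothesis
    because the two applications treat it differently. *)
Lemma green_sum_le (f : lattice d.+1 -> R) :
  (forall v, 0 <= f v) ->
  (forall v, v != 0 -> (2 * d.+1)%:R^-1 * \sum_k f (v + unit_step k) <= f v) ->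
  (forall n, (forall v, green_sum n v <= f v) -> green_sum n.+1 0 <= f 0) ->
  forall n v, green_sum n v <= f v.
Proof.
move=> f_ge0 f_sup f0; elim=> [|n ih] v; first by rewrite /green_sum big_ord0.
have [->|v0] := eqVneq v 0; first exact: f0.
rewrite green_sumS (negbTE v0) add0r (le_trans _ (f_sup _ v0))//.
by rewrite ler_wpM2l ?invr_ge0// -(sum_unit_step (fun k => f (v + k))) ler_sum.
Qed.

Variable c : R.
Hypothesis c_ge : 1000 <= c.
Local Notation pot := (@potential R d c).

(** The value of the potential at the unit vectors, its maximum off the origin ([potential_le1]). *)
Definition potential1 : R := ((1 + c) / c) `^ (- 3^-1).

Lemma potential1_lt1 : potential1 < 1.
Proof.
have c_gt0 : 0 < c by apply: lt_le_trans c_ge; rewrite ltr0n.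
have c1 : 1 < (1 + c) / c by rewrite ltr_pdivlMr// mul1r ltrDr.
rewrite /potential1 powRN invf_lt1; last by rewrite powR_gt0 ?(lt_trans _ c1).
by rewrite /powR gt_eqF ?(lt_trans _ c1)// expR_gt1 mulr_gt0 ?invr_gt0// ln_gt0.
Qed.

Lemma potential_le1 v : v != 0 -> pot v <= potential1.
Proof.
move=> v0; have -> : potential1 = pot (unit_step (ord0, false)).
  by rewrite /potential1 /potential -[unit_step _]add0r sqnorm_step sqnorm0 mxE mulr0 addr0 add0r.
apply: potential_le => //; rewrite -[unit_step _]add0r sqnorm_step sqnorm0 mxE mulr0 addr0 add0r.
exact: sqnorm_ge1.
Qed.

Lemma green_sum_bounded : exists A, forall n v, green_sum n v <= A.
Proof.
have p1 := potential1_lt1.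
(* The solution of 1 + A potential1 = A, so that the bound A pot reproduces itself at the origin. *)
pose A := (1 - potential1)^-1.
have A_gt0 : 0 < A by rewrite invr_gt0 subr_gt0.
have G n v : green_sum n v <= A * pot v.
  apply: (@green_sum_le (fun v => A * pot v)) => [u|u u0|m ih].
  - by rewrite mulr_ge0 ?ltW// potential_gt0.
  - by rewrite -mulr_sumr mulrCA ler_pM2l// potential_superharmonic.
  rewrite green_sumS eqxx potential0// mulr1.
  apply: (@le_trans _ _ (1 + (2 * d.+1)%:R^-1 *
      \sum_(k : 'I_d.+1 * bool) A * potential1)).
    rewrite lerD2l ler_wpM2l ?invr_ge0// ler_sum// => k _.
    rewrite (le_trans (ih _))// ler_pM2l// potential_le1// sub0r oppr_eq0.
    apply/eqP => /rowP/(_ k.1); rewrite !mxE eqxx => /eqP.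
    by rewrite signr_eq0.
  rewrite sumr_const card_prod card_ord card_bool -[X in _ * X]mulr_natl [(_ * 2)%N]mulnC mulKf//.
  rewrite -lerBrDr -[X in _ <= X - _]mulr1 -mulrBr mulVf// subr_eq0.
  by rewrite gt_eqF.
exists A => n v; rewrite (le_trans (G _ _))// ger_pMr//.
have [->|v0] := eqVneq v 0; first by rewrite potential0.
by rewrite (le_trans (potential_le1 v0))// ltW.
Qed.

Definition green_real v : R := limn (green_sum ^~ v).

Lemma green_sum_nd v : nondecreasing_seq (green_sum ^~ v).
Proof.
apply/nondecreasing_seqP => n; rewrite /green_sum big_ord_recr/= lerDl.
exact: walk_prob_ge0.
Qed.

Lemma cvg_green_sum v : green_sum n v @[n --> \oo] --> green_real v.
Proof.
apply: nondecreasing_is_cvgn; first exact: green_sum_nd.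
have [A GA] := green_sum_bounded; exists A => _ [n _ <-]; exact: GA.
Qed.

Lemma green_sum_le_real n v : green_sum n v <= green_real v.
Proof.
apply: nondecreasing_cvgn_le; first exact: green_sum_nd.
by apply/cvg_ex; exists (green_real v); exact: cvg_green_sum.
Qed.

Lemma green_real_ge1 : 1 <= green_real 0.
Proof.
by rewrite (le_trans _ (green_sum_le_real 1 _))// /green_sum big_ord1/= eqxx.
Qed.

Lemma green_real_ge0 v : 0 <= green_real v.
Proof.
by rewrite (le_trans _ (green_sum_le_real 0 _))// /green_sum big_ord0.
Qed.

Lemma green_realN v : green_real (- v) = green_real v.
Proof.
by congr (limn _); apply/funext => n; apply: eq_bigr => i _; rewrite walk_probN.
Qed.

(** Second use of the comparison principle: g(0) being finite now, g(0) times the potential is a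
    majorant, and at the origin the bound is just that partial sums lie below their limit. *)
Lemma green_real_le v : green_real v <= green_real 0 * pot v.
Proof.
apply: limr_le; first by apply/cvg_ex; exists (green_real v); exact: cvg_green_sum.
apply: nearW => n; have g0 : 0 < green_real 0 by rewrite (lt_le_trans _ green_real_ge1).
apply: (@green_sum_le (fun v => green_real 0 * pot v)) => [u|u u0|m _].
- by rewrite mulr_ge0 ?ltW// potential_gt0.
- by rewrite -mulr_sumr mulrCA ler_pM2l// potential_superharmonic.
- by rewrite potential0// mulr1 green_sum_le_real.
Qed.

Variable P : lattice d.+1 -> probability (path_space d.+1) R.
Hypothesis P_walk : forall x, walk_law x (P x).

Lemma greenE x y : green P x y = (green_real (y - x))%:E.
Proof.
apply/cvg_lim => //; apply/fine_cvgP; split.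
  by apply: nearW => n; under eq_bigr do rewrite (walk_marginal P_walk); rewrite sumEFin.
rewrite (_ : _ \o _ = green_sum ^~ (y - x)); first exact: cvg_green_sum.
apply/funext => n /=; rewrite big_mkord.
by under eq_bigr do rewrite walk_marginal//; rewrite sumEFin.
Qed.

End green_function.

(** * Last-exit decomposition *)

Section last_exit.
Context (R : realType) (d : nat).
Hypothesis d_ge3 : (3 <= d.+1)%N.
Variable P : lattice d.+1 -> probability (path_space d.+1) R.
Hypothesis P_walk : forall x, walk_law x (P x).
Local Notation path := (path_space d.+1).

Lemma no_returnE (K : set (lattice d.+1)) :
  no_return R K = [set w | forall n, (0 < n)%N -> ~ K (w n)].
Proof.
apply/seteqP; split => w /=; rewrite /no_return/= /return_time => wK.
  move=> n n0 Kwn; have : (ereal_inf [set n%:R%:E | n in [set n | (1 <= n)%N /\ K (w n)]]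
      <= n%:R%:E :> \bar R)%E by apply: ereal_inf_lbound; exists n.
  by rewrite wK.
rewrite (_ : [set n | _] = set0) ?image_set0 ?ereal_inf0//.
by apply/seteqP; split => // n [n0 /(wK _ n0)].
Qed.

Lemma measurable_no_return (K : set (lattice d.+1)) :
  measurable (no_return R K : set path).
Proof.
rewrite no_returnE.
have -> : [set w : path | forall n, (0 < n)%N -> ~ K (w n)] =
    \bigcap_(n in [set n | (0 < n)%N]) [set w | (~` K) (w n)] by [].
apply: bigcap_measurable => [|n _]; first by exists 1%N.
exact: measurable_path_in.
Qed.

Variables (K : {fset lattice d.+1}) (x : lattice d.+1).
Hypothesis Kx : x \in K.
Local Notation KS := [set` K].

Let last_visit n : set path :=
  [set w | w n \in K] `&` shift_path n @^-1` no_return R KS.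

Let measurable_last_visit n : measurable (last_visit n).
Proof.
apply: measurableI; first exact: (measurable_path_in n KS).
apply: measurable_shift_preimage; exact: measurable_no_return.
Qed.

Let trivIset_last_visit : trivIset setT last_visit.
Proof.
apply: ltn_trivIset => n m nm; apply/seteqP; split => // w [[_ +] [wn _]].
rewrite /= no_returnE => /(_ (n - m)%N); rewrite subn_gt0 => /(_ nm).
by rewrite /shift_path subnK ?(ltnW nm).
Qed.

Let last_visitE n : P x (last_visit n) =
  (\sum_(y <- K) (walk_prob R n (y - x))%:E * P y (no_return R KS))%E.
Proof.
have -> : last_visit n = \big[setU/set0]_(y <- K)
    ([set w : path | w n = y] `&` shift_path n @^-1` no_return R KS).
  rewrite -bigcup_fset; apply/seteqP; split => [w [wn ?]|w [y yK [/= wy ?]]].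
    by exists (w n).
  by split => //=; rewrite wy.
rewrite (measure_fbigsetU (P x)).
- by apply: eq_bigr => y _; apply: walk_markov => //; exact: measurable_no_return.
- move=> y _; apply: measurableI; first exact: measurable_path_eq.
  by apply: measurable_shift_preimage; exact: measurable_no_return.
- apply/trivIsetP => y z _ _ yz; apply/seteqP; split => // w [[/= wy _] [wz _]].
  by move: yz; rewrite -wy wz eqxx.
Qed.

Variable c : R.
Hypothesis c_ge : 1000 <= c.

Let sum_green (e : lattice d.+1 -> R) : (forall y, 0 <= e y) ->
  (\sum_(n <oo) \sum_(y <- K) (walk_prob R n (y - x))%:E * (e y)%:E =
   \sum_(y <- K) (green_real R (y - x))%:E * (e y)%:E)%E.
Proof.
move=> e0; rewrite nneseries_sum => [|y n _]; last first.
  by rewrite -EFinM lee_fin mulr_ge0// walk_prob_ge0.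
apply: eq_bigr => y _.
under eq_eseriesr do rewrite muleC.
rewrite nneseriesZl => [|n _]; last by rewrite lee_fin walk_prob_ge0.
rewrite muleC; congr (_ * _)%E; rewrite -(greenE d_ge3 c_ge P_walk).
by apply: eq_eseriesr => n _; rewrite (walk_marginal P_walk).
Qed.

Let sum_visits : (\sum_(n <oo) P x [set w : path | w n \in K] < +oo)%E.
Proof.
rewrite (_ : (\sum_(n <oo) _)%E =
    (\sum_(n <oo) \sum_(y <- K) (walk_prob R n (y - x))%:E * 1%:E)%E).
  rewrite (sum_green (e := fun=> 1))// lte_sum_pinfty// => y _.
  by rewrite -EFinM ltry.
apply: eq_eseriesr => n _.
have -> : [set w : path | w n \in K] = \big[setU/set0]_(y <- K) [set w : path | w n = y].
  rewrite -bigcup_fset; apply/seteqP; split => [w wn|w [y yK /= wy]].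
    by exists (w n).
  by rewrite /= wy.
rewrite (measure_fbigsetU (P x)).
- by apply: eq_bigr => y _; rewrite mule1; exact: walk_marginal.
- by move=> y _; exact: measurable_path_eq.
- apply/trivIsetP => y z _ _ yz; apply/seteqP; split => // w [/= wy wz].
  by move: yz; rewrite -wy wz eqxx.
Qed.

(** Borel-Cantelli: the expected number of visits to [K] is finite ([sum_visits]), so almost surely
    there are finitely many. Time 0 is one of them since [x] is in [K], hence a last one exists. *)
Let last_visit_cover : P x (\bigcup_n last_visit n) = 1%E.
Proof.
have mU : measurable (\bigcup_n last_visit n) by apply: bigcupT_measurable.
pose V n := [set w : path | w n \in K].
have mV n : measurable (V n) by exact: (measurable_path_in n KS).
have mL : measurable (lim_sup_set V).
  by apply: bigcapT_measurable => k; apply: bigcup_measurable => j _.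
have L0 : P x (lim_sup_set V) = 0%E by apply: (@lim_sup_set_cvg0 _ _ _ (P x)).
have LC1 : P x (~` lim_sup_set V) = 1%E.
  by rewrite [LHS](probability_setC (P x) mL) L0 sube0.
apply/eqP; rewrite eq_le probability_le1//= -LC1.
rewrite -(probability_setI_full (measurable_path_eq 0 x) (measurableC mL) (walk_start P_walk x)).
apply: le_measure; rewrite ?inE//.
  by apply: measurableI; [exact: measurableC|exact: measurable_path_eq].
move=> w [+ /= w0]; rewrite /lim_sup_set /= => /existsNP[N] /not_implyP[_ wN].
have ub i : w i \in K -> (i <= N)%N.
  move=> wi; rewrite leqNgt; apply/negP => Ni; apply: wN; exists i => //=.
  exact: ltnW.
have ex : exists i, w i \in K by exists 0%N; rewrite w0.
case: (ex_maxnP ex ub) => n wn nmax; exists n => //; split => //.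
rewrite /= no_returnE => m m0; rewrite /shift_path => /nmax.
by rewrite leqNgt -{1}[n]add0n ltn_add2r m0.
Qed.

Lemma last_exit : (\sum_(y <- K) (green_real R (y - x))%:E * P y (no_return R KS) = 1)%E.
Proof.
rewrite -last_visit_cover measure_bigcup//=.
transitivity (\sum_(y <- K) (green_real R (y - x))%:E * (fine (P y (no_return R KS)))%:E)%E.
  by apply: eq_bigr => y _; rewrite fineK ?fin_num_measure//; exact: measurable_no_return.
rewrite -sum_green => [|y]; last by rewrite fine_ge0.
rewrite [RHS](@eq_eseriesl _ _ xpredT) => [|n]; last by rewrite in_setT.
apply: eq_eseriesr => n _; rewrite last_visitE; apply: eq_bigr => y _.
by rewrite fineK ?fin_num_measure//; exact: measurable_no_return.
Qed.

End last_exit.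

(** * Capacities and avoidance probabilities *)

Section hitting_trajectories.
Context (R : realType) (d : nat).

Definition hitting (A : set (lattice d.+1)) : set (trajectory_space d) :=
  [set w | traj_range w `&` A !=set0].

Lemma traj_range_to_trajectory (v : bipath_space d) x :
  traj_range (to_trajectory v) x <-> exists n, (v : bipath d) n = x.
Proof.
split=> [[v' [n [e <-]]]|[n vn]]; last by exists v, n.
move/eqquotP: e => /asboolP[N v'v]; exists (n + N); exact/esym/v'v.
Qed.

Lemma measurable_bipath_in n (A : set (lattice d.+1)) :
  measurable [set w : bipath_space d | A ((w : bipath d) n)].
Proof.
have -> : [set w : bipath_space d | A ((w : bipath d) n)] =
    \bigcup_y (if `[< A y >] then [set w : bipath_space d | (w : bipath d) n = y] else set0).
  apply/seteqP; split => [w /= Aw|w [y _]].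
    by exists ((w : bipath d) n) => //; case: asboolP.
  by case: asboolP => // Ay /= ->.
apply: countable_bigcupT_measurable => [|y]; first exact: countableP.
case: asboolP => _; last exact: measurable0.
by apply: sub_sigma_algebra; exists n, y.
Qed.

Lemma hitting_to_trajectory A : @to_trajectory d @^-1` hitting A =
  \bigcup_(n : int) [set w : bipath_space d | A ((w : bipath d) n)].
Proof.
apply/seteqP; split => [w [x [/traj_range_to_trajectory[n wn] Ax]]|w [n _ /= Aw]].
  by exists n => //=; rewrite wn.
by exists ((w : bipath d) n); split => //; apply/traj_range_to_trajectory; exists n.
Qed.

Lemma measurable_hitting A : measurable (hitting A).
Proof.
apply: sub_sigma_algebra; rewrite /image_set_system/= setTI hitting_to_trajectory.
apply: countable_bigcupT_measurable => [|n]; first exact: countableP.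
exact: measurable_bipath_in.
Qed.

Lemma hittingU A B : hitting (A `|` B) = hitting A `|` hitting B.
Proof.
apply/seteqP; split => w.
  by move=> [x [wx [Ax|Bx]]]; [left|right]; exists x.
by move=> [[x [wx Ax]]|[x [wx Bx]]]; exists x; split => //; [left|right].
Qed.

End hitting_trajectories.

Section capacity.
Context (R : realType) (d : nat).
Hypothesis d_ge3 : (3 <= d.+1)%N.
Variable P : lattice d.+1 -> probability (path_space d.+1) R.
Hypothesis P_walk : forall x, walk_law x (P x).
Variable nu : {sigma_finite_measure set (trajectory_space d) -> \bar R}.
Hypothesis nuP : interlacement_intensity P nu.

Lemma nu_hitting (K : {fset lattice d.+1}) :
  nu (hitting [set` K]) = (\sum_(y <- K) P y (no_return R [set` K]))%E.
Proof.
have [Q QK nuQ] := nuP (finite_fset K).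
have := nuQ setT measurableT; rewrite setTI => ->.
rewrite /pushforward preimage_setT.
pose S y := [set w : bipath_space d | (w : bipath d) 0 = y].
have mS y : measurable (S y) by exact: (measurable_bipath_in 0 [set y]).
have QS y : Q (S y) = (P y (no_return R [set` K]) * (\1_[set` K] y)%:E)%E.
  have -> : S y = [set w : bipath_space d |
      [/\ setT (fun n : nat => (w : bipath d) (- n%:Z)%R),
          (w : bipath d) 0%R = y & setT (fun n : nat => (w : bipath d) n%:Z)]].
    by apply/seteqP; split => [w|w []].
  rewrite QK// probability_setT mule1 /equilibrium /cond_prob setTI.
  have mN := @measurable_no_return R d [set` K].
  have fN : P y (no_return R [set` K]) \is a fin_num by exact: fin_num_measure.
  rewrite -(fineK fN) -!EFinM; congr EFin => /=.
  (* The conditional probability is p / p, which is 0 when p = 0; its product with p is p in both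
     cases. *)
  have [->|e0] := eqVneq (fine (P y (no_return R [set` K]))) 0.
    by rewrite !mul0r.
  by rewrite divff// mul1r.
have mU : measurable [set w : bipath_space d | (w : bipath d) 0 \in K].
  exact: (measurable_bipath_in 0 [set` K]).
have -> : Q setT = Q [set w : bipath_space d | (w : bipath d) 0 \in K].
  rewrite -[in LHS](setvU [set w : bipath_space d | (w : bipath d) 0 \in K]) setUC.
  apply: measureU0 => //; first exact: measurableC.
  (* Paths with w(0) outside [K] form a countable union over lattice points, enumerated by
     [unpickle]; each piece is null because of the factor 1_K in the equilibrium measure. *)
  pose F k := if (choice.unpickle k : option (lattice d.+1)) is Some y then if y \in K then set0 else S y else set0.
  apply: (@subset_measure0 _ _ _ Q _ (\bigcup_k F k)).
  - exact: measurableC.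
  - apply: bigcupT_measurable => k; rewrite /F; case: choice.unpickle => // y.
    by case: ifP.
  - move=> w /= wK; exists (choice.pickle ((w : bipath d) 0)) => //.
    by rewrite /F choice.pickleK; case: ifPn.
  - apply/eqP; rewrite eq_le measure_ge0 andbT.
    rewrite (le_trans (generalized_Boole_inequality Q _ _))//.
    + move=> k; rewrite /F; case: choice.unpickle => // y; by case: ifP.
    + apply: bigcupT_measurable => k; rewrite /F; case: choice.unpickle => // y.
      by case: ifP.
    rewrite eseries0// => k _ _; rewrite /F.
    case: choice.unpickle => [y|]; last exact: measure0.
    case: ifPn => yK; first exact: measure0.
    by rewrite [LHS]QS indicE memNset ?mule0//; apply/negP.
have -> : [set w : bipath_space d | (w : bipath d) 0 \in K] = \big[setU/set0]_(y <- K) S y.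
  rewrite -bigcup_fset; apply/seteqP; split => [w wn|w [y yK /= wy]].
    by exists ((w : bipath d) 0).
  by rewrite /= wy.
rewrite (measure_fbigsetU Q).
- rewrite big_seq [RHS]big_seq; apply: eq_bigr => y yK.
  by rewrite [LHS]QS indicE mem_set ?mule1.
- by move=> y _; exact: mS.
- apply/trivIsetP => y z _ _ yz; apply/seteqP; split => // w [/= wy wz].
  by move: yz; rewrite -wy wz eqxx.
Qed.

(** Capacity as the Poisson process sees it, namely the mass of the trajectories hitting [A];
    [capacityE] identifies it with the total equilibrium mass for finite sets. *)
Definition capacity A : R := fine (nu (hitting A)).

Lemma nu_hittingE (K : {fset lattice d.+1}) :
  nu (hitting [set` K]) = (capacity [set` K])%:E.
Proof.
rewrite /capacity fineK// nu_hitting sum_fin_num; apply/allP => e /mapP[y _ ->].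
by apply: fin_num_measure; exact: measurable_no_return.
Qed.

Lemma capacityE (K : {fset lattice d.+1}) :
  capacity [set` K] = \sum_(y <- K) fine (P y (no_return R [set` K])).
Proof.
rewrite /capacity nu_hitting.
under eq_bigr => y _.
  rewrite -[P y _]fineK; last by apply: fin_num_measure; exact: measurable_no_return.
  over.
by rewrite sumEFin.
Qed.

Variable c : R.
Hypothesis c_ge : 1000 <= c.

Lemma last_exit_fine (K : {fset lattice d.+1}) x : x \in K ->
  \sum_(y <- K) green_real R (y - x) * fine (P y (no_return R [set` K])) = 1.
Proof.
move=> xK; have := last_exit d_ge3 P_walk xK c_ge.
under eq_bigr => y _.
  rewrite -[P y _]fineK; last by apply: fin_num_measure; exact: measurable_no_return.
  rewrite -EFinM; over.
by rewrite sumEFin => -[].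
Qed.

Lemma capacity1 x : capacity [set x] = (green_real R (0 : lattice d.+1))^-1.
Proof.
have -> : [set x] = [set` [fset x]%fset] by rewrite set_fset1.
have := last_exit_fine (fset11 x); rewrite capacityE !big_seq_fset1 subrr => g1.
have g0 : green_real R (0 : lattice d.+1) != 0.
  by rewrite gt_eqF// (lt_le_trans _ (green_real_ge1 d_ge3 c_ge)).
by apply: (mulfI g0); rewrite g1 divff.
Qed.

Lemma capacity2 x y : x != y -> capacity [set x; y] =
  2 / (green_real R (0 : lattice d.+1) + green_real R (x - y)).
Proof.
move=> xy; have -> : [set x; y] = [set` [fset x; y]%fset] by rewrite set_fsetU !set_fset1.
have x_in : x \in [fset x; y]%fset by rewrite !inE eqxx.
have y_in : y \in [fset x; y]%fset by rewrite !inE eqxx orbT.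
have := last_exit_fine x_in; have := last_exit_fine y_in.
rewrite capacityE !big_fsetU1 ?inE//= !big_seq_fset1 !subrr.
rewrite -[green_real R (y - x)]green_realN opprB.
set g0 := green_real R 0; set g := green_real R (x - y).
set ex := fine _; set ey := fine _ => e1 e2.
have g_gt0 : 0 < g0 + g.
  have g0_gt0 : 0 < g0 by rewrite (lt_le_trans _ (green_real_ge1 d_ge3 c_ge)).
  by rewrite ltr_pwDl// (green_real_ge0 d_ge3 c_ge).
apply: (canRL (mulfK _)); first by rewrite gt_eqF.
(* The last-exit identities at [x] and [y] add up to (g(0) + g(x - y)) (ex + ey) = 2, so only the
   sum of the two masses is needed. *)
by rewrite -[2]/(1 + 1) -{1}e1 -e2; ring.
Qed.

End capacity.

Section config_measure_void.
Context disp (T : measurableType disp) (R : realType).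

Lemma config_measure_eq0 (c : config T) (B : set T) :
  config_measure R c B = 0%E <-> forall n x, c n = Some x -> ~ B x.
Proof.
rewrite /config_measure /= /mseries; split => [c0 n x cn Bx|cB].
  have := @nneseries_lim_ge R (fun k =>
    (if c k is Some x then \d_x : {measure set T -> \bar R} else mzero) B) xpredT 0 n.+1
    (fun k _ _ => measure_ge0 _ B).
  rewrite c0 big_nat_recr//= cn/= diracE mem_set//.
  apply/negP; rewrite -ltNge (lt_le_trans lte01)// leeDr// sume_ge0//.
rewrite eseries0// => k _ _; case E : (c k) => [x|//].
by rewrite /= diracE memNset//; exact: (cB k).
Qed.

End config_measure_void.

(** * Void events and cover levels *)

Section process_events.
Context (R : realType) (d : nat).
Variable nu : {sigma_finite_measure set (trajectory_space d) -> \bar R}.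
Context dO (Omega : measurableType dO) (P : probability Omega R).
Variable omega : Omega -> config (trajectory_space d * measurableTypeR R).
Hypothesis omegaP : interlacement_process P nu omega.
Local Open Scope ereal_scope.

(** The event that no trajectory in [H] has label at most [u]. A half-line serves as window because
    [level_measure] gives no mass to negative labels. *)
Definition void (H : set (trajectory_space d)) (u : R) : set Omega :=
  [set s | config_measure R (omega s) (H `*` `]-oo, u]%classic) = 0].

Lemma voidP H u s : void H u s <->
  forall n w v, omega s n = Some (w, v) -> (v <= u)%R -> ~ H w.
Proof.
rewrite /void/= config_measure_eq0; split => [h n w v sn vu Hw|h n [w v] sn [/= Hw]].
  by apply: (h n (w, v) sn); split => //=; rewrite in_itv.
by rewrite in_itv/= => /(h n w v sn).
Qed.

Lemma level_measure_itv u : (0 <= u)%R -> @level_measure R `]-oo, u]%classic = u%:E.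
Proof.
move=> u0; rewrite /level_measure /mrestr.
have -> : `]-oo, u] `&` `[0%R, +oo[ = `[0%R, u]%classic :> set R.
  apply/seteqP; split => x /=; rewrite !in_itv/= ?andbT.
    by move=> [-> ->].
  by move=> /andP[-> ->].
by rewrite lebesgue_measure_itv/= lte_fin; case: ltgtP u0 => // [_ _|<- _]; rewrite ?oppr0 ?adde0// sube0.
Qed.

Lemma intensity_setX H u : measurable H -> (0 <= u)%R ->
  (nu \x @level_measure R) (H `*` `]-oo, u]%classic) = nu H * u%:E.
Proof.
move=> mH u0; rewrite /product_measure1.
transitivity (\int[nu]_w ((\1_H w)%:E * u%:E)).
  apply: eq_integral => w _ /=; rewrite indicE.
  have [Hw|Hw] := boolP (w \in H).
    by rewrite in_xsectionX// level_measure_itv// mul1e.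
  by rewrite notin_xsectionX// /level_measure /mrestr set0I measure0 mul0e.
rewrite ge0_integralZr//; last by apply/measurable_EFinP; exact: measurable_indic.
by rewrite integral_indic// setIT.
Qed.

Let measurable_setX (H : set (trajectory_space d)) (u : R) : measurable H ->
  measurable (H `*` `]-oo, u]%classic : set (trajectory_space d * measurableTypeR R)).
Proof. by move=> mH; apply: measurableX => //; exact: measurable_itv. Qed.

Lemma measurable_void H u : measurable H -> measurable (void H u).
Proof.
move=> mH; have [[mN _ _ _] _] := omegaP.
have := mN _ (measurable_setX u mH) measurableT [set 0] (@emeasurable_set1 R 0).
by rewrite setTI.
Qed.

Lemma void_prob H u : measurable H -> nu H < +oo -> (0 <= u)%R ->
  P (void H u) = (expR (- (fine (nu H) * u)))%:E.
Proof.
move=> mH nuH u0; have [[_ poisson _ _] _] := omegaP.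
have muE := intensity_setX mH u0.
have fH : nu H \is a fin_num by rewrite ge0_fin_numE.
have := poisson _ (measurable_setX u mH).
rewrite muE -(fineK fH) -EFinM ltry => /(_ isT 0%N).
by rewrite /= expr0 fact0 mulr1 divr1.
Qed.

Lemma void_indep H1 H2 u : measurable H1 -> measurable H2 -> H1 `&` H2 = set0 ->
  P (void H1 u `&` void H2 u) = P (void H1 u) * P (void H2 u).
Proof.
move=> mH1 mH2 H12; have [[_ _ _ indep] _] := omegaP.
pose H (i : 'I_2) := if i == ord0 then H1 else H2.
have mH i : measurable (H i) by rewrite /H; case: ifP.
have tH : trivIset setT (fun i => H i `*` (`]-oo, u]%classic : set (measurableTypeR R))).
  apply/trivIsetP => i j _ _ ij; rewrite -setXI.
  suff -> : H i `&` H j = set0 by rewrite set0X.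
  rewrite /H; case: i j ij => -[|[|//]] i2 [[|[|//]] j2] //= _.
  by rewrite setIC.
have := indep 2%N (fun i => H i `*` `]-oo, u]%classic) (fun i => measurable_setX u (mH i)) tH
  (fun=> [set 0]) (fun=> emeasurable_set1 0).
rewrite big_ord_recl big_ord1 => indE.
transitivity (P [set s | forall i, [set 0] (config_measure R (omega s) (H i `*` `]-oo, u]))]).
  congr (P _); apply/seteqP; split => s /=.
    by move=> [s1 s2] i; rewrite /H; case: ifP.
  by move=> h; split; [exact: (h ord0)|exact: (h (lift ord0 ord0))].
exact: indE.
Qed.

Lemma void_subset H1 H2 u : H1 `<=` H2 -> void H2 u `<=` void H1 u.
Proof.
by move=> H12 s /voidP h; apply/voidP => n w v sn vu /H12; exact: (h n w v).
Qed.

Lemma void_setU H1 H2 u : void (H1 `|` H2) u = void H1 u `&` void H2 u.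
Proof.
apply/seteqP; split => [s h|s [/voidP h1 /voidP h2]].
  by split; apply: void_subset h => w; [left|right].
by apply/voidP => n w v sn vu [/(h1 n w v sn vu)|/(h2 n w v sn vu)].
Qed.

(** Avoiding [x] up to level [u] does not give U_x > u, as labels might accumulate at [u] from
    above; hence the margin 1/(n + 1). Measurability of the event follows from this form. *)
Lemma cover_levelE (u : R) (x : lattice d.+1) :
  [set s | u%:E < cover_level (omega s) x] =
  \bigcup_n void (hitting [set x]) (u + n.+1%:R^-1)%R.
Proof.
have [_ label_ge0] := omegaP.
apply/seteqP; split => s /=.
  move=> ux; have [n un] : exists n, (u + n.+1%:R^-1)%:E < cover_level (omega s) x.
    case E : (cover_level (omega s) x) ux => [r| |]//; last by exists 0%N; rewrite ltry.
    by rewrite lte_fin => /ltr_add_invr[n un]; exists n; rewrite lte_fin.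
  exists n => //; apply/voidP => k w v sk vu [y [wy /= yx]]; subst y.
  move: un; apply/negP; rewrite -leNgt.
  apply: (@le_trans _ _ v%:E); last by rewrite lee_fin.
  apply: ereal_inf_lbound; exists v => //; split; first exact: (label_ge0 _ _ _ _ sk).
  by exists k, w, v.
move=> [n _ /voidP h]; apply: (@lt_le_trans _ _ (u + n.+1%:R^-1)%:E).
  by rewrite lte_fin ltrDl invr_gt0.
apply: le_ereal_inf_tmp => _ [v [v0 [k [w [t [sk tv wx]]]]] <-]; rewrite lee_fin.
rewrite leNgt; apply/negP => vu; apply: (h k w t sk); last by exists x.
by rewrite (le_trans tv)// ltW.
Qed.

Lemma cover_level_subset u x :
  [set s | u%:E < cover_level (omega s) x] `<=` void (hitting [set x]) u.
Proof.
rewrite cover_levelE => s [n _ /voidP h]; apply/voidP => k w v sk vu.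
by apply: (h k w v sk); rewrite (le_trans vu)// lerDl invr_ge0.
Qed.

Lemma measurable_cover_level u x :
  measurable [set s | u%:E < cover_level (omega s) x].
Proof.
rewrite cover_levelE; apply: bigcupT_measurable => n; apply: measurable_void.
exact: measurable_hitting.
Qed.

(** The margin 1/(n + 1) disappears in the limit, exp(- C u) being continuous in u. As one event
    contains the other, they differ by a null event. *)
Lemma cover_level_prob u x : (0 <= u)%R -> nu (hitting [set x]) < +oo ->
  P [set s | u%:E < cover_level (omega s) x] = P (void (hitting [set x]) u).
Proof.
move=> u0 nux; have mH := measurable_hitting [set x].
apply/eqP; rewrite eq_le; apply/andP; split.
  apply: le_measure; rewrite ?inE.
  - exact: measurable_cover_level.
  - exact: measurable_void.
  - exact: cover_level_subset.
rewrite void_prob//.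
have mP : P [set s | u%:E < cover_level (omega s) x] \is a fin_num.
  by apply: fin_num_measure; exact: measurable_cover_level.
rewrite -(fineK mP) lee_fin.
set C := fine (nu _).
have -> : expR (- (C * u)) = limn (fun n => expR (- (C * (u + n.+1%:R^-1)))).
  apply/esym/cvg_lim => //; rewrite -[in X in _ --> X](addr0 u).
  apply: continuous_cvg; first exact: continuous_expR.
  apply: cvgN; apply: cvgMr; apply: cvgD; first exact: cvg_cst.
  exact: cvg_harmonic.
apply: limr_le.
  apply/cvg_ex; exists (expR (- (C * (u + 0)))).
  apply: continuous_cvg; first exact: continuous_expR.
  apply: cvgN; apply: cvgMr; apply: cvgD; first exact: cvg_cst.
  exact: cvg_harmonic.
apply: nearW => n; rewrite -lee_fin (fineK mP) -void_prob ?addr_ge0//.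
rewrite cover_levelE; apply: le_measure; rewrite ?inE.
- exact: measurable_void.
- by apply: bigcupT_measurable => k; exact: measurable_void.
- exact: (@bigcup_sup _ _ n).
Qed.

End process_events.

(** * Palm recursion for random subsets *)

Section random_subset.
Context dO (Omega : measurableType dO) (R : realType) (P : probability Omega R).
Variable I : finType.
Implicit Types (A B : set Omega) (D : {set I}).

Definition pr A : R := fine (P A).

Lemma prE A : measurable A -> P A = (pr A)%:E.
Proof. by move=> mA; rewrite /pr fineK// fin_num_measure. Qed.

Lemma pr_ge0 A : 0 <= pr A.
Proof. by rewrite fine_ge0. Qed.

Lemma pr_le A B : measurable A -> measurable B -> A `<=` B -> pr A <= pr B.
Proof.
by move=> mA mB AB; rewrite -lee_fin -!prE// le_measure ?inE.
Qed.

Lemma pr_setT : pr setT = 1.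
Proof. by rewrite /pr probability_setT. Qed.

Lemma pr_set0 : pr set0 = 0.
Proof. by rewrite /pr measure0. Qed.

Lemma pr_le1 A : measurable A -> pr A <= 1.
Proof. by move=> mA; rewrite -pr_setT pr_le. Qed.

Lemma pr_sum (J : finType) (F : J -> set Omega) (Q : pred J) :
  (forall j, measurable (F j)) -> (forall i j, i != j -> F i `&` F j = set0) ->
  pr (\bigcup_(j in [set j | Q j]) F j) = \sum_(j | Q j) pr (F j).
Proof.
move=> mF tF; rewrite /pr (measure_fin_bigcup P finite_finset)//; last first.
  by apply/trivIsetP => i j _ _ /tF.
transitivity (fine (\sum_(j | Q j) P (F j))%E); last first.
  by under eq_bigr => j _ do rewrite prE//; rewrite sumEFin.
congr fine.
have -> : [set j | Q j] = [set` enum Q].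
  by apply/seteqP; split => j /=; rewrite mem_enum.
by rewrite -fsbig_seq ?enum_uniq// big_enum.
Qed.

Lemma pr_setD A B : measurable A -> measurable B -> A `<=` B ->
  pr (B `\` A) = pr B - pr A.
Proof.
move=> mA mB AB; apply: EFin_inj; rewrite EFinB -!prE//; last exact: measurableD.
have PB : (P B < +oo)%E by rewrite prE// ltry.
rewrite measureD//.
by rewrite setIidr.
Qed.

Lemma pr_setU A B : measurable A -> measurable B ->
  pr (A `|` B) <= pr A + pr B.
Proof.
move=> mA mB; rewrite -lee_fin EFinD -!prE//; last exact: measurableU.
exact: measureU2.
Qed.

Lemma pr_bigcup (J : finType) (F : J -> set Omega) (Q : pred J) :
  (forall j, measurable (F j)) ->
  pr (\bigcup_(j in [set j | Q j]) F j) <= \sum_(j | Q j) pr (F j).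
Proof.
move=> mF.
have -> : \bigcup_(j in [set j | Q j]) F j = \big[setU/set0]_(j | Q j) F j.
  rewrite -[RHS]big_enum/= -bigcup_seq; congr (\bigcup_(j in _) _).
  by apply/seteqP; split => j /=; rewrite mem_enum.
suff : measurable (\big[setU/set0]_(j | Q j) F j) /\
  pr (\big[setU/set0]_(j | Q j) F j) <= \sum_(j | Q j) pr (F j) by case.
elim/big_rec2 : _ => [|j x A Qj [mA Ax]].
  by split; [exact: measurable0|rewrite /pr measure0].
split; first exact: measurableU.
by rewrite (le_trans (pr_setU _ _))// lerD2l.
Qed.

Variable T : Omega -> {set I}.
Hypothesis mT : forall i, measurable [set s | i \in T s].

Lemma measurable_set_eq D : measurable [set s | T s = D].
Proof.
have -> : [set s | T s = D] = ~` \bigcup_(i : I) (if i \in D then ~` [set s | i \in T s] else [set s | i \in T s]).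
  apply/seteqP; split => s /=.
    by move=> <- [i _]; case: ifP => iT /=; rewrite ?iT.
  move=> h; apply/setP => i; apply/idP/idP => iD.
    by apply/negPn/negP => niD; apply: h; exists i => //; rewrite (negbTE niD).
  by apply/negPn/negP => niT; apply: h; exists i => //; rewrite iD /=; apply/negP.
apply: measurableC; apply: countable_bigcupT_measurable => [|i]; first exact: countableP.
by case: ifP => _ //; exact: measurableC.
Qed.

Lemma setUP_eq (Phi : pred {set I}) : [set s | Phi (T s)] =
  \bigcup_(D in [set D | Phi D]) [set s | T s = D].
Proof. by apply/seteqP; split => [s Ps|s [D PD /= ->]] //; exists (T s). Qed.

Lemma measurable_setP (Phi : pred {set I}) : measurable [set s | Phi (T s)].
Proof.
rewrite setUP_eq; apply: fin_bigcup_measurable => [|D _]; first exact: finite_finset.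
exact: measurable_set_eq.
Qed.

Lemma pr_decomp A (Phi : pred {set I}) : measurable A ->
  pr (A `&` [set s | Phi (T s)]) = \sum_(D | Phi D) pr (A `&` [set s | T s = D]).
Proof.
move=> mA; rewrite setUP_eq setI_bigcupr pr_sum// => [D|D E DE].
  by apply: measurableI => //; exact: measurable_set_eq.
by apply/seteqP; split => // s [[_ /= sD] [_ sE]]; move: DE; rewrite -sD sE eqxx.
Qed.

(** Moebius inversion on the lattice of subsets, by induction on the size of the complement. *)
Lemma supset_sum_inj (a b : {set I} -> R) :
  (forall D, \sum_(E : {set I} | D \subset E) a E = \sum_(E : {set I} | D \subset E) b E) ->
  a =1 b.
Proof.
move=> ab D; have [n] := ubnP #|~: D|; elim: n D => // n ih D Dn.
have := ab D; rewrite (bigD1 D)//= [in RHS](bigD1 D)//= => abD.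
suff e : \sum_(E : {set I} | (D \subset E) && (E != D)) a E =
    \sum_(E : {set I} | (D \subset E) && (E != D)) b E.
  by move: abD; rewrite e => /addIr.
apply: eq_bigr => E /andP[DE ED]; apply: ih.
have : D \proper E by rewrite finset.properEneq eq_sym ED.
by rewrite -properC => /proper_card; lia.
Qed.

(** The probabilities of the inclusions D \subset T determine those of T = D by inversion, and every
    event about T is a finite disjoint union of the latter. Inclusions are what void probabilities
    compute. *)
Lemma indep_random_subset A : measurable A ->
  (forall D, pr (A `&` [set s | D \subset T s]) = pr A * pr [set s | D \subset T s]) ->
  forall Phi : pred {set I},
    pr (A `&` [set s | Phi (T s)]) = pr A * pr [set s | Phi (T s)].
Proof.
move=> mA indep Phi; rewrite -[in RHS](setTI [set s | Phi (T s)]) !pr_decomp// mulr_sumr.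
apply: eq_bigr => D _; move: D; apply: supset_sum_inj => D.
by rewrite -mulr_sumr -!pr_decomp// setTI indep.
Qed.

End random_subset.

Section palm.
Context dO (Omega : measurableType dO) (R : realType) (P : probability Omega R).
Variables (I J : finType) (cell : I -> J).
(* [S' i] is a version of [S] conditioned on containing [i], coupled with [S]
   so as to contain it. *)
Variables (S : Omega -> {set I}) (S' : I -> Omega -> {set I}).
Hypothesis mS : forall i, measurable [set s | i \in S s].
Hypothesis mS' : forall i j, measurable [set s | j \in S' i s].
Hypothesis sub_S' : forall i s, S s \subset S' i s.
Hypothesis S'_eq : forall i s, i \in S s -> S' i s = S s.
Hypothesis S'_indep : forall i (D : {set I}),
  pr P ([set s | i \in S s] `&` [set s | D \subset S' i s]) =
  pr P [set s | i \in S s] * pr P [set s | D \subset S' i s].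
Local Notation pr := (pr P).

Definition hit_prob i : R := pr [set s | i \in S s].
Definition pair_prob i j : R := pr [set s | (i \in S s) && (j \in S s)].
(** With p_i = [hit_prob i], this bounds p_i times the probability that S'_i without i differs from
    S. The square is the case that i lies in S; for j <> i, independence gives p_i P(j in S'_i) =
    P(i in S, j in S'_i) = [pair_prob i j]. *)
Definition palm_error i : R :=
  hit_prob i ^+ 2 + \sum_(j | j != i) (pair_prob i j - hit_prob i * hit_prob j).

Let mSP (Phi : pred {set I}) : measurable [set s | Phi (S s)].
Proof. exact: measurable_setP. Qed.

Let mSP' i (Phi : pred {set I}) : measurable [set s | Phi (S' i s)].
Proof. exact: measurable_setP. Qed.

Lemma palm_error_bound i (Psi : pred {set I}) :
  `|pr ([set s | i \in S s] `&` [set s | Psi (S s :\ i)]) - hit_prob i * pr [set s | Psi (S s)]|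
  <= palm_error i.
Proof.
have -> : [set s | i \in S s] `&` [set s | Psi (S s :\ i)] =
    [set s | i \in S s] `&` [set s | Psi (S' i s :\ i)].
  by apply/seteqP; split => s [/= iS]; rewrite S'_eq.
rewrite (indep_random_subset (mS' i) (mS i) (S'_indep i) (fun D => Psi (D :\ i))).
rewrite -mulrBr normrM ger0_norm ?pr_ge0//.
(* Outside [E] the sets S'_i minus i and S coincide. *)
pose E := [set s | i \in S s] `|` \bigcup_(j in [set j | j != i])
  ([set s | j \in S' i s] `\` [set s | j \in S s]).
have mE : measurable E.
  apply: measurableU => //; apply: fin_bigcup_measurable => [|j _]; [exact: finite_finset|exact: measurableD].
have SE s : ~ E s -> S' i s :\ i = S s.
  move=> nE; have iS : i \notin S s by apply/negP => iS; apply: nE; left.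
  apply/setP => j; rewrite !inE; have [->|ji] := eqVneq j i; first by rewrite (negbTE iS).
  rewrite /=; apply/idP/idP => [jS'|]; last exact: (fintype.subsetP (sub_S' i s)).
  apply/negPn/negP => jS; apply: nE; right; exists j => //; split => //=.
  exact/negP.
have EB : pr E <= hit_prob i + \sum_(j | j != i) (pr [set s | j \in S' i s] - hit_prob j).
  rewrite (le_trans (pr_setU _ _ _))//.
    by apply: fin_bigcup_measurable => [|j _]; [exact: finite_finset|exact: measurableD].
  rewrite lerD2l (le_trans (pr_bigcup _ _ _))// => [j|]; first exact: measurableD.
  rewrite ler_sum// => j _; rewrite pr_setD// => s /=.
  exact: (fintype.subsetP (sub_S' i s)).
have diff : `|pr [set s | Psi (S' i s :\ i)] - pr [set s | Psi (S s)]| <= pr E.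
  have mX := mSP' i (fun D => Psi (D :\ i)).
  rewrite ler_distl; apply/andP; split.
    rewrite lerBlDr (le_trans _ (pr_setU _ _ _))//.
    apply: pr_le => //; first exact: measurableU.
    move=> s /= Ps; have [Es|/SE e] := pselect (E s); [by right|left].
    by rewrite /= e.
  rewrite (le_trans _ (pr_setU _ _ _))//.
  apply: pr_le => //; first exact: measurableU.
  move=> s /= Ps; have [Es|/SE e] := pselect (E s); [by right|left].
  by rewrite /= -e.
rewrite (le_trans (ler_wpM2l (pr_ge0 _ _) (le_trans diff EB)))//.
rewrite mulrDr -expr2 lerD2l mulr_sumr ler_sum// => j ji.
rewrite mulrBr lerD2r; have := S'_indep i [set j].
have -> : [set s | [set j]%SET \subset S' i s] = [set s | j \in S' i s].
  by apply/seteqP; split => s /=; rewrite finset.sub1set.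
move=> <-; apply: pr_le; first exact: measurableI.
  exact: (mSP (fun D => (i \in D) && (j \in D))).
by move=> s [/= iS]; rewrite S'_eq// iS.
Qed.

Lemma palm_error_ge0 i : 0 <= palm_error i.
Proof. exact: le_trans (palm_error_bound i xpredT). Qed.

Definition counts (D : {set I}) : {ffun J -> nat} :=
  [ffun j => #|[set i in D | cell i == j]|].

(** Subtraction is truncated at 0, so this is one point less in cell [j] only when m j > 0. *)
Definition decr (m : {ffun J -> nat}) j : {ffun J -> nat} :=
  [ffun k => m k - (k == j)]%N.

Lemma countsD1 (D : {set I}) i : i \in D -> counts (D :\ i) = decr (counts D) (cell i).
Proof.
move=> iD; apply/ffunP => k; rewrite !ffunE.
have [->|ki] := eqVneq k (cell i).
  rewrite [in RHS](cardsD1 i) !inE iD eqxx add1n subSS subn0; congr #|pred_of_set _|.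
  by apply/setP => j; rewrite !inE andbA.
rewrite subn0; congr #|pred_of_set _|; apply/setP => j; rewrite !inE.
by case: (eqVneq j i) => [->|//=]; rewrite /= eq_sym (negbTE ki) andbF.
Qed.

Lemma decr_inj (m m' : {ffun J -> nat}) j : (0 < m j)%N -> (0 < m' j)%N ->
  decr m j = decr m' j -> m = m'.
Proof.
move=> m0 m'0 /ffunP e; apply/ffunP => k; have := e k; rewrite !ffunE.
by case: eqVneq => [->|_] /=; lia.
Qed.

(** On W = m the cell [j] contains m_j points of S, so m_j P(W = m) is the sum of P(i in S, W = m)
    over the i in that cell. Given i in S, W = m means that S minus i has counts [decr m j], and
    [palm_error_bound] applies term by term. *)
Lemma palm_counts (m : {ffun J -> nat}) j : (0 < m j)%N ->
  `|(m j)%:R * pr [set s | counts (S s) == m] -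
    (\sum_(i | cell i == j) hit_prob i) * pr [set s | counts (S s) == decr m j]|
  <= \sum_i palm_error i.
Proof.
move=> mj.
have -> : (m j)%:R * pr [set s | counts (S s) == m] =
    \sum_(i | cell i == j) pr ([set s | i \in S s] `&` [set s | counts (S s) == m]).
  under eq_bigr => i _ do rewrite (pr_decomp P mS (fun D => counts D == m))//.
  rewrite -[[set s | counts (S s) == m]]setTI (pr_decomp P mS (fun D => counts D == m))//.
  rewrite mulr_sumr exchange_big/=; apply: eq_bigr => D /eqP Dm.
  rewrite setTI (bigID (mem D))/= [X in _ = _ + X]big1 => [|i /andP[_ iD]]; last first.
    rewrite (_ : _ `&` _ = set0); last first.
      by apply/seteqP; split => // s [/= + sD]; rewrite sD (negbTE iD).
    exact: pr_set0.
  rewrite addr0 (eq_bigr (fun=> pr [set s | S s = D])) => [|i /andP[_ iD]]; last first.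
    by congr pr; apply/seteqP; split => [s []//|s /= sD]; rewrite sD.
  rewrite sumr_const mulr_natl; congr (_ *+ _).
  by rewrite -Dm ffunE; apply: eq_card => i; rewrite !inE andbC.
rewrite mulr_suml -sumrB (le_trans (ler_norm_sum _ _ _))//.
apply: (@le_trans _ _ (\sum_(i | cell i == j) palm_error i)).
  apply: ler_sum => i /eqP ij.
  have -> : [set s | i \in S s] `&` [set s | counts (S s) == m] =
      [set s | i \in S s] `&` [set s | counts (S s :\ i) == decr m j].
    apply/seteqP; split => s [/= iS /eqP e]; split => //=.
      by rewrite countsD1// e ij.
    apply/eqP; apply: (@decr_inj _ _ j) => //; last by rewrite -e countsD1// ij.
    by rewrite ffunE; apply/card_gt0P; exists i; rewrite !inE iS ij eqxx.
  exact: (palm_error_bound i (fun D => counts D == decr m j)).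
rewrite [leRHS](bigID (fun i => cell i == j))/= lerDl sumr_ge0// => i _.
exact: palm_error_ge0.
Qed.

End palm.

(** * Poisson limits from approximate recursions *)

Section poisson_limit.
Context (R : realType).

(** The recursion gives b k = lam^k / k! b 0 in the limit, with b 0 unknown. The lower bound on
    partial sums is tightness uniform in n; it lets the normalization pass to the limit and fixes b
    0. *)
Lemma total_poisson_limit (lam : R) (b : nat -> nat -> R) (eta : nat -> R) :
  0 <= lam ->
  eta n @[n --> \oo] --> 0 ->
  (\forall n \near \oo, [/\ 0 <= b n 0%N <= 1,
     forall k, `|k.+1%:R * b n k.+1 - lam * b n k| <= eta n &
     forall K, (0 < K)%N -> 1 - lam / K%:R <= \sum_(k < K) b n k <= 1]) ->
  b n 0%N @[n --> \oo] --> expR (- lam).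
Proof.
move=> lam0 eta0 hb.
have bk k : (b n k - lam ^+ k / k`!%:R * b n 0%N) @[n --> \oo] --> 0.
  elim: k => [|k ih].
    by under eq_fun do rewrite expr0 fact0 divr1 mul1r subrr; exact: cvg_cst.
  apply/norm_cvg0P.
  apply: (@squeeze_cvgr _ _ _ _ (fun=> 0) (fun n => eta n +
    lam * `|b n k - lam ^+ k / k`!%:R * b n 0%N|)); last first.
  - rewrite [X in _ --> X](_ : 0 = 0 + lam * 0); last by rewrite mulr0 addr0.
    apply: cvgD => //.
    by apply: cvgMr; exact/norm_cvg0P.
  - exact: cvg_cst.
  near=> n; rewrite normr_ge0/=.
  have [_ /(_ k) h _] : [/\ 0 <= b n 0%N <= 1,
     forall k, `|k.+1%:R * b n k.+1 - lam * b n k| <= eta n &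
     forall K, (0 < K)%N -> 1 - lam / K%:R <= \sum_(k < K) b n k <= 1] by near: n.
  apply: (@le_trans _ _ `|k.+1%:R * (b n k.+1 - lam ^+ k.+1 / k.+1`!%:R * b n 0%N)|).
    by rewrite normrM ler_peMl// ger0_norm// ler1n.
  have -> : k.+1%:R * (b n k.+1 - lam ^+ k.+1 / k.+1`!%:R * b n 0%N) =
     (k.+1%:R * b n k.+1 - lam * b n k) + lam * (b n k - lam ^+ k / k`!%:R * b n 0%N).
    rewrite factS natrM exprS; field.
    by rewrite addrC natr1 !pnatr_eq0 -!lt0n fact_gt0.
  by rewrite (le_trans (ler_normD _ _))// lerD// normrM ger0_norm.
pose s K := \sum_(k < K) lam ^+ k / k`!%:R.
have sK K : (\sum_(k < K) b n k - s K * b n 0%N) @[n --> \oo] --> 0.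
  elim: K => [|K ih].
    under eq_fun do rewrite /s !big_ord0 mul0r subrr; exact: cvg_cst.
  have -> : (fun n => \sum_(k < K.+1) b n k - s K.+1 * b n 0%N) =
      (fun n => (\sum_(k < K) b n k - s K * b n 0%N) + (b n K - lam ^+ K / K`!%:R * b n 0%N)).
    by apply/funext => n; rewrite /s !big_ord_recr/=; ring.
  by rewrite -[X in _ --> X]addr0; exact: cvgD.
have s_exp : (1 - s K * expR (- lam)) @[K --> \oo] --> 0.
  rewrite [X in _ --> X](_ : _ = 1 - expR lam * expR (- lam)); last first.
    by rewrite expRN divff ?subrr// gt_eqF// expR_gt0.
  apply: cvgB; first exact: cvg_cst.
  apply: cvgMl.
  have := @is_cvg_series_exp_coeff R lam.
  rewrite [X in X @ _ --> _](_ : s = series (exp_coeff lam)) //.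
  by apply/funext => K; rewrite /s /series/= big_mkord.
have lamK : (lam / K%:R) @[K --> \oo] --> 0.
  rewrite -[X in _ --> X](mulr0 lam); apply: cvgMr.
  apply/gtr0_cvgV0; last exact: cvgr_idn.
  by near=> n; rewrite ltr0n; near: n; exact: nbhs_infty_gt.
apply/cvgrPdist_le => e e0.
have [K [K0 Ke Ks]] : exists K, [/\ (0 < K)%N, lam / K%:R <= e / 3 &
    `|1 - s K * expR (- lam)| <= e / 3].
  near \oo => K; exists K; split.
  - by near: K; exact: nbhs_infty_gt.
  - have : `|0 - lam / K%:R| <= e / 3.
      by near: K; move/cvgrPdist_le : lamK; apply; rewrite divr_gt0.
    by rewrite sub0r normrN; exact/le_trans/ler_norm.
  - have : `|0 - (1 - s K * expR (- lam))| <= e / 3.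
      by near: K; move/cvgrPdist_le : s_exp; apply; rewrite divr_gt0.
    by rewrite sub0r normrN.
near=> n.
have [/andP[b0 b1] _ /(_ K K0)/andP[S1 S2]] : [/\ 0 <= b n 0%N <= 1,
   forall k, `|k.+1%:R * b n k.+1 - lam * b n k| <= eta n &
   forall K, (0 < K)%N -> 1 - lam / K%:R <= \sum_(k < K) b n k <= 1] by near: n.
have : `|0 - (\sum_(k < K) b n k - s K * b n 0%N)| <= e / 3.
  by near: n; move/cvgrPdist_le : (sK K); apply; rewrite divr_gt0.
rewrite sub0r normrN => Sb.
set E := expR (- lam).
have E0 : 0 <= E by exact: expR_ge0.
have E1 : E <= 1 by rewrite /E -expR0 ler_expR oppr_le0.
(* The three terms are small by the exponential series, by tightness and by the recursion,
   respectively. *)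
have -> : E - b n 0%N = - ((1 - s K * E) * b n 0%N) +
  (E * (1 - \sum_(k < K) b n k) + E * (\sum_(k < K) b n k - s K * b n 0%N)) by ring.
rewrite (le_trans (ler_normD _ _))// normrN.
have -> : e = e / 3 + (e / 3 + e / 3) by field.
rewrite lerD//.
  by rewrite normrM (ger0_norm b0) (le_trans _ Ks)// ler_piMr.
rewrite (le_trans (ler_normD _ _))// lerD//.
  rewrite normrM (ger0_norm E0) ger0_norm ?subr_ge0//.
  rewrite (le_trans (ler_piMl _ E1)) ?subr_ge0// (le_trans _ Ke)//.
  by rewrite lerBlDr -lerBlDl.
by rewrite normrM (ger0_norm E0) (le_trans _ Sb)// ler_piMl.
Unshelve. all: by end_near. Qed.

(** Induction on the total of [m], lowering one positive entry at a time. The value at m = 0 is a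
    separate input, which the recursion cannot provide. *)
Lemma counts_poisson_limit (J : finType) (lam : J -> R) (lamn : nat -> J -> R)
    (a : nat -> {ffun J -> nat} -> R) (a0 : R) (eta : nat -> R) :
  (forall j, lamn n j @[n --> \oo] --> lam j) ->
  eta n @[n --> \oo] --> 0 ->
  (\forall n \near \oo, forall (m : {ffun J -> nat}) j, (0 < m j)%N ->
     `|(m j)%:R * a n m - lamn n j * a n (decr m j)| <= eta n) ->
  a n [ffun=> 0%N] @[n --> \oo] --> a0 ->
  forall m : {ffun J -> nat},
    a n m @[n --> \oo] --> a0 * \prod_j (lam j ^+ m j / (m j)`!%:R).
Proof.
move=> lamE eta0 ha ha0 m.
have [k] := ubnP (\sum_j m j)%N; elim: k m => // k ih m mk.
have [/forallP m0|] := boolP [forall j, m j == 0%N].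
  rewrite big1 => [|j _]; last by rewrite (eqP (m0 j)) expr0 fact0 divr1.
  rewrite mulr1; have -> : m = [ffun=> 0%N] by apply/ffunP => j; rewrite ffunE; exact/eqP.
  exact: ha0.
rewrite negb_forall => /existsP[j mj]; have mj0 : (0 < m j)%N by rewrite lt0n.
have dk : (\sum_i decr m j i < k)%N.
  move: mk; rewrite (bigD1 j)//= [X in _ -> (X < _)%N](bigD1 j)//= ffunE eqxx.
  have -> : (\sum_(i | i != j) decr m j i = \sum_(i | i != j) m i)%N.
    by apply: eq_bigr => i ij; rewrite ffunE (negbTE ij) subn0.
  by move: (\sum_(i | i != j) m i)%N mj0 => q; lia.
have {ih} ih := ih _ dk.
rewrite [X in _ --> X](_ : _ = (m j)%:R^-1 * (lam j *
    (a0 * \prod_i (lam i ^+ decr m j i / (decr m j i)`!%:R)))); last first.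
  rewrite (bigD1 j)//= [in RHS](bigD1 j)//= ffunE eqxx.
  rewrite [X in _ = _ * (_ * (_ * (_ * X)))](eq_bigr
    (fun i => lam i ^+ m i / (m i)`!%:R)) => [|i ij]; last by rewrite ffunE (negbTE ij) subn0.
  case: (m j) mj0 => // q _; rewrite subn1/= factS natrM exprS; field.
  by rewrite addrC natr1 !pnatr_eq0 -!lt0n fact_gt0.
have -> : (fun n => a n m) = (fun n => (m j)%:R^-1 * (((m j)%:R * a n m - lamn n j * a n (decr m j))
    + lamn n j * a n (decr m j))).
  by apply/funext => n; rewrite subrK mulKf// pnatr_eq0.
apply: cvgMr; rewrite -[X in _ --> X]add0r; apply: cvgD; last exact: cvgM.
apply/norm_cvg0P.
apply: (@squeeze_cvgr _ _ _ _ (fun=> 0) eta) => //; last exact: cvg_cst.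
by near=> n; rewrite normr_ge0/=; move: (m) (j) (mj0); near: n.
Unshelve. all: by end_near. Qed.

End poisson_limit.

Section error_asymptotics.
Context (R : realType).

Lemma cvg_expRN (a : R) (u : nat -> R) : 0 < a ->
  u n @[n --> \oo] --> +oo -> expR (- (a * u n)) @[n --> \oo] --> 0.
Proof.
move=> a0 uoo.
have auoo : (a * u n) @[n --> \oo] --> +oo.
  apply/cvgryPge => A; near=> n; rewrite -ler_pdivrMl//.
  by near: n; move/cvgryPge : uoo; exact.
apply: (@squeeze_cvgr _ _ _ _ (fun=> 0) (fun n => (a * u n)^-1)).
- near=> n; rewrite expR_ge0/= expRN lef_pV2 ?posrE ?expR_gt0//.
    by rewrite (le_trans _ (expR_ge1Dx _))// lerDr.
  by near: n; move/cvgryPgt : auoo; exact.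
- exact: cvg_cst.
- by apply/gtr0_cvgV0 => //; near=> n; near: n; move/cvgryPgt : auoo; exact.
Unshelve. all: by end_near. Qed.

Lemma cvg_mul_expRN (a : R) (u : nat -> R) : 0 < a ->
  u n @[n --> \oo] --> +oo -> (u n * expR (- (a * u n))) @[n --> \oo] --> 0.
Proof.
move=> a0 uoo.
have h := cvg_expRN (divr_gt0 a0 (ltr0n _ 2)) uoo.
(* Half of the exponent absorbs the factor: u <= (2 / a) exp(a u / 2). *)
apply: (@squeeze_cvgr _ _ _ _ (fun=> 0) (fun n => (2 / a) * expR (- (a / 2 * u n)))).
- near=> n; have u0 : 0 <= u n by near: n; move/cvgryPge : uoo; exact.
  rewrite mulr_ge0 ?expR_ge0//=.
  have -> : - (a * u n) = - (a / 2 * u n) + - (a / 2 * u n) by field.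
  rewrite expRD mulrA ler_wpM2r ?expR_ge0// expRN ler_pdivrMr ?expR_gt0//.
  rewrite -ler_pdivrMl ?divr_gt0// invf_div (le_trans _ (expR_ge1Dx _))//.
  by rewrite lerDr.
- exact: cvg_cst.
- by rewrite -[X in _ --> X](mulr0 (2 / a)); exact: cvgMr.
Unshelve. all: by end_near. Qed.

End error_asymptotics.

(** * Pair probabilities on the box *)

Section sites.
Variables (d l : nat).
Hypothesis l_le : (l <= d.+1)%N.

(** Coordinates of a box site, padded with zeros. Indexing the box by a finite function type makes
    the random sets subsets of a [finType] and lets counts of sites factor over the coordinates. *)
Definition site n (f : {ffun 'I_l -> 'I_n}) : lattice d.+1 :=
  \row_i (if insub (i : nat) is Some k then (f k : nat)%:Z else 0).

Lemma site_coord n (f : {ffun 'I_l -> 'I_n}) (k : 'I_l) :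
  site f 0 (widen_ord l_le k) = (f k : nat)%:Z.
Proof. by rewrite mxE/= valK. Qed.

Lemma site_coord0 n (f : {ffun 'I_l -> 'I_n}) (i : 'I_d.+1) :
  (l <= i)%N -> site f 0 i = 0.
Proof. by move=> li; rewrite mxE insubF// ltnNge li. Qed.

Lemma site_inj n : injective (@site n).
Proof.
move=> f g /rowP fg; apply/ffunP => k; apply: val_inj.
by have := fg (widen_ord l_le k); rewrite !site_coord => -[].
Qed.

Lemma box_site n : @box d.+1 l n = range (@site n).
Proof.
apply/seteqP; split => [x [x_lt x_ge]|_ [f _ <-]]; last first.
  split=> i li; last exact: site_coord0.
  have -> : i = widen_ord l_le (Ordinal li) by exact: val_inj.
  by rewrite site_coord; have := ltn_ord (f (Ordinal li)); lia.
have xk (k : 'I_l) : (absz (x 0 (widen_ord l_le k))%R < n)%N.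
  by have := x_lt (widen_ord l_le k) (ltn_ord k); lia.
exists [ffun k => Ordinal (xk k)] => //; apply/rowP => i.
have [il|li] := ltnP i l; last by rewrite site_coord0// x_ge.
have -> : i = widen_ord l_le (Ordinal il) by exact: val_inj.
rewrite site_coord ffunE/= gez0_abs//.
by have := x_lt (widen_ord l_le (Ordinal il)) il; lia.
Qed.

Lemma box_fset_site n : box_fset d.+1 l n =
  [fset site f | f in {: {ffun 'I_l -> 'I_n}}]%fset.
Proof.
apply/fsetP => x; rewrite /box_fset in_fset_set box_site; last first.
  exact: finite_image.
apply/idP/imfsetP => [|[f _ ->]]; last by rewrite inE; exists f.
by rewrite inE => -[f _ <-]; exists f.
Qed.

Lemma card_box n : #|` box_fset d.+1 l n| = (n ^ l)%N.
Proof.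
rewrite box_fset_site card_imfset/=; last exact: site_inj.
by rewrite -cardE card_ffun !card_ord.
Qed.

Lemma big_box_fset n (R : Type) (idx : R) (op : Monoid.com_law idx)
    (Q : pred (lattice d.+1)) (F : lattice d.+1 -> R) :
  \big[op/idx]_(x <- box_fset d.+1 l n | Q x) F x =
  \big[op/idx]_(f : {ffun 'I_l -> 'I_n} | Q (site f)) F (site f).
Proof.
rewrite box_fset_site big_mkcond big_imfset/=; last by move=> f g _ _; exact: site_inj.
by rewrite big_enum/= -big_mkcond.
Qed.

End sites.

Section error_sum.
Context (R : realType) (d l : nat).
Hypothesis d_ge3 : (3 <= d.+1)%N.
Hypothesis l_gt0 : (0 < l)%N.
Hypothesis l_le : (l <= d.+1)%N.
Variable c : R.
Hypothesis c_ge : 1000 <= c.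
Local Notation G := (@green_real R d).
Local Notation rho1 := (potential1 c).

Let c_gt0 : 0 < c. Proof. by apply: lt_le_trans c_ge; rewrite ltr0n. Qed.

Let G0_gt0 : 0 < G 0.
Proof. by rewrite (lt_le_trans _ (green_real_ge1 d_ge3 c_ge)). Qed.

Definition pair_void_prob (L : R) (v : lattice d.+1) : R :=
  expR (- (G 0 * L * (2 / (G 0 + G v)))).

(** Chosen so that 1 + green_gap = 2 / (1 + rho1): two distinct sites have capacity at least (1 +
    green_gap) / g(0), uniformly in their positions. *)
Definition green_gap : R := (1 - rho1) / (1 + rho1).

Lemma potential1_gt0 : 0 < rho1.
Proof. by rewrite powR_gt0// divr_gt0// addr_gt0. Qed.

Lemma green_gap_gt0 : 0 < green_gap.
Proof.
rewrite divr_gt0 ?subr_gt0 ?potential1_lt1// addr_gt0// potential1_gt0//.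
Qed.

Lemma pair_void_prob_le (L t : R) v : 0 <= L -> 0 <= t -> G v <= G 0 * t ->
  pair_void_prob L v <= expR (- (L * (2 / (1 + t)))).
Proof.
move=> L0 t0 Gv; rewrite ler_expR lerN2.
have Gv0 : 0 <= G v by exact: (green_real_ge0 d_ge3 c_ge).
have GG : 0 < G 0 + G v by rewrite ltr_pwDl.
have -> : G 0 * L * (2 / (G 0 + G v)) = L * (G 0 * (2 / (G 0 + G v))) by ring.
rewrite ler_wpM2l// ler_pdivrMr ?ltr_pwDl//.
have -> : G 0 * (2 / (G 0 + G v)) * (1 + t) = 2 * (G 0 * (1 + t)) / (G 0 + G v) by ring.
by rewrite ler_pdivlMr// ler_pM2l// mulrDr mulr1 lerD2l.
Qed.

Lemma pair_void_prob_near (L : R) v : 0 <= L -> v != 0 ->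
  pair_void_prob L v <= expR (- ((1 + green_gap) * L)).
Proof.
move=> L0 v0; have p0 := potential1_gt0.
have -> : (1 + green_gap) * L = L * (2 / (1 + rho1)).
  by rewrite /green_gap; field; rewrite gt_eqF// addr_gt0.
apply: pair_void_prob_le => //; first exact: ltW.
rewrite (le_trans (green_real_le d_ge3 c_ge v))// ler_pM2l//.
exact: potential_le1.
Qed.

Definition far_potential (xi : R) : R := (xi ^+ 2 / c) `^ (- 3^-1).

Lemma pair_void_prob_far (L xi : R) v : 0 <= L -> 0 < xi -> xi ^+ 2 <= sqnorm R v ->
  pair_void_prob L v - expR (- L) ^+ 2 <=
  expR (- L) ^+ 2 * (expR (2 * L * far_potential xi) - 1).
Proof.
move=> L0 xi0 xiv; have f0 : 0 <= far_potential xi by exact: powR_ge0.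
rewrite mulrBr mulr1 lerD2r -expRM_natl -expRD.
rewrite (le_trans (pair_void_prob_le (t := far_potential xi) L0 f0 _))//.
  rewrite (le_trans (green_real_le d_ge3 c_ge v))// ler_pM2l//.
  rewrite /potential /far_potential !powRN lef_pV2 ?posrE ?powR_gt0 ?divr_gt0 ?exprn_gt0//.
    apply: ge0_ler_powR; rewrite ?nnegrE ?invr_ge0//.
    - by rewrite divr_ge0 ?sqr_ge0 ?ltW.
    - by rewrite divr_ge0 ?addr_ge0 ?sqnorm_ge0 ?ltW.
    - by rewrite ler_pM2r ?invr_gt0// (le_trans xiv)// lerDl ltW.
  by rewrite ltr_wpDl ?sqnorm_ge0.
rewrite ler_expR; move: (far_potential xi) f0 => t t0.
have -> : 2 * - L + 2 * L * t = - (L * (2 - 2 * t)) by ring.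
(* It remains to see that 2 / (1 + t) >= 2 - 2 t. *)
rewrite lerN2 ler_wpM2l// ler_pdivlMr; last by rewrite ltr_pwDl.
have := sqr_ge0 t; rewrite -subr_ge0 => t2.
rewrite -subr_ge0; have -> : 2 - (2 - 2 * t) * (1 + t) = 2 * t ^+ 2 by ring.
by rewrite mulr_ge0 ?sqr_ge0.
Qed.

Definition near_coord (xi : R) (a b : nat) : bool := `|a%:R - b%:R| <= xi.

Lemma near_coord_count n (b : nat) (xi : R) : 1 <= xi ->
  \sum_(a < n) (near_coord xi a b)%:R <= 3 * xi.
Proof.
move=> xi1; set r := Num.truncn xi.
have xi0 : 0 <= xi by rewrite (le_trans _ xi1).
have r_le : r%:R <= xi by rewrite truncn_le.
have near_le a : near_coord xi a b -> (a <= b + r)%N /\ (b <= a + r)%N.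
  have xi_r (k : nat) : k%:R <= xi -> (k <= r)%N.
    by move=> kxi; rewrite -ltnS -(ltr_nat R) (le_lt_trans kxi)// truncnS_gt.
  rewrite /near_coord; case: (leqP a b) => ab.
    by rewrite distrC -natrB// normr_nat => /xi_r; lia.
  by rewrite -natrB ?(ltnW ab)// normr_nat => /xi_r; lia.
rewrite -natr_sum.
have -> : (\sum_(a < n) near_coord xi a b = #|[pred a : 'I_n | near_coord xi a b]|)%N.
  by rewrite -sum1_card [RHS]big_mkcond; apply: eq_bigr => a _; rewrite inE; case: near_coord.
(* All such [a] lie among the 2 r + 1 integers starting at b - r, or at 0 if b < r. Finally 2 r + 1
   <= 3 xi since xi >= 1. *)
have : (#|[pred a : 'I_n | near_coord xi a b]| <= 2 * r + 1)%N.
  rewrite -[X in (_ <= X)%N](size_iota (b - r)) cardE -(size_map val).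
  apply: uniq_leq_size; first by rewrite (map_inj_uniq val_inj) enum_uniq.
  move=> _ /mapP[a + ->]; rewrite mem_enum inE mem_iota => /near_le[] /=.
  by clearbody r; lia.
rewrite -(ler_nat R) => /le_trans; apply.
by rewrite natrD natrM; lra.
Qed.

Definition near_sites n (xi : R) (f g : {ffun 'I_l -> 'I_n}) : bool :=
  [forall k, near_coord xi (g k) (f k)].

Lemma near_sites_count n (xi : R) (f : {ffun 'I_l -> 'I_n}) : 1 <= xi ->
  \sum_(g : {ffun 'I_l -> 'I_n}) (near_sites xi f g)%:R <= (3 * xi) ^+ l :> R.
Proof.
move=> xi1.
have -> : \sum_(g : {ffun 'I_l -> 'I_n}) (near_sites xi f g)%:R =
    \prod_(k < l) \sum_(a < n) (near_coord xi a (f k))%:R :> R.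
  rewrite bigA_distr_bigA/=; apply: eq_bigr => g _.
  rewrite /near_sites; case: forallP => [h|/forallP]; first by rewrite big1// => k _; rewrite h.
  rewrite negb_forall => /existsP[k nk].
  by rewrite (bigD1 k)//= (negbTE nk) mul0r.
rewrite -[X in _ <= _ ^+ X]card_ord -prodr_const ler_prod// => k _.
by rewrite sumr_ge0//= near_coord_count.
Qed.

Lemma far_sites_sqnorm n (xi : R) (f g : {ffun 'I_l -> 'I_n}) : 0 <= xi ->
  ~~ near_sites xi f g -> xi ^+ 2 <= sqnorm R (site d f - site d g).
Proof.
move=> xi0; rewrite negb_forall => /existsP[k]; rewrite -ltNge => fgk.
rewrite /sqnorm (bigD1 (widen_ord l_le k))//= ler_wpDr//.
  by apply: sumr_ge0 => i _; exact: sqr_ge0.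
have -> : (site d f - site d g) 0 (widen_ord l_le k) = (f k : nat)%:Z - (g k : nat)%:Z.
  by rewrite !mxE/= valK.
rewrite rmorphB/=.
rewrite -(real_normK (num_real (_ - _))) lerXn2r ?nnegrE// distrC ltW//.
Qed.

(** Diagonal terms, pairs with all coordinates within xi = exp(green_gap L / (2 l)), and the
    remaining pairs. A site has at most (3 xi)^l near neighbours, and xi^l = exp(green_gap L / 2)
    spends only half of the gain in [pair_void_prob_near]. Still xi is exponentially large in L, so
    L times the potential at distance xi is negligible. *)
Definition error_bound (z L : R) : R :=
  expR (- z) * expR (- L) + expR (- z) * 3 ^+ l * expR (- (green_gap / 2 * L)) +
  expR (- z) ^+ 2 * (expR (2 * L * far_potential (expR (green_gap / (2 * l%:R) * L))) - 1).

Lemma error_sum_le n (z L : R) : 0 <= L -> (n ^ l)%:R = expR (L - z) ->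
  \sum_(f : {ffun 'I_l -> 'I_n}) (expR (- L) ^+ 2 +
    \sum_(g | g != f) (pair_void_prob L (site d f - site d g) - expR (- L) * expR (- L)))
  <= error_bound z L.
Proof.
move=> L0 nL; set xi := expR (green_gap / (2 * l%:R) * L).
have gap0 := green_gap_gt0.
have xi1 : 1 <= xi by rewrite -expR0 ler_expR mulr_ge0// divr_ge0// ltW.
have xi0 : 0 < xi by exact: expR_gt0.
set A := expR (- ((1 + green_gap) * L)).
set B := expR (- L) ^+ 2 * (expR (2 * L * far_potential xi) - 1).
have B0 : 0 <= B.
  rewrite mulr_ge0 ?sqr_ge0// subr_ge0 -expR0 ler_expR.
  by rewrite !mulr_ge0// powR_ge0.
have term (f : {ffun 'I_l -> 'I_n}) : \sum_(g | g != f) (pair_void_prob L (site d f - site d g) -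
    expR (- L) * expR (- L)) <= (3 * xi) ^+ l * A + (n ^ l)%:R * B.
  apply: (@le_trans _ _ (\sum_(g : {ffun 'I_l -> 'I_n}) ((near_sites xi f g)%:R * A + B))).
    rewrite [leRHS](bigID (fun g => g != f))/= ler_wpDr//.
      by apply: sumr_ge0 => g _; rewrite addr_ge0// mulr_ge0 ?expR_ge0.
    apply: ler_sum => g gf; have [nfg|nfg] := boolP (near_sites xi f g).
      rewrite mul1r ler_wpDr// lerBlDr ler_wpDr ?mulr_ge0 ?expR_ge0//.
      apply: pair_void_prob_near => //; rewrite subr_eq0.
      by apply: contraNneq gf => /(site_inj l_le) ->.
    rewrite mul0r add0r -expr2; apply: pair_void_prob_far => //.
    by apply: far_sites_sqnorm => //; exact: ltW.
  rewrite big_split/= -mulr_suml sumr_const card_ffun !card_ord -[B *+ _]mulr_natl lerD2r.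
  by rewrite ler_wpM2r ?expR_ge0// near_sites_count.
apply: (@le_trans _ _ (\sum_(f : {ffun 'I_l -> 'I_n})
    (expR (- L) ^+ 2 + ((3 * xi) ^+ l * A + (n ^ l)%:R * B)))).
  by apply: ler_sum => f _; rewrite lerD2l.
rewrite sumr_const card_ffun !card_ord -[_ *+ _]mulr_natl nL /error_bound -/xi.
set y := expR (- L); set x := expR (- z); set w := expR (- (green_gap / 2 * L)).
have y0 : y != 0 by rewrite gt_eqF// expR_gt0.
have w0 : w != 0 by rewrite gt_eqF// expR_gt0.
have -> : expR (L - z) = x / y by rewrite expRD mulrC /y [expR (- L)]expRN invrK.
have -> : A = y * w ^+ 2.
  by rewrite -expRM_natl -expRD; congr expR; field.
have -> : (3 * xi) ^+ l = 3 ^+ l / w.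
  rewrite exprMn /w expRN invrK -expRM_natl; congr (_ * expR _); field.
  by rewrite pnatr_eq0 -lt0n.
rewrite /B -/y; set E := expR _ - 1.
rewrite le_eqVlt; apply/orP; left; apply/eqP; field.
by rewrite y0.
Qed.

End error_sum.

Section error_limit.
Context (R : realType) (l : nat) (c : R).
Hypothesis l_gt0 : (0 < l)%N.
Hypothesis c_ge : 1000 <= c.

Let c_gt0 : 0 < c. Proof. by apply: lt_le_trans c_ge; rewrite ltr0n. Qed.

Lemma cvg_error_bound (z : R) (L : nat -> R) : L n @[n --> \oo] --> +oo ->
  error_bound l c z (L n) @[n --> \oo] --> 0.
Proof.
move=> Loo; have gap0 := green_gap_gt0 c_ge; rewrite /error_bound.
set k := green_gap c / (2 * l%:R).
have k0 : 0 < k by rewrite divr_gt0// mulr_gt0// ltr0n.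
(* The potential at distance xi is c^(1/3) xi^(-2/3), exponentially small in [u]. *)
have far u : far_potential c (expR (k * u)) = c `^ 3^-1 * expR (- (2 / 3 * k * u)).
  rewrite /far_potential powRN -expRM_natl.
  rewrite powRM ?invr_ge0 ?expR_ge0 ?(ltW c_gt0)// invfM mulrC; congr (_ * _).
    by rewrite -powRN -powR_inv1 ?(ltW c_gt0)// -powRrM mulN1r opprK.
  by rewrite -expRM -expRN; congr expR; field.
rewrite [X in _ --> X](_ : 0 = expR (- z) * 0 + expR (- z) * 3 ^+ l * 0 +
  expR (- z) ^+ 2 * (expR (2 * (c `^ 3^-1 * 0)) - 1)); last first.
  by rewrite !mulr0 expR0 subrr mulr0 !addr0.
apply: cvgD; first apply: cvgD.
- apply: cvgMr.
  have := cvg_expRN (@ltr01 R) Loo; under eq_fun do rewrite mul1r; exact.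
- apply: cvgMr; apply: cvg_expRN => //; exact: divr_gt0.
- apply: cvgMr; apply: cvgB; last exact: cvg_cst.
  apply: continuous_cvg; first exact: continuous_expR.
  rewrite (_ : (fun n => _) = (fun n => 2 * (c `^ 3^-1 * (L n * expR (- (2 / 3 * k * L n)))))); last first.
    by apply/funext => n; rewrite far; ring.
  apply: cvgMr; apply: cvgMr; apply: cvg_mul_expRN => //.
  by rewrite mulr_gt0// divr_gt0.
Qed.

End error_limit.

(** * Poisson limit of the counts of a sequence of random sets *)

Section palm_limit.
Context dO (Omega : measurableType dO) (R : realType) (P : probability Omega R).
Variables (I : nat -> finType) (S : forall n, Omega -> {set I n}).
Variable S' : forall n, I n -> Omega -> {set I n}.
Hypothesis mS : forall n i, measurable [set s | i \in S n s].
Hypothesis mS' : forall n i j, measurable [set s | j \in @S' n i s].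
Hypothesis sub_S' : forall n i s, S n s \subset S' i s.
Hypothesis S'_eq : forall n i s, i \in S n s -> S' i s = S n s.
Hypothesis S'_indep : forall n i (D : {set I n}),
  pr P ([set s | i \in S n s] `&` [set s | D \subset S' i s]) =
  pr P [set s | i \in S n s] * pr P [set s | D \subset S' i s].
Variables (lam : R) (eta : nat -> R).
Hypothesis lam_ge0 : 0 <= lam.
Hypothesis eta0 : eta n @[n --> \oo] --> 0.
Hypothesis lamE : \forall n \near \oo, \sum_i hit_prob P (S n) i = lam.
Hypothesis err_le : \forall n \near \oo, \sum_i palm_error P (S n) i <= eta n.
Local Notation pr := (pr P).

(** Markov's inequality, the mean of #|S| being the sum of the hitting probabilities. It supplies
    the tightness required by [total_poisson_limit]. *)
Lemma card_markov n K : (0 < K)%N ->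
  1 - (\sum_i hit_prob P (S n) i) / K%:R <= \sum_(k < K) pr [set s | #|S n s| == k] <= 1.
Proof.
move=> K0.
have mSP (Phi : pred {set I n}) : measurable [set s | Phi (S n s)].
  exact: (measurable_setP (@mS n)).
have -> : \sum_(k < K) pr [set s | #|S n s| == k] = pr [set s | (#|S n s| < K)%N].
  rewrite -(@pr_sum _ _ _ _ _ (fun k : 'I_K => [set s | #|S n s| == k]) xpredT).
  - congr pr; apply/seteqP; split => s /=; first by move=> [k _ /= /eqP ->].
    by move=> sK; exists (Ordinal sK) => //=.
  - by move=> k; exact: (mSP (fun D => #|D| == k)).
  - move=> i j ij; apply/seteqP; split => // s [/= /eqP si /eqP sj].
    by move/eqP : ij; case; apply: val_inj; rewrite /= -si.
rewrite pr_le1 ?andbT; last exact: (mSP (fun D => (#|D| < K)%N)).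
have -> : [set s | (#|S n s| < K)%N] = setT `\` [set s | (K <= #|S n s|)%N].
  by apply/seteqP; split => s /=; rewrite ltnNge; [move/negP|case=> _ /negP].
rewrite pr_setD//; last exact: (mSP (fun D => (K <= #|D|)%N)).
rewrite pr_setT lerD2l lerN2 ler_pdivlMr ?ltr0n//.
have -> : \sum_i hit_prob P (S n) i = \sum_(D : {set I n}) #|D|%:R * pr [set s | S n s = D].
  transitivity (\sum_i \sum_(D : {set I n} | i \in D) pr [set s | S n s = D]).
    apply: eq_bigr => i _; rewrite /hit_prob -[[set s | i \in S n s]]setTI.
    rewrite (pr_decomp P (@mS n) (fun D => i \in D))//.
    by apply: eq_bigr => D _; rewrite setTI.
  rewrite (exchange_big_dep xpredT)//=; apply: eq_bigr => D _.
  by rewrite sumr_const mulr_natl.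
rewrite -[[set s | (K <= #|S n s|)%N]]setTI (pr_decomp P (@mS n) (fun D => (K <= #|D|)%N))//.
rewrite mulr_suml [leRHS](bigID (fun D : {set I n} => (K <= #|D|)%N))/=.
rewrite ler_wpDr//; first by apply: sumr_ge0 => D _; rewrite mulr_ge0// pr_ge0.
by apply: ler_sum => D KD; rewrite setTI mulrC ler_wpM2r ?pr_ge0// ler_nat.
Qed.

Lemma palm_total n k :
  `|k.+1%:R * pr [set s | #|S n s| == k.+1] -
    (\sum_i hit_prob P (S n) i) * pr [set s | #|S n s| == k]|
  <= \sum_i palm_error P (S n) i.
Proof.
pose cell (i : I n) := tt.
have countE q (D : {set I n}) : (counts cell D == [ffun=> q]) = (#|D| == q).
  have e : #|[set i in D | cell i == tt]| = #|D|.
    by apply: eq_card => i; rewrite !inE andbT.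
  apply/eqP/eqP => [/ffunP/(_ tt)|Dq]; first by rewrite !ffunE e.
  by apply/ffunP => -[]; rewrite !ffunE e.
have k0 : (0 < [ffun=> k.+1] tt)%N by rewrite ffunE.
have := palm_counts cell (@mS n) (@mS' n) (@sub_S' n)
  (@S'_eq n) (@S'_indep n) k0.
have -> : decr [ffun=> k.+1] tt = [ffun=> k].
  by apply/ffunP => -[]; rewrite !ffunE eqxx subn1.
have setE q : [set s | counts cell (S n s) == [ffun=> q]] = [set s | #|S n s| == q].
  by apply/seteqP; split => s /=; rewrite countE.
by rewrite ffunE !setE (eq_bigl xpredT).
Qed.

Lemma cvg_empty : pr [set s | #|S n s| == 0%N] @[n --> \oo] --> expR (- lam).
Proof.
apply: (@total_poisson_limit _ lam (fun n k => pr [set s | #|S n s| == k]) eta) => //.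
near=> n.
have mSP (Phi : pred {set I n}) : measurable [set s | Phi (S n s)].
  exact: (measurable_setP (@mS n)).
have lamn : \sum_i hit_prob P (S n) i = lam by near: n.
split.
- by rewrite pr_ge0 pr_le1//; exact: (mSP (fun D => #|D| == 0%N)).
- move=> k; rewrite -lamn (le_trans (palm_total n k))//; near: n.
  exact: err_le.
- by move=> K K0; rewrite -lamn; exact: card_markov.
Unshelve. all: by end_near. Qed.

Lemma cvg_counts (J : finType) (cell : forall n, I n -> J) (lamj : J -> R) :
  (forall j, \sum_(i | cell n i == j) hit_prob P (S n) i @[n --> \oo] --> lamj j) ->
  forall m : {ffun J -> nat},
  pr [set s | counts (cell n) (S n s) == m] @[n --> \oo] -->
  expR (- lam) * \prod_j (lamj j ^+ m j / (m j)`!%:R).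
Proof.
move=> lamjE.
apply: (@counts_poisson_limit _ _ _ (fun n j => \sum_(i | cell n i == j) hit_prob P (S n) i)
  (fun n m => pr [set s | counts (cell n) (S n s) == m]) _ eta) => //.
  near=> n => m j mj.
  rewrite (le_trans (palm_counts (@cell n) (@mS n) (@mS' n) (@sub_S' n)
    (@S'_eq n) (@S'_indep n) mj))//.
  by near: n.
(* All cells are empty iff S is, so the starting value of the recursion is the limit in [cvg_empty],
   whatever the partition. *)
have -> : (fun n => pr [set s | counts (cell n) (S n s) == [ffun=> 0%N]]) =
    (fun n => pr [set s | #|S n s| == 0%N]).
  apply/funext => n; congr pr; apply/seteqP; split => s /= /eqP.
    move=> /ffunP S0; rewrite cards_eq0; apply/eqP/setP => i; rewrite inE.
    apply/negP => iS; have := S0 (cell n i); rewrite !ffunE => /eqP.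
    by rewrite cards_eq0 => /eqP/setP/(_ i); rewrite !inE iS eqxx.
  move=> /eqP; rewrite cards_eq0 => /eqP ->; apply/eqP/ffunP => j; rewrite !ffunE.
  by apply/eqP; rewrite cards_eq0; apply/eqP/setP => i; rewrite !inE.
exact: cvg_empty.
Unshelve. all: by end_near. Qed.

End palm_limit.

(** * Cell counts of the uncovered sites *)

Section uncovered_sites.
Context (R : realType) (d l : nat).
Hypothesis d_ge3 : (3 <= d.+1)%N.
Hypothesis l_gt0 : (0 < l)%N.
Hypothesis l_le : (l <= d.+1)%N.
Variable c : R.
Hypothesis c_ge : 1000 <= c.
Variable Pwalk : lattice d.+1 -> probability (path_space d.+1) R.
Hypothesis Pwalk_law : forall x, walk_law x (Pwalk x).
Variable nu : {sigma_finite_measure set (trajectory_space d) -> \bar R}.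
Hypothesis nuP : interlacement_intensity Pwalk nu.
Context dO (Omega : measurableType dO) (P : probability Omega R).
Variable omega : Omega -> config (trajectory_space d * measurableTypeR R).
Hypothesis omegaP : interlacement_process P nu omega.
Local Notation G := (@green_real R d).
Local Notation pr := (pr P).
Local Notation sites n := {ffun 'I_l -> 'I_n}.

Let G0_gt0 : 0 < G 0.
Proof. by rewrite (lt_le_trans _ (green_real_ge1 d_ge3 c_ge)). Qed.

(** Equal to [uncovered_sites] up to a null event ([pr_uncovered_void]), but made of [void] events,
    whose probabilities and independence come directly from the Poisson process. *)
Definition void_sites n (u : R) (s : Omega) : {set sites n} :=
  [set f | `[< void omega (hitting [set site d f]) u s >]].

(** The set written S'_x in the overview, with x the site of [f]. *)
Definition void_sites_off n (u : R) (f : sites n) (s : Omega) : {set sites n} :=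
  [set g | `[< void omega (hitting [set site d g] `\` hitting [set site d f]) u s >]].

Definition uncovered_sites n (u : R) (s : Omega) : {set sites n} :=
  [set f | (u%:E < cover_level (omega s) (site d f))%E].

Let nu_fin (K : {fset lattice d.+1}) : (nu (hitting [set` K]) < +oo)%E.
Proof. by rewrite (nu_hittingE nuP) ltry. Qed.

Let nu1_fin x : (nu (hitting [set x]) < +oo)%E.
Proof. by have := nu_fin [fset x]%fset; rewrite set_fset1. Qed.

Lemma void_sitesP n u (g : sites n) s :
  reflect (void omega (hitting [set site d g]) u s) (g \in void_sites n u s).
Proof. by rewrite inE; exact: asboolP. Qed.

Lemma void_sites_offP n u (f g : sites n) s :
  reflect (void omega (hitting [set site d g] `\` hitting [set site d f]) u s)
    (g \in void_sites_off u f s).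
Proof. by rewrite inE; exact: asboolP. Qed.

Lemma measurable_void_sites n u (f : sites n) :
  measurable [set s | f \in void_sites n u s].
Proof.
rewrite (_ : [set s | _] = void omega (hitting [set site d f]) u).
  by apply: (measurable_void omegaP); exact: measurable_hitting.
by apply/seteqP; split => s /=; rewrite inE => /asboolP.
Qed.

Lemma measurable_void_sites_off n u (f g : sites n) :
  measurable [set s | g \in void_sites_off u f s].
Proof.
rewrite (_ : [set s | _] =
    void omega (hitting [set site d g] `\` hitting [set site d f]) u).
  apply: (measurable_void omegaP); apply: measurableD; exact: measurable_hitting.
by apply/seteqP; split => s /=; rewrite inE => /asboolP.
Qed.

Lemma measurable_uncovered_sites n u (f : sites n) :
  measurable [set s | f \in uncovered_sites n u s].
Proof.
rewrite (_ : [set s | _] = [set s | (u%:E < cover_level (omega s) (site d f))%E]).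
  exact: (measurable_cover_level omegaP).
by apply/seteqP; split => s /=; rewrite inE.
Qed.

Lemma void_sites_sub n u (f : sites n) s :
  void_sites n u s \subset void_sites_off u f s.
Proof.
apply/fintype.subsetP => g /void_sitesP gs; apply/void_sites_offP.
by apply: void_subset gs => w [].
Qed.

Lemma void_sites_off_eq n u (f : sites n) s : f \in void_sites n u s ->
  void_sites_off u f s = void_sites n u s.
Proof.
move=> /void_sitesP fs; apply/eqP; rewrite finset.eqEsubset void_sites_sub andbT.
apply/fintype.subsetP => g /void_sites_offP gs; apply/void_sitesP.
have := conj gs fs; rewrite -[_ /\ _]/((_ `&` _) s) -void_setU.
by apply: void_subset => w gw; have [fw|fw] := pselect (hitting [set site d f] w); [right|left].
Qed.

(** The event on [D] is that no trajectory up to level [u] hits a site of D while missing f. Such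
    trajectories are disjoint from those hitting f, and the Poisson process is independent on
    disjoint sets. *)
Lemma void_sites_off_indep n u (f : sites n) (D : {set sites n}) : 0 <= u ->
  pr ([set s | f \in void_sites n u s] `&` [set s | D \subset void_sites_off u f s]) =
  pr [set s | f \in void_sites n u s] * pr [set s | D \subset void_sites_off u f s].
Proof.
move=> u0; pose HD := hitting [set site d g | g in [set` D]] `\` hitting [set site d f].
have mHD : measurable HD by apply: measurableD; exact: measurable_hitting.
have -> : [set s | D \subset void_sites_off u f s] = void omega HD u.
  apply/seteqP; split => s /=.
    move=> /fintype.subsetP Ds; apply/voidP => k w v sk vu [[x [wx [g gD gx]]] wf].
    have := Ds g gD; rewrite inE => /asboolP/voidP/(_ k w v sk vu); apply.
    by split => //; exists x; split => //=; rewrite -gx.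
  move=> hs; apply/fintype.subsetP => g gD; rewrite inE; apply/asboolP.
  apply: void_subset hs => w [[x [wx /= xg]] wf]; split => //.
  by exists x; split => //; exists g.
have -> : [set s | f \in void_sites n u s] = void omega (hitting [set site d f]) u.
  by apply/seteqP; split => s /=; rewrite inE => /asboolP.
rewrite /pr; have mf := measurable_hitting [set site d f].
have dis : hitting [set site d f] `&` HD = set0 by apply/seteqP; split => // w [fw [_]].
rewrite (void_indep omegaP u mf mHD dis) fineM//; apply: fin_num_measure.
  exact: (measurable_void omegaP).
exact: (measurable_void omegaP).
Qed.

Lemma hit_prob_void n (L : R) (f : sites n) : 0 <= L ->
  hit_prob P (void_sites n (G 0 * L)) f = expR (- L).
Proof.
move=> L0; rewrite /hit_prob.
have -> : [set s | f \in void_sites n (G 0 * L) s] = void omega (hitting [set site d f]) (G 0 * L).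
  by apply/seteqP; split => s /=; rewrite inE => /asboolP.
rewrite /pr (void_prob omegaP)//; last 2 first.
- exact: measurable_hitting.
- by rewrite mulr_ge0// ltW.
rewrite /= -[fine _]/(capacity nu [set site d f]) (capacity1 d_ge3 Pwalk_law nuP c_ge).
by rewrite mulKf// gt_eqF.
Qed.

Lemma pair_prob_void n (L : R) (f g : sites n) : 0 <= L -> f != g ->
  pair_prob P (void_sites n (G 0 * L)) f g = pair_void_prob L (site d f - site d g).
Proof.
move=> L0 fg; rewrite /pair_prob.
have -> : [set s | (f \in void_sites n (G 0 * L) s) && (g \in void_sites n (G 0 * L) s)] =
    void omega (hitting [set site d f; site d g]) (G 0 * L).
  rewrite hittingU void_setU; apply/seteqP; split => s /=.
    by rewrite !inE => /andP[/asboolP ? /asboolP].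
  by move=> [? ?]; rewrite !inE; apply/andP; split; apply/asboolP.
have fin : (nu (hitting [set site d f; site d g]) < +oo)%E.
  by have := nu_fin [fset site d f; site d g]%fset; rewrite set_fsetU !set_fset1.
rewrite /pr (void_prob omegaP)//; last 2 first.
- exact: measurable_hitting.
- by rewrite mulr_ge0// ltW.
rewrite /= -[fine _]/(capacity nu [set site d f; site d g]).
rewrite (capacity2 d_ge3 Pwalk_law nuP c_ge); last first.
  by apply: contraNneq fg => /(site_inj l_le) ->.
by rewrite /pair_void_prob mulrC.
Qed.

Lemma pr_uncovered_void n u (Phi : pred {set sites n}) : 0 <= u ->
  pr [set s | Phi (uncovered_sites n u s)] = pr [set s | Phi (void_sites n u s)].
Proof.
move=> u0.
have mU := measurable_setP (@measurable_uncovered_sites n u).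
have mV := measurable_setP (@measurable_void_sites n u).
pose E := \bigcup_(f in [set f : sites n | true])
  (void omega (hitting [set site d f]) u `\` [set s | (u%:E < cover_level (omega s) (site d f))%E]).
have mE f : measurable (void omega (hitting [set site d f]) u `\`
    [set s | (u%:E < cover_level (omega s) (site d f))%E]).
  apply: measurableD; last exact: (measurable_cover_level omegaP).
  by apply: (measurable_void omegaP); exact: measurable_hitting.
have mEE : measurable E by apply: fin_bigcup_measurable => //; exact: finite_finset.
have E0 : pr E <= 0.
  rewrite (le_trans (pr_bigcup _ _ _))// big1// => f _.
  rewrite pr_setD//.
  - by rewrite /pr (cover_level_prob omegaP)// subrr.
  - exact: (measurable_cover_level omegaP).
  - by apply: (measurable_void omegaP); exact: measurable_hitting.
  - exact: (cover_level_subset omegaP).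
have UV s : ~ E s -> uncovered_sites n u s = void_sites n u s.
  move=> nE; apply/setP => f; rewrite !inE; apply/idP/asboolP.
    exact: (cover_level_subset omegaP).
  by move=> vf; apply/negPn/negP => uf; apply: nE; exists f => //; split => //=; exact/negP.
apply/le_anti/andP; split.
  rewrite -[leRHS]addr0 (le_trans _ (lerD (lexx _) E0))// (le_trans _ (pr_setU _ _ _))//.
  apply: pr_le => //; first exact: measurableU.
  move=> s /= Ps; have [Es|/UV e] := pselect (E s); [by right|left].
  by rewrite /= -e.
rewrite -[leRHS]addr0 (le_trans _ (lerD (lexx _) E0))// (le_trans _ (pr_setU _ _ _))//.
apply: pr_le => //; first exact: measurableU.
move=> s /= Ps; have [Es|/UV e] := pselect (E s); [by right|left].
by rewrite /= e.
Qed.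

Variable z : R.

Definition log_level n : R := ln (n ^ l)%:R + z.

Lemma cvg_log_level : log_level n @[n --> \oo] --> +oo.
Proof.
apply/cvgryPge => A; near=> n.
have nA : expR (A - z) <= n%:R by near: n; exact: nbhs_infty_ger.
rewrite -lerBlDr -[leLHS]expRK ler_ln ?posrE ?expR_gt0//.
  rewrite (le_trans nA)// ler_nat -{1}(expn1 n) leq_pexp2l//.
  by near: n; exact: nbhs_infty_gt.
by rewrite ltr0n expn_gt0; apply/orP; left; near: n; exact: nbhs_infty_gt.
Unshelve. all: by end_near. Qed.

Let log_level_ge0 : \forall n \near \oo, 0 <= log_level n /\ (0 < n)%N.
Proof.
near=> n; split; last by near: n; exact: nbhs_infty_gt.
by near: n; move/cvgryPge : cvg_log_level; exact.
Unshelve. all: by end_near. Qed.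

Let log_levelE n : (0 < n)%N -> (n ^ l)%:R = expR (log_level n - z).
Proof. by move=> n0; rewrite /log_level addrK lnK// posrE ltr0n expn_gt0 n0. Qed.

Lemma cvg_uncovered_counts (J : finType) (cell : forall n, sites n -> J) (v : J -> R) :
  (forall j, #|[pred f | cell n f == j]|%:R / (n ^ l)%:R @[n --> \oo] --> v j) ->
  forall m : {ffun J -> nat},
  pr [set s | counts (cell n) (uncovered_sites n (G 0 * log_level n) s) == m] @[n --> \oo] -->
  expR (- expR (- z)) * \prod_j ((expR (- z) * v j) ^+ m j / (m j)`!%:R).
Proof.
(* The level can be negative for small n. Truncating at 0 yields a nonnegative level for every n, as
   [void_sites_off_indep] assumes, and changes nothing for large n. *)
move=> vE m; pose u n := G 0 * Num.max 0 (log_level n).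
have u0 n : 0 <= u n by rewrite mulr_ge0 ?le_max ?lexx//; exact: ltW.
suff : pr [set s | counts (cell n) (void_sites n (u n) s) == m] @[n --> \oo] -->
    expR (- expR (- z)) * \prod_j ((expR (- z) * v j) ^+ m j / (m j)`!%:R).
  apply: cvg_trans; apply: near_eq_cvg; near=> n.
  have [L0 n0] : 0 <= log_level n /\ (0 < n)%N by near: n.
  rewrite /u max_r// -(pr_uncovered_void (fun D => counts (cell n) D == m))//.
  by rewrite mulr_ge0// ltW.
apply: (@cvg_counts _ _ _ P (fun n => sites n) (fun n => void_sites n (u n))
  (fun n => @void_sites_off n (u n)) _ _ _ _ _ _ (fun n => error_bound l c z (log_level n))).
- by move=> n f; exact: measurable_void_sites.
- by move=> n f g; exact: measurable_void_sites_off.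
- by move=> n f s; exact: void_sites_sub.
- by move=> n f s; exact: void_sites_off_eq.
- by move=> n f D; exact: void_sites_off_indep.
- exact: expR_ge0.
- by apply: cvg_error_bound => //; exact: cvg_log_level.
- near=> n; have [L0 n0] : 0 <= log_level n /\ (0 < n)%N by near: n.
  under eq_bigr do rewrite /u max_r// hit_prob_void//.
  rewrite sumr_const card_ffun !card_ord -[_ *+ _]mulr_natl log_levelE// -expRD.
  by congr expR; ring.
- near=> n; have [L0 n0] : 0 <= log_level n /\ (0 < n)%N by near: n.
  rewrite (le_trans _ (@error_sum_le R d l d_ge3 l_gt0 l_le c c_ge n z (log_level n) L0 _))//.
    apply: ler_sum => f _; rewrite /palm_error /u max_r// hit_prob_void// lerD2l.
    by apply: ler_sum => g gf; rewrite !hit_prob_void// pair_prob_void// eq_sym.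
  exact: log_levelE.
- move=> j.
  have h : (expR (- z) * (#|[pred f | cell n f == j]|%:R / (n ^ l)%:R)) @[n --> \oo] -->
      expR (- z) * v j by apply: cvgMr; exact: vE.
  apply: cvg_trans h; apply: near_eq_cvg; near=> n.
  have [L0 n0] : 0 <= log_level n /\ (0 < n)%N by near: n.
  under eq_bigr do rewrite /u max_r// hit_prob_void//.
  rewrite sumr_const -[RHS]mulr_natl log_levelE//.
  rewrite mulrCA; congr (_ * _); rewrite -expRN -expRD; congr expR; ring.
Unshelve. all: by end_near. Qed.

End uncovered_sites.

(** * Equidistribution of the sites among the cells *)

Section cell_counts.
Context (R : realType) (M : nat).

Lemma increment_bound (x y t u : R) : t <= x -> x <= t + 1 -> t + u <= y ->
  y <= t + u + 1 -> u - 1 <= y - x <= u + 1.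
Proof. by move=> *; apply/andP; split; lra. Qed.

Definition coord_cell n (a : nat) : 'I_M.+1 := inord ((M.+1 * a) %/ n).

(** (x + M) %/ M.+1 is the ceiling of x / (M + 1). A cell is thus an interval of integers between
    two ceilings, and its size is within 1 of n / (M + 1). *)
Lemma coord_cellE n (a : 'I_n) (j : 'I_M.+1) : (coord_cell n a == j) =
  ((j * n + M) %/ M.+1 <= a < (j.+1 * n + M) %/ M.+1)%N.
Proof.
have n0 : (0 < n)%N by exact: leq_trans (ltn_ord a).
have lt : ((M.+1 * a) %/ n < M.+1)%N by rewrite ltn_divLR// ltn_pmul2l.
rewrite -(inj_eq val_inj)/= inordK//.
have ceil x : ((x + M) %/ M.+1 <= a)%N = (x <= M.+1 * a)%N.
  rewrite -ltnS ltn_divLR// mulSn mulnC; lia.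
rewrite ltnNge !ceil -ltnNge -leq_divRL// -ltn_divLR// eqn_leq ltnS andbC//.
Qed.

Lemma coord_cell_count n (j : 'I_M.+1) :
  (\sum_(a < n) (coord_cell n a == j)%:R : R) =
  ((j.+1 * n + M) %/ M.+1)%:R - ((j * n + M) %/ M.+1)%:R.
Proof.
have le_n (i : nat) : (i <= M.+1)%N -> ((i * n + M) %/ M.+1 <= n)%N.
  move=> iM; rewrite -ltnS ltn_divLR// mulSn [(n * _)%N]mulnC.
  have : (i * n <= M.+1 * n)%N by rewrite leq_mul2r iM orbT.
  lia.
have sum_lt b : (b <= n)%N -> \sum_(a < n) (a < b)%N%:R = b%:R :> R.
  move=> bn; rewrite -natr_sum; congr (_%:R).
  transitivity (\sum_(a < n | (a < b)%N) 1)%N.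
    by rewrite [RHS]big_mkcond; apply: eq_bigr => a _; case: ltnP.
  by rewrite (big_ord_narrow bn) sum_nat_const card_ord muln1.
rewrite -(sum_lt _ (le_n j.+1 (ltn_ord j))) -(sum_lt _ (le_n j (ltnW (ltn_ord j)))).
rewrite -sumrB; apply: eq_bigr => a _; rewrite coord_cellE.
have : ((j * n + M) %/ M.+1 <= (j.+1 * n + M) %/ M.+1)%N.
  by rewrite leq_div2r// leq_add2r leq_mul2r leqnSn orbT.
case: leqP => ab; case: ltnP => ba /=; rewrite ?subr0 ?subrr//; lia.
Qed.

Lemma cvg_coord_cell (j : 'I_M.+1) :
  ((\sum_(a < n) (coord_cell n a == j)%:R) / n%:R : R) @[n --> \oo] --> (M.+1%:R^-1 : R).
Proof.
have ceil_bound (x : nat) : (x%:R / M.+1%:R : R) <= ((x + M) %/ M.+1)%:R <= (x%:R / M.+1%:R + 1 : R).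
  have := divn_eq (x + M) M.+1; have := ltn_pmod (x + M) (ltn0Sn M).
  move: ((x + M) %/ M.+1)%N ((x + M) %% M.+1)%N => q r rM e.
  have M0 : 0 < M.+1%:R :> R by rewrite ltr0n.
  apply/andP; split; first by rewrite ler_pdivrMr// -natrM ler_nat; lia.
  by rewrite -lerBlDr ler_pdivlMr// mulrBl mul1r lerBlDr -natrM -natrD ler_nat; lia.
apply: (@squeeze_cvgr _ _ _ _ (fun n => M.+1%:R^-1 - n%:R^-1) (fun n => M.+1%:R^-1 + n%:R^-1)).
- near=> n; have n0 : 0 < n%:R :> R by rewrite ltr0n; near: n; exact: nbhs_infty_gt.
  rewrite coord_cell_count.
  have /andP[a1 a2] := ceil_bound (j * n)%N; have /andP[b1 b2] := ceil_bound (j.+1 * n)%N.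
  have e : (j.+1 * n)%:R / M.+1%:R = (j * n)%:R / M.+1%:R + n%:R / M.+1%:R :> R.
    by rewrite mulSn natrD mulrDl addrC.
  rewrite e in b1 b2; rewrite ler_pdivlMr// ler_pdivrMr// mulrBl mulrDl mulVf ?gt_eqF//.
  by rewrite [M.+1%:R^-1 * _]mulrC; exact: (increment_bound a1 a2 b1 b2).
- rewrite -[X in _ --> X]subr0; apply: cvgB; first exact: cvg_cst.
  apply/gtr0_cvgV0; last exact: cvgr_idn.
  by near=> n; rewrite ltr0n; near: n; exact: nbhs_infty_gt.
- rewrite -[X in _ --> X]addr0; apply: cvgD; first exact: cvg_cst.
  apply/gtr0_cvgV0; last exact: cvgr_idn.
  by near=> n; rewrite ltr0n; near: n; exact: nbhs_infty_gt.
Unshelve. all: by end_near. Qed.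

Lemma cvg_prod_seq (I : Type) (r : seq I) (F : I -> nat -> R) (v : I -> R) :
  (forall i, F i n @[n --> \oo] --> v i) ->
  \prod_(i <- r) F i n @[n --> \oo] --> \prod_(i <- r) v i.
Proof.
move=> Fv; elim: r => [|i r ih].
  by under eq_fun do rewrite big_nil; rewrite big_nil; exact: cvg_cst.
by under eq_fun do rewrite big_cons; rewrite big_cons; exact: cvgM.
Qed.

Variable l : nat.

Definition site_cell n (f : {ffun 'I_l -> 'I_n}) : {ffun 'I_l -> 'I_M.+1} :=
  [ffun k => coord_cell n (f k)].

Lemma cvg_site_cell (j : {ffun 'I_l -> 'I_M.+1}) :
  (#|[pred f | @site_cell n f == j]|%:R / (n ^ l)%:R : R) @[n --> \oo] --> (M.+1%:R^-1 ^+ l : R).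
Proof.
have -> : (fun n => #|[pred f | @site_cell n f == j]|%:R / (n ^ l)%:R : R) =
    (fun n => \prod_(k < l) ((\sum_(a < n) (coord_cell n a == j k)%:R) / n%:R)).
  apply/funext => n; rewrite big_split/= prodr_const card_ord exprVn natrX; congr (_ / _).
  rewrite bigA_distr_bigA/= -sum1_card natr_sum big_mkcond/=; apply: eq_bigr => f _.
  rewrite inE; case: eqVneq => [/ffunP fj|].
    by rewrite big1// => k _; rewrite -fj ffunE eqxx.
  move=> fj; have /existsP[k nk] : [exists k, coord_cell n (f k) != j k].
    rewrite -negb_forall; apply: contra fj => /forallP fj.
    by apply/eqP/ffunP => k; rewrite ffunE; exact/eqP/fj.
  by rewrite (bigD1 k)//= (negbTE nk) mul0r.
rewrite -[X in M.+1%:R^-1 ^+ X]card_ord -prodr_const.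
by apply: cvg_prod_seq => k; exact: cvg_coord_cell.
Qed.

End cell_counts.

(** * Point measures and grids *)

Section pairing.
Context (R : realType) (d : nat).
Implicit Types (mu : point_measure R d) (s : seq (borel R d)).

Lemma measurable_continuous (f : 'rV[R]_d -> R) : continuous f ->
  measurable_fun setT (f : borel R d -> R).
Proof.
move=> cf; apply: (measurability (@RGenOInfty.G R)).
  exact: RGenOInfty.measurableE.
move=> _ [_ [r ->] <-]; rewrite setTI; apply: sub_sigma_algebra.
by apply: open_comp => //; exact: rray_open.
Qed.

Lemma integral_seq (mu : {measure set (borel R d) -> \bar R}) s :
  (forall A, measurable A -> mu A = \sum_(x <- s) \d_x A)%E ->
  forall f : borel R d -> \bar R, measurable_fun setT f -> (forall x, 0 <= f x)%E ->
  (\int[mu]_x f x = \sum_(x <- s) f x)%E.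
Proof.
move=> mus f mf f0.
pose m := msum (fun i => @dirac _ (borel R d) (nth (0 : 'rV[R]_d) s i) R) (size s).
rewrite (eq_measure_integral m) => [|A mA _]; last first.
  by rewrite mus// /m/= /msum (big_nth (0 : 'rV[R]_d)) big_mkord.
rewrite ge0_integral_measure_sum// [RHS](big_nth (0 : 'rV[R]_d)) big_mkord.
by apply: eq_bigr => i _; rewrite integral_dirac// diracT mul1e.
Qed.

Lemma pairing_seq mu s : (forall A, measurable A -> mu A = \sum_(x <- s) \d_x A)%E ->
  forall f, pairing mu f = \sum_(x <- s) sval f x.
Proof.
move=> mus f; rewrite /pairing /Rintegral.
have mf : measurable_fun setT (sval f : borel R d -> R).
  by apply: measurable_continuous; case: f => /= ? [].
have mEf : measurable_fun setT (EFin \o (sval f : borel R d -> R)) by exact/measurable_EFinP.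
rewrite integralE (integral_seq mus)//; last exact: measurable_funepos.
rewrite (integral_seq mus)//; last exact: measurable_funeneg.
rewrite [X in fine X](_ : _ = (\sum_(x <- s) sval f x)%:E)//.
have posE x : ((EFin \o sval f)^\+ x)%E = (Num.max (sval f x) 0)%:E.
  by rewrite funeposE EFin_max.
have negE x : ((EFin \o sval f)^\- x)%E = (Num.max (- sval f x) 0)%:E.
  by rewrite funenegE EFin_max.
rewrite (eq_bigr _ (fun x _ => posE x)) (eq_bigr _ (fun x _ => negE x)).
rewrite !sumEFin -EFinB -sumrB; congr EFin; apply: eq_bigr => x _.
move: (sval f x) => r; case: (leP r 0) => r0; [rewrite (max_idPl _) ?oppr_ge0//|rewrite (max_idPr _) ?oppr_le0 ?ltW//]; ring.
Qed.

Lemma pairing_seq_point_measure s f :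
  pairing (seq_point_measure s) f = \sum_(x <- s) sval f x.
Proof. by apply: pairing_seq => A _; exact: config_measure_onth. Qed.

(** In an initial topology, points with the same image have the same neighbourhoods, so no
    continuous real function separates them. This replaces equality of point measures throughout. *)
Lemma continuous_pairing_eq (F : point_measure R d -> R) mu mu' :
  continuous F -> pairing mu = pairing mu' -> F mu = F mu'.
Proof.
move=> cF e; apply/eqP; rewrite -subr_eq0 -normr_le0; apply/ler_addgt0Pr => eps eps0.
rewrite add0r.
have : \forall m \near mu, `|F mu - F m| <= eps.
  have := cF mu; move/cvgrPdist_le => /(_ eps eps0); exact.
move=> [_ [[B oB <-] Bmu] sub]; apply: (sub mu').
by rewrite /preimage /= -e.
Qed.

Lemma cvg_bigsum (T I : Type) (E : set_system T) {FE : Filter E} (r : seq I) (Q : pred I)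
    (f : I -> T -> R) (v : I -> R) :
  (forall i, Q i -> f i @ E --> v i) ->
  \sum_(i <- r | Q i) f i x @[x --> E] --> \sum_(i <- r | Q i) v i.
Proof.
move=> fv; elim: r => [|i r ih].
  by under eq_fun do rewrite big_nil; rewrite big_nil; exact: cvg_cst.
under eq_fun do rewrite big_cons; rewrite big_cons; case: ifP => // Qi.
by apply: cvgD => //; exact: fv.
Qed.

(** Row vectors rather than lists of points: at fixed length [t] they carry a product topology, in
    which tuples from the cube form a compact set. *)
Definition points t (v : 'rV['rV[R]_d]_t) : point_measure R d :=
  seq_point_measure [seq v 0 i | i <- enum 'I_t].

Lemma continuous_points t : continuous (@points t).
Proof.
apply: continuous_comp_initial => v.
apply/cvg_sup; first exact/fmap_filter/nbhs_filter.
move=> f; move: v; apply/(@continuousP _ (initial_topology (@^~ f))) => A [B oB <-].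
have [cf _] := proj2_sig f.
have ct : continuous (fun v : 'rV['rV[R]_d]_t => \sum_(i <- enum 'I_t) sval f (v 0 i)).
  move=> v; apply: (@cvg_bigsum _ _ (nbhs v) (nbhs_filter v)) => i _.
  apply: (@continuous_comp _ _ _ (fun v : 'rV['rV[R]_d]_t => v 0 i)); last exact: cf.
  (* Continuity of the i-th projection: the neighbourhood of [v] that restricts only column [i]. *)
  move=> U Uv; exists (fun a b => [set y | b = i -> U y]) => [a b|w]; last exact.
  have [->|bi] := eqVneq b i; first by rewrite (ord1 a); exact: filterS (fun y Uy _ => Uy) Uv.
  by apply: (filterS _ filterT) => y _ /= e; rewrite e eqxx in bi.
rewrite (_ : _ @^-1` _ = (fun v : 'rV['rV[R]_d]_t => \sum_(i <- enum 'I_t) sval f (v 0 i)) @^-1` B).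
  by apply: open_comp oB => v _; exact: ct.
rewrite /preimage; apply/funext => w /=; congr B.
by rewrite pairing_seq_point_measure big_map.
Qed.

Definition unit_cube : set 'rV[R]_d := [set y | forall k, `[0, 1]%classic (y 0 k)].

Lemma compact_unit_cube : compact unit_cube.
Proof. by apply: (@rV_compact R d (fun=> `[0, 1]%classic)) => k; exact: segment_compact. Qed.

(** Heine-Cantor through near coverings. Stating it for all small [e] allows finitely many values of
    [t] to be treated at once. *)
Lemma points_unif_continuous (F : point_measure R d -> R) t (eps : R) :
  continuous F -> 0 < eps ->
  \forall e \near 0^'+, forall v w : 'rV['rV[R]_d]_t,
    (forall i, unit_cube (v 0 i)) -> (forall i, ball (v 0 i) e (w 0 i)) ->
    `|F (points v) - F (points w)| <= eps.
Proof.
move=> cF eps0; pose K := [set v : 'rV['rV[R]_d]_t | forall i, unit_cube (v 0 i)].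
have cK : compact K by apply: (@rV_compact 'rV[R]_d t (fun=> unit_cube)) => i; exact: compact_unit_cube.
have cFp : continuous (F \o @points t).
  by move=> v; apply: continuous_comp; [exact: continuous_points|exact: cF].
pose Q (e : R) (v : 'rV['rV[R]_d]_t) := forall w : 'rV['rV[R]_d]_t,
  (forall i, ball (v 0 i) e (w 0 i)) -> `|F (points v) - F (points w)| <= eps.
have : \forall e \near 0^'+, K `<=` Q e.
  move/compact_near_coveringP : cK; apply => v Kv.
  have eps2 : 0 < eps / 2 by rewrite divr_gt0.
  have := cFp v; move/cvgrPdist_le => /(_ _ eps2) /=.
  move=> /nbhs_ballP[r /= r0 rF].
  have r2 : 0 < r / 2 by rewrite divr_gt0.
  exists (ball v (r / 2), [set e : R | e <= r / 2]).
    by split => /=; [exact: nbhsx_ballx|exact: nbhs_right_le].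
  move=> [v' e] [/= vv' er] w v'w.
  have rr : r = r / 2 + r / 2 by field.
  have h1 : `|F (points v) - F (points v')| <= eps / 2.
    by apply: rF; apply: le_ball vv'; lra.
  have h2 : `|F (points v) - F (points w)| <= eps / 2.
    apply: rF; rewrite rr; apply: ball_triangle vv' _; split => // i j.
    by rewrite (ord1 i); apply: le_ball er _ _; exact: v'w.
  have -> : F (points v') - F (points w) =
    (F (points v) - F (points w)) - (F (points v) - F (points v')) by ring.
  by rewrite (le_trans (ler_normB _ _))// (splitr eps) lerD.
apply: filterS => e KQ v w Kv; exact: KQ.
Qed.

End pairing.

Section finite_config.
Context dT (T : measurableType dT) (R : realType).

(** Each point adds 1 to the total mass. The tails of the convergent series tend to 0, and beyond an
    index where they stay below 1 there are no points left. *)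
Lemma config_finite (c : config T) : (config_measure R c setT < +oo)%E ->
  exists s : seq T, forall A, config_measure R c A = (\sum_(x <- s) \d_x A)%E.
Proof.
pose term A n : \bar R := ((if c n is Some x then \d_x : {measure set T -> \bar R}
  else mzero) : {measure set T -> \bar R}) A.
have term0 A n : (0 <= term A n)%E by exact: measure_ge0.
have cE A : config_measure R c A = (\sum_(n <oo) term A n)%E by [].
rewrite cE => cT.
have := nneseries_tail_cvg cT (fun k _ => term0 setT k).
move=> /fine_cvgP[tfin /cvgrPdist_lt /(_ 1 ltr01) tlt].
have [N _ cN] : \forall N \near \oo, forall n, (N <= n)%N -> c n = None.
  near=> N; move=> n Nn.
  have tailN : (\sum_(N <= k <oo) term setT k)%E \is a fin_num by near: N.
  have tN : `|0 - fine (\sum_(N <= k <oo) term setT k)%E| < 1 by near: N.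
  have tn : (term setT n <= \sum_(N <= k <oo) term setT k)%E.
    rewrite (le_trans _ (nneseries_lim_ge n.+1 _))//.
    by rewrite big_nat_recr//= leeDr// sume_ge0.
  move: tn tN; rewrite sub0r normrN ger0_norm ?fine_ge0 ?nneseries_ge0//.
  rewrite -(fineK tailN) {1}/term; case: (c n) => //= x; rewrite diracT lee_fin.
  by move=> h1 h2; have := le_lt_trans h1 h2; rewrite ltxx.
exists (pmap c (iota 0 N)) => A.
rewrite cE (nneseries_split 0 N)// eseries0 ?adde0; last first.
  by move=> i Ni _; rewrite /term (cN N (leqnn N))// -(add0n N).
rewrite add0n /index_iota subn0; elim: (iota 0 N) => [|i r ih]; first by rewrite !big_nil.
rewrite big_cons ih {1}/term /=; case: (c i) => /= [x|]; last by rewrite add0e.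
by rewrite big_cons.
Unshelve. all: by end_near. Qed.

Lemma sum_dirac (s : seq T) A :
  (\sum_(x <- s) \d_x A = (count (fun x => x \in A) s)%:R%:E :> \bar R)%E.
Proof.
rewrite -sum1_count natr_sum -sumEFin [RHS]big_mkcond.
by apply: eq_bigr => x _; rewrite diracE; case: ifPn.
Qed.

End finite_config.

Lemma point_measure_finite (R : realType) d (mu : point_measure R d) :
  (mu setT < +oo)%E -> exists s : seq (borel R d),
  forall A, measurable A -> (mu A = \sum_(x <- s) \d_x A)%E.
Proof.
have [c cE] := point_measure_config mu; rewrite cE//.
by move=> /config_finite[s sE]; exists s => A mA; rewrite cE.
Qed.

Section slabs.
Context (R : realType) (d l : nat) (l_le : (l <= d)%N).

Definition slab (I : 'I_l -> set R) : set (borel R d) :=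
  [set y | (forall k, I k (y 0 (widen_ord l_le k))) /\
           (forall k : 'I_d, (l <= k)%N -> y 0 k = 0)].

Lemma measurable_coord (k : 'I_d) (A : set R) : measurable A ->
  measurable ([set y | A (y 0 k)] : set (borel R d)).
Proof.
move=> mA; rewrite -[X in measurable X]setTI.
exact: (measurable_continuous (@coord_continuous _ _ _ 0 k)).
Qed.

Lemma measurable_slab (I : 'I_l -> set R) : (forall k, measurable (I k)) ->
  measurable (slab I).
Proof.
move=> mI; have -> : slab I =
    (\bigcap_(k in [set: 'I_l]) [set y | I k (y 0 (widen_ord l_le k))]) `&`
    (\bigcap_(k in [set k : 'I_d | (l <= k)%N]) [set y | [set 0] (y 0 k)]).
  by apply/seteqP; split => y [yI y0]; split => k; [move=> _; exact: yI|exact: y0|exact: yI|exact: y0].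
apply: measurableI.
  apply: fin_bigcap_measurable; first exact: finite_finset.
  by move=> k _; exact: measurable_coord.
apply: fin_bigcap_measurable; first exact: finite_finset.
by move=> k _; apply: measurable_coord; exact: measurable_set1.
Qed.

(** Half-open so that the cells partition it exactly; rescaled sites lie in it, as their coordinates
    are at most (N - 1) / N. *)
Definition half_open_cube : set (borel R d) := slab (fun=> [set` `[0%R, 1%R[]).

Section cells.
Variable M : nat.
Local Notation J := {ffun 'I_l -> 'I_M.+1}.

Definition cell_side (j : J) k : set R :=
  [set` `[(j k)%:R / M.+1%:R, (j k).+1%:R / M.+1%:R[].

Definition cell (j : J) : set (borel R d) := slab (cell_side j).

Definition corner (j : J) : borel R d :=
  \row_(i < d) if insub (i : nat) is Some k then (j k)%:R / M.+1%:R else 0.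

Definition cell_of (y : borel R d) : J :=
  [ffun k => inord (Num.truncn (M.+1%:R * y 0 (widen_ord l_le k)))].

Lemma cell_ofP y : half_open_cube y -> cell (cell_of y) y.
Proof.
move=> [y01 y0]; split => // k; rewrite /cell_side /= ffunE in_itv/=.
have := y01 k; rewrite /= in_itv/= => /andP[yk0 yk1].
rewrite inordK.
  rewrite ler_pdivrMr ?ltr0n// ltr_pdivlMr ?ltr0n// mulrC; apply: truncn_itv.
  by rewrite mulr_ge0.
by rewrite truncn_lt_nat ?mulr_ge0// -[ltRHS]mulr1 ltr_pM2l ?ltr0n.
Qed.

Lemma cell_ofE j y : cell j y -> cell_of y = j.
Proof.
move=> [yj _]; apply/ffunP => k; rewrite ffunE.
have := yj k; rewrite /cell_side /= in_itv/= => jk.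
rewrite (@truncn_def _ _ (j k)) ?inord_val//.
by move: jk; rewrite ler_pdivrMr ?ltr0n// ltr_pdivlMr ?ltr0n// mulrC.
Qed.

Lemma cell_sub j : cell j `<=` half_open_cube.
Proof.
move=> y [yj y0]; split => // k; have := yj k; rewrite /cell_side /= !in_itv/=.
move=> /andP[a b]; rewrite (le_trans _ a) ?divr_ge0//= (lt_le_trans b)//.
by rewrite ler_pdivrMr ?ltr0n// mul1r ler_nat ltn_ord.
Qed.

Lemma measurable_cell j : measurable (cell j).
Proof. by apply: measurable_slab => k; exact: measurable_itv. Qed.

Lemma corner_ball j y e : M.+1%:R^-1 < e -> cell j y -> ball (y : 'rV[R]_d) e (corner j).
Proof.
move=> Me [yj y0]; split => [|i k]; first by rewrite (lt_trans _ Me)// invr_gt0.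
rewrite (ord1 i) mxE /ball/= /ball_.
case: insubP => [k' _ k'k|].
  have -> : k = widen_ord l_le k' by apply: val_inj.
  have := yj k'; rewrite /cell_side /= in_itv/= => /andP[a b].
  rewrite ger0_norm ?subr_ge0// (le_lt_trans _ Me)// lerBlDl.
  by rewrite (le_trans (ltW b))// -natr1 mulrDl mul1r.
by rewrite -leqNgt => lk; rewrite y0// subr0 normr0 (le_lt_trans _ Me)// invr_ge0.
Qed.

Definition corner_measure (m : J -> nat) : point_measure R d :=
  seq_point_measure (flatten [seq nseq (m j) (corner j) | j <- enum J]).

Lemma measurable_half_open_cube : measurable half_open_cube.
Proof. by apply: measurable_slab => k; exact: measurable_itv. Qed.

Lemma half_open_cube_bigcup : half_open_cube = \bigcup_(j in [set: J]) cell j.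
Proof.
apply/seteqP; split => y; first by exists (cell_of y) => //; exact: cell_ofP.
by move=> [j _]; exact: cell_sub.
Qed.

Lemma half_open_cube_sum (mu : {measure set (borel R d) -> \bar R}) :
  mu half_open_cube = (\sum_(j : J) mu (cell j))%E.
Proof.
rewrite half_open_cube_bigcup (measure_fin_bigcup mu finite_finset)//.
- rewrite (_ : [set: J] = [set` enum J]).
    by rewrite -fsbig_seq ?enum_uniq// big_enum.
  by apply/seteqP; split => j /=; rewrite mem_enum.
- by apply/trivIsetP => i j _ _ /eqP ij; rewrite -subset0 => y [/cell_ofE yi /cell_ofE yj];
    apply: ij; rewrite -yi -yj.
- by move=> j _; exact: measurable_cell.
Qed.

End cells.

Lemma unit_cube_half_open y : half_open_cube y -> unit_cube y.
Proof.
move=> [y01 y0] k; have [lk|kl] := leqP l k; first by rewrite /= y0// in_itv/= lexx ler01.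
have := y01 (Ordinal kl); rewrite /= !in_itv/=.
by rewrite (_ : widen_ord _ _ = k) => [/andP[-> /ltW]|]; last exact: val_inj.
Qed.

Lemma sum_fibers (M : nat) (s : seq (borel R d)) (f : borel R d -> R)
  (g : {ffun 'I_l -> 'I_M.+1} -> nat) :
  (forall j, g j = count (fun y => cell_of M y == j) s) ->
  \sum_(y <- s) f (corner (cell_of M y)) =
  \sum_(y <- flatten [seq nseq (g j) (corner j) | j <- enum {ffun 'I_l -> 'I_M.+1}]) f y.
Proof.
move=> gE; rewrite big_flatten big_map [RHS]big_enum/=.
rewrite (partition_big (cell_of M) xpredT)//=; apply: eq_bigr => j _.
rewrite gE; elim: s {gE} => [|y s ih]; first by rewrite !big_nil.
rewrite big_cons /=; case: eqVneq => [e|_] /=; last exact: ih.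
by rewrite add0n big_cons -ih e.
Qed.

(** A measure with [t] atoms in the cube and its corner version have the same pairings as [points v]
    and [points w], where each w_i is the corner of the cell of v_i and hence within [e] of it. *)
Lemma points_corner_approx (F : point_measure R d -> R) (t M : nat) (e eps : R)
    (m : {ffun 'I_l -> 'I_M.+1} -> nat) (mu : point_measure R d) :
  continuous F ->
  (forall v w : 'rV['rV[R]_d]_t,
    (forall i, unit_cube (v 0 i)) -> (forall i, ball (v 0 i) e (w 0 i)) ->
    `|F (points v) - F (points w)| <= eps) ->
  M.+1%:R^-1 < e -> mu (~` half_open_cube) = 0 ->
  (forall j, mu (cell j) = (m j)%:R%:E) -> (\sum_j m j)%N = t ->
  `|F mu - F (corner_measure m)| <= eps.
Proof.
move=> cF Fe Me mu0 muj tE.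
have mC := measurable_half_open_cube.
have muT : mu setT = t%:R%:E.
  have -> : mu setT = (mu half_open_cube + mu (~` half_open_cube))%E.
    by rewrite -measureU ?setUv ?setICr//; exact: measurableC.
  by rewrite mu0 adde0 (half_open_cube_sum M) (eq_bigr _ (fun j _ => muj j)) sumEFin -natr_sum tE.
have [|s musE] := @point_measure_finite _ _ mu; first by rewrite muT ltry.
have muN A : measurable A -> mu A = (count (fun x => x \in A) s)%:R%:E.
  by move=> mA; rewrite musE// sum_dirac.
have sC x : x \in s -> half_open_cube x.
  move=> xs; apply: contrapT => xC; have := muN _ (measurableC mC).
  rewrite mu0 => -[/esym/eqP]; rewrite pnatr_eq0 => /eqP c0.
  have : has (fun x => x \in ~` half_open_cube) s by apply/hasP; exists x => //; rewrite inE.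
  by rewrite has_count c0.
have st : size s = t.
  have := muN _ measurableT; rewrite muT => -[/eqP]; rewrite eqr_nat => /eqP ->.
  by rewrite -[LHS]count_predT; apply: eq_count => x; rewrite in_setT.
have mE j : m j = count (fun y => cell_of M y == j) s.
  have := muN _ (measurable_cell j); rewrite muj => -[/eqP]; rewrite eqr_nat => /eqP ->.
  apply: eq_in_count => x xs; apply/idP/eqP; rewrite inE; first exact: cell_ofE.
  by move=> <-; exact/cell_ofP/sC.
pose v : 'rV['rV[R]_d]_t := \row_i (nth (0 : 'rV[R]_d) s i).
pose w : 'rV['rV[R]_d]_t := \row_i (corner (cell_of M (nth (0 : 'rV[R]_d) s i))).
have sum_s (f : 'rV[R]_d -> R) : \sum_(i <- enum 'I_t) f (nth (0 : 'rV[R]_d) s i) = \sum_(x <- s) f x.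
  by rewrite big_enum [RHS](big_nth (0 : 'rV[R]_d)) big_mkord st.
have vE : F mu = F (points v).
  apply: continuous_pairing_eq => //; apply/funext => f.
  rewrite pairing_seq_point_measure (pairing_seq musE) big_map -sum_s.
  by apply: eq_bigr => i _; rewrite mxE.
have wE : F (corner_measure m) = F (points w).
  apply: continuous_pairing_eq => //; apply/funext => f.
  rewrite !pairing_seq_point_measure big_map -(sum_fibers _ mE).
  rewrite -(sum_s (fun y => sval f (corner (cell_of M y)))).
  by apply: eq_bigr => i _; rewrite mxE.
have si (i : 'I_t) : nth (0 : 'rV[R]_d) s i \in s by rewrite mem_nth// st.
rewrite vE wE; apply: Fe => i; rewrite !mxE; first exact/unit_cube_half_open/sC.
by apply: corner_ball => //; exact/cell_ofP/sC.
Qed.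

End slabs.

(** * Lebesgue measure of the cube and of its cells *)

Section lebesgue_slabs.
Context (R : realType).
Local Notation leb := (@lebesgue_measure R).

Lemma lebesgue_tuple0 l : @lebesgue_tuple R l set0 = 0%E.
Proof.
elim: l => [|l ih] /=; first by rewrite measure0.
rewrite /pushforward /product_measure1 preimage_set0.
by apply: integral0_eq => x _ /=; rewrite xsection0.
Qed.

Lemma lebesgue_tuple_prod l (I : 'I_l -> set R) (v : 'I_l -> R) :
  (forall k, measurable (I k)) -> (forall k, leb (I k) = (v k)%:E) ->
  @lebesgue_tuple R l [set t | forall k, I k (tnth t k)] = (\prod_k v k)%:E.
Proof.
elim: l I v => [|l ih] I v mI Iv.
  rewrite big_ord0 /= diracE mem_set//= => -[]//.
rewrite /= /pushforward /product_measure1.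
pose B : set (l.-tuple (measurableTypeR R)) := [set t | forall k, I (lift ord0 k) (tnth t k)].
have BE : lebesgue_tuple B = (\prod_k v (lift ord0 k))%:E by apply: (ih (fun k => I (lift ord0 k)) (fun k => v (lift ord0 k))) => k; [exact: mI|exact: Iv].
have v0 k : 0 <= v k by rewrite -lee_fin -Iv measure_ge0.
transitivity (\int[leb]_x ((\prod_k v (lift ord0 k)) * \1_(I ord0) x)%:E)%E.
  apply: eq_integral => x _ /=; rewrite indicE.
  case: (boolP (x \in I ord0)) => xI.
    rewrite mulr1 -BE; congr lebesgue_tuple; apply/seteqP; split => t.
      by rewrite /xsection /= inE => tI k; have := tI (lift ord0 k); rewrite tnthS.
    move=> tB; rewrite /xsection /= inE => k; case: (unliftP ord0 k) => [j|] ->.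
      by rewrite tnthS; exact: tB.
    by rewrite tnth0; exact: set_mem.
  transitivity (lebesgue_tuple (set0 : set (l.-tuple (measurableTypeR R)))); last first.
    by rewrite lebesgue_tuple0 mulr0.
  congr lebesgue_tuple; apply/seteqP; split => // t.
  rewrite /xsection /= inE => /(_ ord0); rewrite tnth0 => xI'.
  by rewrite mem_set in xI.
rewrite (@integralZl_indic _ (measurableTypeR R) R lebesgue_measure setT measurableT (fun=> I ord0));
  [|by rewrite ltNge prodr_ge0|exact: mI].
rewrite integral_indic ?setIT//; last exact: mI.
by rewrite [X in (_ * X)%E]Iv -EFinM big_ord_recl mulrC.
Qed.

Context (d l : nat) (l_le : (l <= d)%N).

Lemma lebesgue_cube_slab (I : 'I_l -> set R) (v : 'I_l -> R) :
  (forall k, measurable (I k)) -> (forall k, leb (I k) = (v k)%:E) ->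
  (forall k, I k `<=` `[0%R, 1%R]%classic) ->
  lebesgue_cube l (slab l_le I) = (\prod_k v k)%:E.
Proof.
move=> mI Iv I01; rewrite -(lebesgue_tuple_prod mI Iv) /lebesgue_cube.
congr lebesgue_tuple; apply/seteqP; split => t /=.
  by move=> [_ [tI _]] k; have := tI k; rewrite mxE/= (tnth_nth 0).
move=> tI; split => [k|]; first by have /I01 := tI k; rewrite /= in_itv.
split => k; first by rewrite mxE -tnth_nth.
by move=> lk; rewrite mxE nth_default// size_tuple.
Qed.

Lemma lebesgue_cube_half_open : lebesgue_cube l (@half_open_cube R d l l_le) = 1%:E.
Proof.
rewrite /half_open_cube (@lebesgue_cube_slab _ (fun=> 1))//.
- by rewrite big1.
- by move=> k; rewrite lebesgue_measure_itv/= lte_fin ltr01 sube0.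
- by move=> k x /=; rewrite !in_itv/= => /andP[-> /ltW].
Qed.

Lemma lebesgue_cube_cell M (j : {ffun 'I_l -> 'I_M.+1}) :
  lebesgue_cube l (@cell R d l l_le M j) = (M.+1%:R^-1 ^+ l)%:E.
Proof.
rewrite /cell (@lebesgue_cube_slab _ (fun=> M.+1%:R^-1))//.
- by rewrite prodr_const card_ord.
- by move=> k; exact: measurable_itv.
- move=> k; rewrite lebesgue_measure_itv/= lte_fin ltr_pM2r ?invr_gt0 ?ltr0n// ltr_nat ltnSn.
  by rewrite -EFinB -mulrBl -natr1 addrAC subrr add0r mul1r.
- move=> k x; rewrite /cell_side /= !in_itv/= => /andP[a b]; rewrite (le_trans _ a) ?divr_ge0//=.
  by rewrite (le_trans (ltW b))// ler_pdivrMr ?ltr0n// mul1r ler_nat ltn_ord.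
Qed.

Lemma lebesgue_cubeT : @lebesgue_cube R d l setT = 1%:E.
Proof.
have -> : @lebesgue_cube R d l setT =
    @lebesgue_tuple R l [set t | forall k, `[0%R, 1%R]%classic (tnth t k)].
  rewrite /lebesgue_cube; congr lebesgue_tuple; apply/seteqP; split => t /=.
    by move=> [h _] k; rewrite in_itv /= h.
  by move=> h; split => // k; have := h k; rewrite in_itv.
rewrite (@lebesgue_tuple_prod _ (fun=> `[0%R, 1%R]%classic) (fun=> 1)).
- by rewrite big1.
- by move=> k; exact: measurable_itv.
- by move=> k; rewrite lebesgue_measure_itv/= lte_fin ltr01 sube0.
Qed.

End lebesgue_slabs.

(** * Convergence of expectations *)

Section expectation_approx.
Context dO (Omega : measurableType dO) (R : realType) (P : probability Omega R).
Local Notation pr := (pr P).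

(* The integrands are not assumed measurable. *)
Lemma ge0_le_integral_nonmeasurable (f g : Omega -> \bar R) :
  (forall s, 0 <= f s)%E -> (forall s, f s <= g s)%E ->
  (\int[P]_s f s <= \int[P]_s g s)%E.
Proof.
move=> f0 fg; have g0 s : (0 <= g s)%E by exact: le_trans (fg s).
rewrite !ge0_integralTE//; apply: le_ereal_sup => _ [h hf <-].
by exists h => // s; exact: le_trans (fg s).
Qed.

Lemma integral_step (I : finType) (E : I -> set Omega) (c : I -> R) :
  (forall i, measurable (E i)) -> (forall i, 0 <= c i) ->
  (\int[P]_s (\sum_i c i * \1_(E i) s)%R%:E = (\sum_i c i * pr (E i))%R%:E)%E.
Proof.
move=> mE c0; under eq_integral => s _ do rewrite -sumEFin.
have m1 i : measurable_fun setT (fun s => (c i * \1_(E i) s)%:E).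
  by apply/measurable_EFinP; apply: measurable_funM => //; exact: measurable_indic.
rewrite ge0_integral_sum//; last by move=> i s _; rewrite lee_fin mulr_ge0.
rewrite -sumEFin; apply: eq_bigr => i _.
rewrite (integralZl_indic _ (fun=> E i))//; last by rewrite ltNge c0.
by rewrite integral_indic// setIT EFinM -prE.
Qed.

Lemma sum_option (I : finType) (h : option I -> R) :
  \sum_o h o = h None + \sum_i h (Some i).
Proof.
rewrite (bigD1 None)//= (reindex_omap Some id) => [|[]//].
by congr (_ + _); apply: eq_bigl => i; rewrite /= eqxx.
Qed.

(** [f] lies between the step functions with values [lo] and [up], so monotonicity alone controls
    its integral. Where no [E i] occurs the bounds are 0 and [B]. *)
Lemma ge0_expectation_approx (I : finType) (E : I -> set Omega) (a : I -> R)
    (f : Omega -> R) (eps B : R) :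
  (forall i, measurable (E i)) -> (forall i j, i != j -> E i `&` E j = set0) ->
  0 <= eps -> (forall i, 0 <= a i) -> (forall s, 0 <= f s <= B) ->
  (forall i s, E i s -> `|f s - a i| <= eps) ->
  exists2 r, (\int[P]_s (f s)%:E = r%:E)%E &
    `|r - \sum_i a i * pr (E i)| <= eps + B * (1 - \sum_i pr (E i)).
Proof.
move=> mE dE eps0 a0 fB fa.
pose U := \bigcup_(i in [set i : I | true]) E i.
have mU : measurable U by apply: fin_bigcup_measurable => //; exact: finite_finset.
have prU : pr U = \sum_i pr (E i) by exact: pr_sum.
have p1 : \sum_i pr (E i) <= 1 by rewrite -prU pr_le1.
(* [None] labels the complement, so that the events [E' o] partition the space. *)
pose E' o := if o is Some i then E i else ~` U.
have mE' o : measurable (E' o) by case: o => [i|] /=; [exact: mE|exact: measurableC].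
have prC : pr (~` U) = 1 - \sum_i pr (E i) by rewrite -setTD pr_setD// pr_setT prU.
have B0 : 0 <= B by have /andP[h1 h2] := fB point; exact: le_trans h2.
pose up o := if o is Some i then a i + eps else B.
pose lo o := if o is Some i then Num.max (a i - eps) 0 else 0.
have up0 o : 0 <= up o by case: o => //= i; rewrite addr_ge0.
have lo0 o : 0 <= lo o by case: o => //= i; rewrite le_max lexx orbT.
have sumE' (c : option I -> R) s o : E' o s -> \sum_o c o * \1_(E' o) s = c o.
  move=> os; rewrite (bigD1 o)//= indicE mem_set// mulr1 big1 ?addr0// => o' o'o.
  rewrite indicE memNset ?mulr0// => o's; move: o'o os o's; case: o => [i|]; case: o' => [j|]//=.
  - by move=> ji si sj; have : (E j `&` E i) s by []; rewrite dE// => [[]].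
  - by move=> _ si; apply; exists i.
  - by move=> _ nU sj; apply: nU; exists j.
have cov s : exists o, E' o s.
  have [[i _ si]|nU] := pselect (U s); [by exists (Some i)|by exists None].
have le_up : (\int[P]_s (f s)%:E <= (\sum_o up o * pr (E' o))%:E)%E.
  rewrite -integral_step//; apply: ge0_le_integral_nonmeasurable => s; rewrite lee_fin.
    by have /andP[] := fB s.
  case: (cov s) => o os; rewrite (sumE' _ _ o)//; case: o os => [i|] /= os.
    by have := fa i s os; rewrite ler_norml lerBlDl => /andP[].
  by have /andP[] := fB s.
have le_lo : ((\sum_o lo o * pr (E' o))%:E <= \int[P]_s (f s)%:E)%E.
  rewrite -integral_step//; apply: ge0_le_integral_nonmeasurable => s; rewrite lee_fin.
    by rewrite sumr_ge0// => o _; rewrite mulr_ge0.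
  have /andP[fs0 _] := fB s.
  case: (cov s) => o os; rewrite (sumE' _ _ o)//; case: o os => [i|] //= os.
  rewrite ge_max fs0 andbT; have := fa i s os; rewrite ler_norml => /andP[+ _].
  by rewrite lerBrDr addrC.
have fin : (\int[P]_s (f s)%:E)%E \is a fin_num.
  rewrite ge0_fin_numE; first by rewrite (le_lt_trans le_up)// ltry.
  by apply: integral_ge0 => s _; rewrite lee_fin; have /andP[] := fB s.
exists (fine (\int[P]_s (f s)%:E)%E); first by rewrite fineK.
move: le_up le_lo; rewrite -(fineK fin) !lee_fin.
move: (fine _) => r; rewrite !sum_option /= prC mul0r add0r.
under eq_bigr do rewrite mulrDl; rewrite big_split/= -mulr_sumr.
have : \sum_i a i * pr (E i) - eps * (\sum_i pr (E i)) <= \sum_i Num.max (a i - eps) 0 * pr (E i).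
  rewrite mulr_sumr -sumrB; apply: ler_sum => i _; rewrite -mulrBl.
  by rewrite ler_wpM2r ?pr_ge0// le_max lexx.
have epsp : eps * (\sum_i pr (E i)) <= eps by rewrite ler_piMr.
have Bp : 0 <= B * (1 - \sum_i pr (E i)) by rewrite mulr_ge0// subr_ge0.
move: epsp Bp; set x := eps * _; set y := B * _; set u := \sum_i a i * _.
set t := \sum_i _ => h1 h2 h3 h4 h5; rewrite ler_norml; apply/andP; split; lra.
Qed.

Lemma max0_lipschitz (x y : R) : `|Num.max x 0 - Num.max y 0| <= `|x - y|.
Proof.
have aux (t : R) : x - y <= t -> y - x <= t -> 0 <= t ->
    `|Num.max x 0 - Num.max y 0| <= t.
  move=> h1 h2 t0; rewrite ler_norml.
  by case: (leP x 0) => ?; case: (leP y 0) => ?; apply/andP; split; lra.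
by apply: aux; [exact: ler_norm|rewrite distrC ler_norm|].
Qed.

(** The integral is by definition a difference of those of the positive and negative parts. Taking
    the positive part is 1-Lipschitz, so both parts satisfy the nonnegative case; the two errors
    give the factor 2. *)
Lemma expectation_approx (I : finType) (E : I -> set Omega) (a : I -> R)
    (f : Omega -> R) (eps B : R) :
  (forall i, measurable (E i)) -> (forall i j, i != j -> E i `&` E j = set0) ->
  0 <= eps -> (forall s, `|f s| <= B) ->
  (forall i s, E i s -> `|f s - a i| <= eps) ->
  exists2 r, ('E_P[f])%E = r%:E &
    `|r - \sum_i a i * pr (E i)| <= 2 * (eps + B * (1 - \sum_i pr (E i))).
Proof.
move=> mE dE eps0 fB fa.
have max_bound (x : R) : `|x| <= B -> 0 <= Num.max x 0 <= B.
  move=> xB; have := ler_norm x; have := normr_ge0 x.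
  by move=> h1 h2; rewrite le_max lexx orbT /= ge_max; apply/andP; split; lra.
have [|i|s|i s si|rp fp hp] := @ge0_expectation_approx I E (fun i => Num.max (a i) 0)
  (fun s => Num.max (f s) 0) eps B mE dE => //.
- by rewrite le_max lexx orbT.
- exact: max_bound.
- exact: le_trans (max0_lipschitz _ _) (fa _ _ si).
have [|i|s|i s si|rn fn hn] := @ge0_expectation_approx I E (fun i => Num.max (- a i) 0)
  (fun s => Num.max (- f s) 0) eps B mE dE => //.
- by rewrite le_max lexx orbT.
- by apply: max_bound; rewrite normrN.
- by rewrite (le_trans (max0_lipschitz _ _))// -opprD normrN fa.
exists (rp - rn).
  rewrite unlock integralE EFinB -fp -fn; congr (_ - _)%E; apply: eq_integral => s _.
    by rewrite funeposE EFin_max.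
  by rewrite funenegE EFin_max.
have -> : \sum_i a i * pr (E i) = \sum_i Num.max (a i) 0 * pr (E i) -
    \sum_i Num.max (- a i) 0 * pr (E i).
  rewrite -sumrB; apply: eq_bigr => i _; rewrite -mulrBl; congr (_ * _).
  move: (a i) => r; case: (leP r 0) => r0.
    by rewrite (max_idPl _) ?oppr_ge0//; ring.
  by rewrite (max_idPr _) ?oppr_le0 ?ltW//; ring.
have -> (u v w x : R) : u - v - (w - x) = (u - w) - (v - x) by ring.
by rewrite (le_trans (ler_normB _ _))// [2 * _]mulr_natl mulr2n lerD.
Qed.

End expectation_approx.

(** * Expectations in terms of the laws of the cell counts *)

Section occupancy.
Context (R : realType) (d l : nat) (l_le : (l <= d)%N).
Local Notation C := (@half_open_cube R d l l_le).

Section law_approx.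
Context dO (Omega : measurableType dO) (P : probability Omega R).
Variable X : Omega -> point_measure R d.
Local Notation pr := (pr P).
Variable M : nat.
Local Notation J := {ffun 'I_l -> 'I_M.+1}.

Definition occupancy (m : J -> nat) : set Omega :=
  [set s | X s (~` C) = 0 /\ forall j, X s (cell l_le j) = (m j)%:R%:E].

Lemma occupancy_disjoint (m m' : J -> nat) s :
  occupancy m s -> occupancy m' s -> m =1 m'.
Proof.
move=> [_ ms] [_ ms'] j; have := ms j; rewrite ms' => -[/eqP].
by rewrite eqr_nat => /eqP.
Qed.

Lemma occupancy_approx (F : point_measure R d -> R) (K : nat) (e eps B : R) :
  (forall m, measurable (occupancy m)) -> continuous F -> (forall mu, `|F mu| <= B) ->
  0 <= eps -> M.+1%:R^-1 < e ->
  (forall (t : 'I_K.+1) (v w : 'rV['rV[R]_d]_t),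
    (forall i, unit_cube (v 0 i)) -> (forall i, ball (v 0 i) e (w 0 i)) ->
    `|F (points v) - F (points w)| <= eps) ->
  exists2 r, ('E_P[F \o X])%E = r%:E &
  `|r - \sum_(m : {ffun J -> 'I_K.+1} | (\sum_j m j <= K)%N)
       F (@corner_measure R d l M (fun j => nat_of_ord (m j))) * pr (occupancy (fun j => nat_of_ord (m j)))| <=
  2 * (eps + B * (1 - \sum_(m : {ffun J -> 'I_K.+1} | (\sum_j m j <= K)%N) pr (occupancy (fun j => nat_of_ord (m j))))).
Proof.
move=> mX cF FB eps0 Me Fe.
(* Count vectors with total above [K] get the empty event, since uniform continuity is available for
   at most [K] points only. *)
pose E (m : {ffun J -> 'I_K.+1}) := if (\sum_j m j <= K)%N then occupancy (fun j => nat_of_ord (m j)) else set0.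
have [|m m' mm'||s|m s|r rE rle] := @expectation_approx _ _ _ P _ E
    (fun m => F (@corner_measure R d l M (fun j => nat_of_ord (m j)))) (F \o X) eps B.
- by move=> m; rewrite /E; case: ifP.
- rewrite /E; case: ifP => _; last by rewrite set0I.
  case: ifP => _; last by rewrite setI0.
  apply/seteqP; split => // s [ms ms']; move/eqP: mm'; apply.
  by apply/ffunP => j; apply: val_inj; exact: (occupancy_disjoint ms ms').
- exact: eps0.
- exact: FB.
- rewrite /E; case: ifP => // mK [s0 sm] /=.
  have tK : (\sum_j m j < K.+1)%N by rewrite ltnS.
  exact: (points_corner_approx cF (Fe (Ordinal tK)) Me s0 sm).
exists r => //; rewrite [X in _ - X]big_mkcond [X in 1 - X]big_mkcond/=.
have sumE (g : {ffun J -> 'I_K.+1} -> R) : \sum_m g m * pr (E m) =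
    \sum_(m : {ffun J -> 'I_K.+1}) (if (\sum_j m j <= K)%N then g m * pr (occupancy (fun j => nat_of_ord (m j))) else 0).
  by apply: eq_bigr => m _; rewrite /E; case: ifP => // _; rewrite pr_set0 mulr0.
have sumE1 : \sum_m pr (E m) = \sum_(m : {ffun J -> 'I_K.+1})
    (if (\sum_j m j <= K)%N then pr (occupancy (fun j => nat_of_ord (m j))) else 0).
  by apply: eq_bigr => m _; rewrite /E; case: ifP => // _; rewrite pr_set0.
by rewrite -sumE -sumE1.
Qed.

End law_approx.

Section poisson_limit.
Context dO (Omega : measurableType dO) (P : probability Omega R).
Variables (X : Omega -> point_measure R d) (z : R).
Hypothesis XP : poisson_process P (fun s => X s)
  (fun A => ((expR (- z))%:E * lebesgue_cube l A)%E).
Local Notation pr := (pr P).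
Local Notation lam := (expR (- z)).

Let mX B : measurable B -> measurable_fun setT (fun s => X s B).
Proof. by case: XP => h _ _ _; exact: h. Qed.

Lemma measurable_poisson_eq B (x : \bar R) : measurable B -> measurable [set s | X s B = x].
Proof.
move=> mB; rewrite -[X in measurable X]setTI.
exact: (mX mB measurableT (emeasurable_set1 x)).
Qed.

Lemma poisson_eq_prob B (b : R) k : measurable B -> lebesgue_cube l B = b%:E ->
  pr [set s | X s B = k%:R%:E] = expR (- (lam * b)) * (lam * b) ^+ k / k`!%:R.
Proof.
move=> mB bE; case: XP => _ h _ _; rewrite /pr h//; first by rewrite bE /=.
by rewrite bE -EFinM ltry.
Qed.

(* P(X(T) = 0) = P(X(C) = 0) P(X(~C) = 0) by independence, and the first two
   probabilities are both e^-lam. *)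
Lemma poisson_off_cube : pr [set s | X s (~` C) = 0] = 1.
Proof.
have mC := @measurable_half_open_cube R d l l_le.
have mCc : measurable (~` C) by exact: measurableC.
case: XP => _ _ _ indep.
pose B (i : 'I_2) : set (borel R d) := if i == ord0 then C else ~` C.
have mB i : measurable (B i) by rewrite /B; case: ifP.
have tB : trivIset setT B.
  apply/trivIsetP => i j _ _; rewrite /B; case: (i =P ord0) => [->|i0]; case: (j =P ord0) => [->|j0]//.
  - by rewrite setICr.
  - by rewrite setICl.
  - move=> /eqP ij; exfalso; apply: ij; apply: val_inj; move: (ltn_ord i) (ltn_ord j).
    by move: i0 j0 => /eqP + /eqP; rewrite -!val_eqE /=; lia.
have := indep 2%N B mB tB (fun=> [set 0%E]) (fun i => emeasurable_set1 _).
have -> : [set s | forall i : 'I_2, [set 0%E] (X s (B i))] = [set s | X s setT = 0%:R%:E].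
  have XT s : X s setT = (X s C + X s (~` C))%E.
    by rewrite -measureU ?setUv ?setICr.
  apply/seteqP; split => s /=.
    by move=> h; have := h ord0; have := h (lift ord0 ord0); rewrite XT /B /= => -> ->; rewrite adde0.
  rewrite XT => /eqP; rewrite padde_eq0// => /andP[/eqP h1 /eqP h2] i.
  by rewrite /B; case: ifP.
rewrite big_ord_recl big_ord1 /B /=.
have pT : pr [set s | X s setT = 0%:R%:E] = expR (- lam).
  by rewrite (poisson_eq_prob _ _ (@lebesgue_cubeT R d l))// mulr1 expr0 fact0 divr1 mulr1.
have pC : pr [set s | X s C = 0%:R%:E] = expR (- lam).
  by rewrite (poisson_eq_prob _ _ (@lebesgue_cube_half_open R d l l_le))// mulr1 expr0 fact0 divr1 mulr1.
rewrite !prE; last 3 first.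
- exact: measurable_poisson_eq.
- exact: (measurable_poisson_eq 0%E).
- exact: (measurable_poisson_eq 0%E).
rewrite pT pC -EFinM => -[/esym/eqP]; rewrite -subr_eq0 -{2}[expR (- lam)]mulr1 -mulrBr mulf_eq0.
by rewrite gt_eqF ?expR_gt0//= subr_eq0 => /eqP.
Qed.

Section cells.
Variable M : nat.
Local Notation J := {ffun 'I_l -> 'I_M.+1}.
Local Notation occ := (@occupancy _ _ X M).

Let mcell (j : J) : measurable (cell l_le j) := @measurable_cell R d l l_le M j.

Let mCc : measurable (~` C).
Proof. by apply: measurableC; exact: measurable_half_open_cube. Qed.

Let mcells (m : J -> nat) : measurable [set s | forall j, X s (cell l_le j) = (m j)%:R%:E].
Proof.
rewrite (_ : [set s | _] = \bigcap_(j in [set: J]) [set s | X s (cell l_le j) = (m j)%:R%:E]).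
  apply: fin_bigcap_measurable; first exact: finite_finset.
  by move=> j _; exact: measurable_poisson_eq.
by apply/seteqP; split => s h j; [move=> _; exact: h|exact: h].
Qed.

Lemma measurable_occupancy (m : J -> nat) : measurable (occ m).
Proof. by apply: measurableI; [exact: measurable_poisson_eq|exact: mcells]. Qed.

Lemma pr_setI1 (A B : set Omega) : measurable A -> measurable B -> pr A = 1 ->
  pr (A `&` B) = pr B.
Proof.
move=> mA mB A1; congr fine; rewrite setIC probability_setI_full//.
by rewrite prE// A1.
Qed.

Lemma occupancy_prob (m : J -> nat) : pr (occ m) =
  expR (- lam) * \prod_j ((lam * M.+1%:R^-1 ^+ l) ^+ m j / (m j)`!%:R).
Proof.
have -> : pr (occ m) = pr [set s | forall j, X s (cell l_le j) = (m j)%:R%:E].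
  by rewrite -[RHS](@pr_setI1 [set s | X s (~` C) = 0])//;
    [exact: measurable_poisson_eq|exact: poisson_off_cube].
case: XP => _ _ _ indep.
pose B (i : 'I_#|{: J}|) := cell l_le (enum_val i : J) : set (borel R d).
have tB : trivIset setT B.
  apply/trivIsetP => i j _ _ /eqP ij; apply/seteqP; split => // y [yi yj]; apply: ij.
  by apply: enum_val_inj; rewrite -(cell_ofE yi) -(cell_ofE yj).
pose A (i : 'I_#|{: J}|) : set (\bar R) := [set (m (enum_val i))%:R%:E].
have := indep _ B (fun i => mcell _) tB A (fun i => emeasurable_set1 _).
rewrite (_ : [set s | _] = [set s | forall j, X s (cell l_le j) = (m j)%:R%:E]); last first.
  apply/seteqP; split => s /=; last by move=> h i; exact: h.
  by move=> h j; have := h (enum_rank j); rewrite /A /B /= enum_rankK.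
rewrite prE; last exact: mcells.
have p1 j : P [set s | X s (cell l_le j) = (m j)%:R%:E] = (expR (- (lam * M.+1%:R^-1 ^+ l)) *
    ((lam * M.+1%:R^-1 ^+ l) ^+ m j / (m j)`!%:R))%:E.
  rewrite prE; last exact: measurable_poisson_eq.
  by rewrite (poisson_eq_prob _ _ (@lebesgue_cube_cell R d l l_le M j))// mulrA.
rewrite (eq_bigr _ (fun i _ => p1 (enum_val i))) prodEFin => -[->].
rewrite -(big_enum_val (fun j : J => expR (- (lam * M.+1%:R^-1 ^+ l)) *
    ((lam * M.+1%:R^-1 ^+ l) ^+ m j / (m j)`!%:R))) /= big_split/=; congr (_ * _).
(* There are (M + 1)^l cells of mass lam (M + 1)^(-l) each, so the exponents add up to - lam. *)
rewrite prodr_const -expRM_natl card_ffun !card_ord; congr expR.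
by rewrite mulrN mulrCA natrX -exprMn divff ?expr1n ?mulr1// pnatr_eq0.
Qed.

(** The left side does not involve [M]: a truncation [K] chosen from it works for every mesh. *)
Lemma occupancy_total (K : nat) :
  \sum_(k < K.+1) pr [set s | X s C = k%:R%:E] <=
  \sum_(m : {ffun J -> 'I_K.+1} | (\sum_j m j <= K)%N) pr (occ (fun j => nat_of_ord (m j))).
Proof.
have mC := @measurable_half_open_cube R d l l_le.
have mE k : measurable [set s | X s C = k%:R%:E] by exact: measurable_poisson_eq.
have -> : \sum_(k < K.+1) pr [set s | X s C = k%:R%:E] =
    pr (\bigcup_(k in [set k : 'I_K.+1 | true]) [set s | X s C = k%:R%:E]).
  rewrite pr_sum// => i j ij; apply/seteqP; split => // s [/= ->] [/eqP].
  by rewrite eqr_nat => /eqP/val_inj/eqP; rewrite (negbTE ij).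
rewrite -pr_sum; last 2 first.
- by move=> m; exact: measurable_occupancy.
- move=> m m' mm'; apply/seteqP; split => // s [ms ms']; move/eqP: mm'; apply.
  by apply/ffunP => j; apply: val_inj; exact: (occupancy_disjoint ms ms').
rewrite -(@pr_setI1 [set s | X s (~` C) = 0]); last 3 first.
- exact: measurable_poisson_eq.
- by apply: fin_bigcup_measurable => //; exact: finite_finset.
- exact: poisson_off_cube.
apply: pr_le.
- apply: measurableI; first exact: measurable_poisson_eq.
  by apply: fin_bigcup_measurable => //; exact: finite_finset.
- apply: fin_bigcup_measurable; first exact: finite_finset.
  by move=> m _; exact: measurable_occupancy.
move=> s [/= sC0 [k _ sk]].
have XT : X s setT = k%:R%:E.
  have -> : X s setT = (X s C + X s (~` C))%E by rewrite -measureU ?setUv ?setICr.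
  by rewrite sC0 adde0.
(* Being of finite mass, [X s] is a finite sum of Dirac masses, so its cell counts are natural
   numbers. *)
have [|q qE] := @point_measure_finite _ _ (X s); first by rewrite XT ltry.
pose n (j : J) := count (fun x => x \in cell l_le j) q.
have nE (j : J) : X s (cell l_le j) = (n j)%:R%:E by rewrite qE// sum_dirac.
have nk : (\sum_j n j = k)%N.
  have := half_open_cube_sum l_le M (X s); rewrite sk (eq_bigr _ (fun j _ => nE j)) sumEFin -natr_sum.
  by move=> -[/eqP]; rewrite eqr_nat => /eqP.
have nj j : (n j < K.+1)%N.
  by rewrite (leq_ltn_trans _ (ltn_ord k))// -nk (bigD1 j)//= leq_addr.
exists [ffun j => Ordinal (nj j)] => /=.
  rewrite (eq_bigr n) => [|j _]; last by rewrite ffunE.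
  by rewrite nk -ltnS.
by split => // j; rewrite ffunE nE.
Qed.

End cells.

Lemma cvg_total_poisson :
  \sum_(k < K.+1) pr [set s | X s C = k%:R%:E] @[K --> \oo] --> (1 : R).
Proof.
have h : (expR (- lam) * series (exp_coeff lam) K.+1) @[K --> \oo] --> expR (- lam) * expR lam.
  apply: cvgMr; rewrite (cvg_shiftS (series (exp_coeff lam))).
  exact: is_cvg_series_exp_coeff.
rewrite -expRD addNr expR0 in h.
apply: cvg_trans h; apply: near_eq_cvg; near=> K.
rewrite /series /= mulr_sumr big_mkord; apply: eq_bigr => k _.
rewrite (poisson_eq_prob _ _ (@lebesgue_cube_half_open R d l l_le)) ?mulr1 ?mulrA//.
exact: measurable_half_open_cube.
Unshelve. all: by end_near. Qed.

End poisson_limit.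

End occupancy.

(** * Convergence in law of the process of uncovered sites *)

Section uncovered_process.
Context (R : realType) (d l : nat).
Hypothesis d_ge3 : (3 <= d.+1)%N.
Hypothesis l_gt0 : (0 < l)%N.
Hypothesis l_le : (l <= d.+1)%N.
Variable c : R.
Hypothesis c_ge : 1000 <= c.
Variable Pwalk : lattice d.+1 -> probability (path_space d.+1) R.
Hypothesis Pwalk_law : forall x, walk_law x (Pwalk x).
Variable nu : {sigma_finite_measure set (trajectory_space d) -> \bar R}.
Hypothesis nuP : interlacement_intensity Pwalk nu.
Context dO (Omega : measurableType dO) (P : probability Omega R).
Variable omega : Omega -> config (trajectory_space d * measurableTypeR R).
Hypothesis omegaP : interlacement_process P nu omega.
Variable z : R.
Local Notation G := (@green_real R d).
Local Notation C := (@half_open_cube R d.+1 l l_le).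
Local Notation X n := (fun s => uncovered_process l n z Pwalk (omega s)).
Local Notation unc n s := (@uncovered_sites R d l dO Omega omega n (G 0 * log_level l z n) s).

Lemma uncovered_processE n s A :
  X n s A = (\sum_(f : {ffun 'I_l -> 'I_n} | f \in unc n s) \d_(rescale R n (site d f)) A)%E.
Proof.
rewrite /= config_measure_onth big_map big_filter big_box_fset//.
apply: eq_bigl => f; rewrite inE card_box//.
by rewrite (greenE d_ge3 c_ge Pwalk_law) subrr -EFinM.
Qed.

Lemma rescale_site_coord n (f : {ffun 'I_l -> 'I_n}) k :
  rescale R n (site d f) 0 (widen_ord l_le k) = (f k)%:R / n%:R.
Proof. by rewrite mxE site_coord -pmulrn. Qed.

Lemma rescale_site_cube n (f : {ffun 'I_l -> 'I_n}) : C (rescale R n (site d f)).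
Proof.
split => k; last by move=> lk; rewrite mxE site_coord0// mul0r.
have n0 : (0 < n)%N by exact: leq_trans (ltn_ord (f k)).
by rewrite rescale_site_coord /= in_itv/= divr_ge0//= ltr_pdivrMr ?ltr0n// mul1r ltr_nat.
Qed.

Lemma rescale_site_cell M n (f : {ffun 'I_l -> 'I_n}) (j : {ffun 'I_l -> 'I_M.+1}) :
  cell l_le j (rescale R n (site d f)) <-> site_cell M f = j.
Proof.
suff h : site_cell M f = cell_of l_le M (rescale R n (site d f)).
  by rewrite h; split => [/cell_ofE|<-] //; exact/cell_ofP/rescale_site_cube.
apply/ffunP => k; rewrite !ffunE rescale_site_coord /coord_cell; congr inord.
have n0 : (0 < n)%N by exact: leq_trans (ltn_ord (f k)).
apply/esym/truncn_def; rewrite mulrA -natrM ler_pdivlMr ?ltr0n// ltr_pdivrMr ?ltr0n//.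
by rewrite -!natrM ler_nat ltr_nat leq_trunc_div/= ltn_ceil.
Qed.

Lemma uncovered_process_off_cube n s : X n s (~` C) = 0%E.
Proof.
rewrite uncovered_processE big1// => f _.
by rewrite diracE memNset//; apply; exact: rescale_site_cube.
Qed.

Lemma uncovered_process_cell M n s (j : {ffun 'I_l -> 'I_M.+1}) :
  X n s (cell l_le j) = (counts (@site_cell M l n) (unc n s) j)%:R%:E.
Proof.
rewrite uncovered_processE ffunE -sum1_card natr_sum -sumEFin big_mkcond [RHS]big_mkcond/=.
apply: eq_bigr => f _; rewrite !inE diracE; case: ifP => //= _.
case: eqVneq => [fj|/eqP fj]; first by rewrite mem_set//; exact/rescale_site_cell.
by rewrite memNset// => /rescale_site_cell.
Qed.

Lemma uncovered_occupancy M n (m : {ffun 'I_l -> 'I_M.+1} -> nat) :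
  occupancy l_le (X n) m =
  [set s | counts (@site_cell M l n) (unc n s) == [ffun j => m j]].
Proof.
apply/seteqP; split => s /=.
  move=> [_ sm]; apply/eqP/ffunP => j; rewrite [RHS]ffunE; apply/eqP.
  by have := sm j; rewrite uncovered_process_cell => -[/eqP]; rewrite eqr_nat.
move=> /eqP e; split => [|j]; first exact: uncovered_process_off_cube.
by rewrite uncovered_process_cell e ffunE.
Qed.

Lemma measurable_uncovered_occupancy M n (m : {ffun 'I_l -> 'I_M.+1} -> nat) :
  measurable (occupancy l_le (X n) m).
Proof.
rewrite uncovered_occupancy.
exact: (measurable_setP (@measurable_uncovered_sites R d l nu dO Omega P omega omegaP n _)
  (fun D => counts (@site_cell M l n) D == [ffun j => m j])).
Qed.

Lemma cvg_uncovered_occupancy M (m : {ffun 'I_l -> 'I_M.+1} -> nat) :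
  pr P (occupancy l_le (X n) m) @[n --> \oo] -->
  expR (- expR (- z)) * \prod_j ((expR (- z) * M.+1%:R^-1 ^+ l) ^+ m j / (m j)`!%:R).
Proof.
under eq_fun do rewrite uncovered_occupancy.
have e : \prod_j ((expR (- z) * M.+1%:R^-1 ^+ l) ^+ m j / (m j)`!%:R) =
    \prod_j ((expR (- z) * M.+1%:R^-1 ^+ l) ^+ [ffun j => m j] j / ([ffun j => m j] j)`!%:R) :> R.
  by apply: eq_bigr => j _; rewrite ffunE.
rewrite e; exact: (@cvg_uncovered_counts R d l d_ge3 l_gt0 l_le c c_ge Pwalk Pwalk_law nu nuP dO Omega P
  omega omegaP z {ffun 'I_l -> 'I_M.+1} (@site_cell M l) (fun=> M.+1%:R^-1 ^+ l)
  (@cvg_site_cell R M l) [ffun j => m j]).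
Qed.

Context dO' (Omega' : measurableType dO') (P' : probability Omega' R).
Variable Y : Omega' -> point_measure R d.+1.
Hypothesis YP : poisson_process P' (fun s => Y s)
  (fun A => ((expR (- z))%:E * lebesgue_cube l A)%E).

Lemma ler_dist_chain (r S Sn rn a an eta : R) : `|r - S| <= a -> `|S - Sn| <= eta ->
  `|rn - Sn| <= an -> `|r - rn| <= a + eta + an.
Proof.
move=> h1 h2 h3; have -> : r - rn = (r - S) + (S - Sn) - (rn - Sn) by ring.
by rewrite (le_trans (ler_normB _ _))// lerD// (le_trans (ler_normD _ _))// lerD.
Qed.

(** B (1 - p) <= del / 16 and B (1 - pn) <= del / 8, which makes 11/16 del in all. Dividing by B + 1
    covers the case B = 0. *)
Lemma error_budget (B p pn del : R) : 0 <= B -> 0 < del -> 1 - del / 16 / (B + 1) <= p ->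
  p - del / 16 / (B + 1) <= pn ->
  2 * (del / 16 + B * (1 - p)) + del / 16 + 2 * (del / 16 + B * (1 - pn)) <= del.
Proof.
move=> B0 d0; set x := _ / (B + 1) => h1 h2.
have xE : x * (B + 1) = del / 16 by rewrite /x divfK// gt_eqF// ltr_wpDl.
have x0 : 0 <= x by rewrite divr_ge0 ?divr_ge0 ?addr_ge0// ltW.
have e1 : B * (1 - p) <= B * x by rewrite ler_wpM2l//; lra.
have e2 : B * (1 - pn) <= B * (x + x) by rewrite ler_wpM2l//; lra.
have Bx : B * x <= del / 16 by rewrite -xE mulrDr mulr1 mulrC lerDl.
by move: e2; rewrite mulrDr => e2; lra.
Qed.

(** One radius for the finitely many numbers of points t <= K. *)
Lemma uniform_mesh (F : point_measure R d.+1 -> R) (K : nat) (eps : R) :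
  continuous F -> 0 < eps -> exists e : R, 0 < e /\
  forall (t : 'I_K.+1) (v w : 'rV['rV[R]_d.+1]_t),
    (forall i, unit_cube (v 0 i)) -> (forall i, ball (v 0 i) e (w 0 i)) ->
    `|F (points v) - F (points w)| <= eps.
Proof.
move=> cF eps0.
have h : \forall e \near 0^'+, 0 < e /\ forall (t : 'I_K.+1) (v w : 'rV['rV[R]_d.+1]_t),
    (forall i, unit_cube (v 0 i)) -> (forall i, ball (v 0 i) e (w 0 i)) ->
    `|F (points v) - F (points w)| <= eps.
  near=> e; split; first by near: e; exact: nbhs_right_gt.
  near: e; apply: filter_forall => t; exact: points_unif_continuous.
exact: (filter_ex h).
Unshelve. all: by end_near. Qed.

Lemma cvg_uncovered_process : cvg_in_law P (fun n => X n) P' Y.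
Proof.
move=> F cF [B0 FB0].
pose B := Num.max 0 B0.
have B_ge0 : 0 <= B by rewrite le_max lexx.
have FB mu : `|F mu| <= B by rewrite (le_trans (FB0 mu))// le_max lexx orbT.
have approxX K M e eps n := @occupancy_approx R d.+1 l l_le dO Omega P (X n) M F K e eps B
  (@measurable_uncovered_occupancy M n) cF FB.
have approxY K M e eps := @occupancy_approx R d.+1 l l_le dO' Omega' P' Y M F K e eps B
  (@measurable_occupancy R d.+1 l l_le dO' Omega' P' Y z YP M) cF FB.
have main (del : R) : 0 < del -> exists2 r, ('E_P'[F \o Y])%E = r%:E &
    \forall n \near \oo, exists2 rn, ('E_P[F \o X n])%E = rn%:E & `|r - rn| <= del.
  move=> del0; have del16 : 0 < del / 16 by rewrite divr_gt0.
  have eta0 : 0 < del / 16 / (B + 1) by rewrite divr_gt0// ltr_wpDl.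
  (* Order of the choices: [K] from the tail of the limiting total, then the radius [e] for at most
     [K] points, then the mesh [M], and [n] last. *)
  have [K _ /(_ K (leqnn K)) KP] : \forall K \near \oo,
      1 - del / 16 / (B + 1) <= \sum_(k < K.+1) pr P' [set s | Y s C = k%:R%:E].
    have := @cvg_total_poisson R d.+1 l l_le dO' Omega' P' Y z YP.
    move=> /cvgrPdist_le/(_ _ eta0); apply: filterS => K.
    by move=> /ler_normlP[_]; rewrite lerBlDr addrC -lerBlDr.
  have [e [e0 eP]] := uniform_mesh K cF del16.
  pose M := Num.truncn e^-1.
  have Me : M.+1%:R^-1 < e.
    by rewrite invf_plt ?posrE ?ltr0n// truncnS_gt.
  have [r rE rle] := approxY K M e _ (ltW del16) Me eP.
  exists r => //.
  pose S := \sum_(m : {ffun {ffun 'I_l -> 'I_M.+1} -> 'I_K.+1} | (\sum_j m j <= K)%N)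
       F (@corner_measure R d.+1 l M (fun j => nat_of_ord (m j))) *
       pr P' (occupancy l_le Y (fun j => nat_of_ord (m j))).
  pose Sn n := \sum_(m : {ffun {ffun 'I_l -> 'I_M.+1} -> 'I_K.+1} | (\sum_j m j <= K)%N)
       F (@corner_measure R d.+1 l M (fun j => nat_of_ord (m j))) *
       pr P (occupancy l_le (X n) (fun j => nat_of_ord (m j))).
  pose p := \sum_(m : {ffun {ffun 'I_l -> 'I_M.+1} -> 'I_K.+1} | (\sum_j m j <= K)%N)
       pr P' (occupancy l_le Y (fun j => nat_of_ord (m j))).
  pose pn n := \sum_(m : {ffun {ffun 'I_l -> 'I_M.+1} -> 'I_K.+1} | (\sum_j m j <= K)%N)
       pr P (occupancy l_le (X n) (fun j => nat_of_ord (m j))).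
  have cvg_occ (m : {ffun 'I_l -> 'I_M.+1} -> nat) :
      pr P (occupancy l_le (X n) m) @[n --> \oo] --> pr P' (occupancy l_le Y m).
    rewrite (@occupancy_prob R d.+1 l l_le dO' Omega' P' Y z YP).
    exact: cvg_uncovered_occupancy.
  have cS : Sn n @[n --> \oo] --> S.
    by apply: cvg_bigsum => m _; apply: cvgMr; exact: cvg_occ.
  have cp : pn n @[n --> \oo] --> p by apply: cvg_bigsum => m _; exact: cvg_occ.
  have pK : 1 - del / 16 / (B + 1) <= p.
    exact: le_trans KP (@occupancy_total R d.+1 l l_le dO' Omega' P' Y z YP M K).
  near=> n.
  have [rn rnE rnle] := approxX K M e _ n (ltW del16) Me eP.
  exists rn => //.
  have SSn : `|S - Sn n| <= del / 16.
    by near: n; move/cvgrPdist_le : cS => /(_ _ del16).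
  have ppn : p - del / 16 / (B + 1) <= pn n.
    have : `|p - pn n| <= del / 16 / (B + 1).
      by near: n; move/cvgrPdist_le : cp => /(_ _ eta0).
    by move=> /ler_normlP[_]; rewrite lerBlDr addrC -lerBlDr.
  exact: le_trans (ler_dist_chain rle SSn rnle) (error_budget B_ge0 del0 pK ppn).
have [r rE _] := main 1 ltr01.
rewrite rE; apply/fine_cvgP; split.
  have [r' _] := main 1 ltr01; apply: filterS => n [rn -> _] //.
apply/cvgrPdist_le => del del0; have [r'] := main del del0.
rewrite rE => -[<-]; apply: filterS => n [rn rnE rnle] /=.
by rewrite rnE.
Unshelve. all: by end_near. Qed.

End uncovered_process.

Theorem corollary0p2 (R : realType) (d l : nat) (z : R)
    (d_ge3 : (3 <= d.+1)%N) (l_bounds : (1 <= l <= d.+1)%N)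
    (Pwalk : lattice d.+1 -> probability (path_space d.+1) R)
    (Pwalk_law : forall x, walk_law x (Pwalk x))
    (nu : {sigma_finite_measure set (trajectory_space d) -> \bar R})
    (nu_intensity : interlacement_intensity Pwalk nu)
    (dO : measure_display) (Omega : measurableType dO)
    (P : probability Omega R)
    (omega : Omega -> config (trajectory_space d * measurableTypeR R))
    (omega_process : interlacement_process P nu omega)
    (dO' : measure_display) (Omega' : measurableType dO')
    (P' : probability Omega' R) (Nlim : Omega' -> point_measure R d.+1)
    (Nlim_poisson : poisson_process P' (fun s => Nlim s)
       (fun A => ((expR (- z))%:E * lebesgue_cube l A)%E)) :
  cvg_in_law P (fun N s => uncovered_process l N z Pwalk (omega s)) P' Nlim.
Proof.
have /andP[l_gt0 l_le] := l_bounds.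
(* [lexx 1000] sets c = 1000. *)
exact: (cvg_uncovered_process d_ge3 l_gt0 l_le (lexx 1000) Pwalk_law nu_intensity
  omega_process Nlim_poisson).
Qed.
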